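(* Let $\mathcal G$ be a connected noncompact metric graph with exactly one halfline and no terminal point, and consider the critical energy ($p=6$). Then $\mu_{\mathcal G}=\mu_{\mathbb R^+}$; $-\infty<\mathcal E_{\mathcal G}(\mu)<0$ for every $\mu\in(\mu_{\mathbb R^+},\mu_{\mathbb R}]$; and $\mathcal E_{\mathcal G}(\mu)$ is attained if and only if $\mu\in(\mu_{\mathbb R^+},\mu_{\mathbb R}]$.
   Context: Metric graphs have finitely many edges and vertices, bounded edges identified with $[0,\ell_e]$ and halflines with $[0,\infty)$ (far endpoints: vertices at infinity). A terminal point is a vertex of degree one that is not a vertex at infinity. $H^1_\mu(\mathcal G)$: continuous functions, $H^1$ on each edge, $\|u\|_2^2=\mu$. $E(u,\mathcal G)=\frac12\int|u'|^2-\frac16\int|u|^6$, $\mathcal E_{\mathcal G}(\mu)=\inf_{H^1_\mu(\mathcal G)}E(\cdot,\mathcal G)$, defined for $\mu>0$. For a graph $X$, $K_X=\sup_{u\in H^1(X),u\ne0}\frac{\|u\|_6^6}{\|u\|_2^4\|u'\|_2^2}$ and $\mu_X=\sqrt{3/K_X}$; $\mu_{\mathbb R}=\pi\sqrt3/2$, $\mu_{\mathbb R^+}=\pi\sqrt3/4$. *)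

(* Defs.v *)
From HB Require Import structures.
From mathcomp Require Import all_boot all_order all_algebra.
From mathcomp Require Import all_classical all_reals all_analysis.
Set Implicit Arguments. Unset Strict Implicit. Unset Printing Implicit Defensive.
Import Order.TTheory GRing.Theory Num.Theory.
Import numFieldNormedType.Exports.
Local Open Scope classical_set_scope.
Local Open Scope ring_scope.

(* A metric graph with finitely many edges:
   - V  : the (finite) vertices (not at infinity),
   - BE : bounded edges e, identified with [0, blen e], 0 ~ bsrc e, blen e ~ btgt e,
   - HL : halflines h, identified with [0, +oo), 0 ~ hsrc h (the far endpoint
          is a vertex at infinity, not an element of V).
   Self-loops and multiple edges are allowed. *)
Record metric_graph (R : realType) := MetricGraph {
  V : finType;
  BE : finType;
  HL : finType;
  bsrc : BE -> V;
  btgt : BE -> V;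
  blen : BE -> R;
  blen_gt0 : forall e, 0 < blen e;
  hsrc : HL -> V }.

Section Graphs.
Variable R : realType.
Variable G : metric_graph R.

(* degree of a (finite) vertex; a self-loop counts twice *)
Definition deg (v : V G) : nat :=
  #|[set e | bsrc e == v]| + #|[set e | btgt e == v]| + #|[set h | hsrc h == v]|.

Definition terminal_point (v : V G) : Prop := deg v = 1%N.

Definition adj : rel (V G) := fun v w =>
  [exists e, ((bsrc e == v) && (btgt e == w)) || ((bsrc e == w) && (btgt e == v))].

(* the metric graph is connected (halflines are attached to a vertex, so
   this is connectivity of the vertices through bounded edges) *)
Definition connected_graph : Prop := forall v w : V G, connect adj v w.

End Graphs.

Section Sobolev.
Variable R : realType.
Local Notation leb := (@lebesgue_measure R).

(* u in H^1(0,l) with (weak) derivative g : g in L^2(0,l) and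
   u x = u 0 + int_0^x g for all x in [0,l] *)
Definition H1_seg (l : R) (u g : R -> R) : Prop :=
  [/\ measurable_fun `[0%R, l] g,
      (\int[leb]_(x in `[0%R, l]) ((g x) ^+ 2)%:E < +oo)%E &
      forall x, 0 <= x <= l -> u x = u 0 + Rintegral leb `[0%R, x] g].

Definition H1_hl (u g : R -> R) : Prop :=
  [/\ measurable_fun `[(0:R)%R, +oo[ g,
      (\int[leb]_(x in `[(0:R)%R, +oo[) ((g x) ^+ 2)%:E < +oo)%E,
      (\int[leb]_(x in `[(0:R)%R, +oo[) ((u x) ^+ 2)%:E < +oo)%E &
      forall x, 0 <= x -> u x = u 0 + Rintegral leb `[0%R, x] g].

Variable G : metric_graph R.

(* a (real-valued) function on G, edge by edge, together with a choice
   of its edgewise derivative *)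
Record gfun := GFun {
  ub : BE G -> R -> R;
  gb : BE G -> R -> R;
  uh : HL G -> R -> R;
  gh : HL G -> R -> R }.

Definition H1 (f : gfun) : Prop :=
  (exists phi : V G -> R,
     (forall e, ub f e 0 = phi (bsrc e) /\ ub f e (blen e) = phi (btgt e)) /\
     (forall h, uh f h 0 = phi (hsrc h))) /\
  (forall e, H1_seg (blen e) (ub f e) (gb f e)) /\
  (forall h, H1_hl (uh f h) (gh f h)).

Definition gint (F : R -> R) (u : BE G -> R -> R) (w : HL G -> R -> R) : \bar R :=
  (\sum_(e : BE G) \int[leb]_(x in `[0%R, blen e]) (F (u e x))%:E +
   \sum_(h : HL G) \int[leb]_(x in `[(0:R)%R, +oo[) (F (w h x))%:E)%E.

Definition mass (f : gfun) : \bar R := gint (fun y => y ^+ 2) (ub f) (uh f).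
Definition dnorm (f : gfun) : \bar R := gint (fun y => y ^+ 2) (gb f) (gh f).
Definition p6 (f : gfun) : \bar R := gint (fun y => `|y| ^+ 6) (ub f) (uh f).

Definition energy (f : gfun) : \bar R :=
  ((2^-1)%:E * dnorm f - (6^-1)%:E * p6 f)%E.

Definition H1_mu (m : R) (f : gfun) : Prop := H1 f /\ mass f = m%:E.

Definition Elev (m : R) : \bar R := ereal_inf [set energy f | f in H1_mu m].

Definition KG : \bar R :=
  ereal_sup [set (fine (p6 f) / (fine (mass f) ^+ 2 * fine (dnorm f)))%:E
            | f in [set f | H1 f /\ mass f <> 0%E]].

Definition muG : R := Num.sqrt (3 / fine KG).

End Sobolev.

Definition mu_line (R : realType) : R := pi * Num.sqrt 3 / 2.
Definition mu_halfline (R : realType) : R := pi * Num.sqrt 3 / 4.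

(* Main.v *)
(* Let [u] be a function on the graph and [A >= max |u|].  The energy density plus [A^4 u^2 / 6]
   equals [(u'^2 + (A^4 u^2 - u^6) / 3) / 2], which by AM-GM dominates [|(calib A o u)'|], where
   [calib A] is a primitive of [sqrt ((A^4 u^2 - u^6) / 3)].  Hence the variation of [calib A o u]
   along disjoint paths bounds [E(u) + A^4 m / 6] from below, [m] being the mass of [u].

   One path from a maximum point of [|u|] to infinity is worth [calib A A = A^4 mu_halfline / 6];
   since it avoids a set of positive mass, [E(u) > 0] when [m <= mu_halfline], which by scaling is
   the Gagliardo-Nirenberg inequality with the constant of the halfline.  In the absence of
   terminal points there are two disjoint ways to leave the maximum point, each worth [calib A A]
   up to an error O(m / max |u|^2), so for [m <= mu_line] the functions of energy below a negative
   level are uniformly bounded.  Minimising families then converge along an ultrafilter, locally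
   uniformly and weakly in H^1; the energy of the tail lost at infinity is nonnegative in the
   limit, and a loss of mass is repaired by scaling, which lowers a negative energy.

   The competitors are constant on the compact core and equal to a truncated soliton
   [A sech^(1/2) (k x - T)] on the halfline: [T = 0] gives the optimal constant and the negative
   energies for [m > mu_halfline], and large [T] gives energies tending to -oo for
   [m > mu_line]. *)
Require Import Defs.
From HB Require Import structures.
From mathcomp Require Import all_boot all_order all_algebra.
From mathcomp Require Import all_classical all_reals all_analysis.
From mathcomp Require Import measurable_realfun.
From mathcomp Require Import ring lra.
Set Implicit Arguments. Unset Strict Implicit. Unset Printing Implicit Defensive.
Import Order.TTheory GRing.Theory Num.Theory.
Import numFieldNormedType.Exports.
Local Open Scope classical_set_scope.
Local Open Scope ring_scope.

Local Notation leb := (@lebesgue_measure _).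
Local Notation Rintegrable D f := (leb.-integrable D (EFin \o f)).
Local Notation edge G := (BE G + HL G)%type.

Section RealInequalities.
Variable R : realType.
Implicit Types c e p x y : R.

Lemma ler_even_exprn_norm n x y : ~~ odd n -> `|x| <= y -> x ^+ n <= y ^+ n.
Proof.
move=> nE xy; rewrite -[leLHS]ger0_norm ?exprn_even_ge0// normrX lerXn2r ?nnegrE//.
exact: le_trans xy.
Qed.

Lemma ler_sqr_norm x y : `|x| <= y -> x ^+ 2 <= y ^+ 2.
Proof. exact: ler_even_exprn_norm. Qed.

Lemma ler_norm_weighted_sqr p y : 0 < p -> `|y| <= p * y ^+ 2 + p^-1.
Proof.
move=> p0; rewrite -(real_normK (num_real y)); have := normr_ge0 y; set z := `|y| => z0.
rewrite -(ler_pM2r p0) mulrDl mulVf ?gt_eqF//.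
have := sqr_ge0 (p * z - 1); have := mulr_ge0 (ltW p0) z0; lra.
Qed.

Lemma ler_addgt0MP x y c : 0 <= c -> (forall e, 0 < e -> x <= y + c * e) -> x <= y.
Proof.
move=> c0 xy; apply/ler_addgt0Pr => e e0.
have c1 : 0 < c + 1 by rewrite ltr_wpDl.
apply: le_trans (xy (e / (c + 1)) _) _; first by rewrite divr_gt0.
by rewrite lerD2l mulrA ler_pdivrMr// mulrC ler_pM2l// lerDl.
Qed.

Lemma exists_exprV2_le e : 0 < e -> exists n, (2 ^+ n)^-1 <= e.
Proof.
move=> e0; exists (Num.truncn e^-1).+1; rewrite invf_ple ?posrE ?exprn_gt0//.
apply: le_trans (ltW (truncnS_gt _)) _.
by rewrite -natrX ler_nat ltnW// ltn_expl.
Qed.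

Lemma ler_invXn2l x m n : 1 <= x -> (m <= n)%N -> x ^- n <= x ^- m.
Proof.
move=> x1 mn; have x0 : 0 < x := lt_le_trans ltr01 x1.
by rewrite lef_pV2 ?posrE ?exprn_gt0// ler_weXn2l.
Qed.

Lemma exprn_lipschitz (M : R) n : 0 <= M -> exists2 K : R, 0 <= K &
  forall x y, `|x| <= M -> `|y| <= M -> `|x ^+ n - y ^+ n| <= K * `|x - y|.
Proof.
move=> M0; elim: n => [|n [K K0 IH]].
  by exists 0 => // x y _ _; rewrite !expr0 subrr normr0 mul0r.
exists (M * K + M ^+ n) => [|x y xM yM]; first by rewrite addr_ge0 ?mulr_ge0 ?exprn_ge0.
have -> : x ^+ n.+1 - y ^+ n.+1 = x * (x ^+ n - y ^+ n) + y ^+ n * (x - y).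
  by rewrite !exprS; ring.
apply: le_trans (ler_normD _ _) _; rewrite !normrM mulrDl lerD//.
  by rewrite -mulrA ler_pM// IH.
by rewrite ler_wpM2r// normrX lerXn2r ?nnegrE.
Qed.

Lemma within_continuous_asin : {within `[-1, 1], continuous (@asin R)}.
Proof.
have pi0 := pi_ge0 R.
have := @segment_can_le_continuous R (- (pi / 2)) (pi / 2) sin asin.
rewrite sinN sin_pihalf; apply; first by lra.
- by apply: continuous_subspaceT; exact: continuous_sin.
- by move=> y yi; rewrite sinK.
Qed.

Lemma cvg_exprn (T : Type) (F : set_system T) {FF : Filter F} (f : T -> R) (l : R) n :
  f t @[t --> F] --> l -> f t ^+ n @[t --> F] --> l ^+ n.
Proof.
move=> fl; apply: (@cvg_comp _ _ _ f (fun y => y ^+ n) _ _ _ fl); exact: exprn_continuous.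
Qed.

End RealInequalities.

Section Integrals.
Variable R : realType.
Implicit Types (D E : set R) (f g : R -> R) (c r s t : R).

Lemma RintegrableD D f g : measurable D -> Rintegrable D f -> Rintegrable D g ->
  Rintegrable D (fun x => f x + g x).
Proof. by move=> mD fi gi; apply: (eq_integrable _ _ _ _ (integrableD _ fi gi)). Qed.

Lemma RintegrableB D f g : measurable D -> Rintegrable D f -> Rintegrable D g ->
  Rintegrable D (fun x => f x - g x).
Proof. by move=> mD fi gi; apply: (eq_integrable _ _ _ _ (integrableB _ fi gi)). Qed.

Lemma RintegrableZl D c f : measurable D -> Rintegrable D f -> Rintegrable D (fun x => c * f x).
Proof. by move=> mD fi; apply: (eq_integrable _ _ _ _ (integrableZl _ c fi)). Qed.

Lemma RintegrableS D E f : measurable D -> measurable E -> E `<=` D ->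
  Rintegrable D f -> Rintegrable E f.
Proof. by move=> mD mE ED fi; apply: integrableS fi. Qed.

Lemma Rintegrable_measurable D f : Rintegrable D f -> measurable_fun D f.
Proof. by move=> fi; apply/measurable_EFinP; exact: measurable_int fi. Qed.

Lemma le_Rintegrable D f g : measurable D -> measurable_fun D f ->
  (forall x, D x -> `|f x| <= g x) -> Rintegrable D g -> Rintegrable D f.
Proof.
move=> mD mf fg; apply: le_integrable => //; first exact/measurable_EFinP.
by move=> x Dx /=; rewrite lee_fin (le_trans (fg x Dx))// ler_norm.
Qed.

Lemma ge0_Rintegrable D f : measurable D -> measurable_fun D f ->
  (forall x, D x -> 0 <= f x) -> (\int[leb]_(x in D) (f x)%:E < +oo)%E -> Rintegrable D f.
Proof.
move=> mD mf f0 fy; apply/integrableP; split; first exact/measurable_EFinP.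
move: fy; congr (_ < _)%E; apply: eq_integral => x; rewrite inE => Dx /=.
by rewrite ger0_norm ?f0.
Qed.

Lemma EFin_Rintegral D f : measurable D -> Rintegrable D f ->
  (\int[leb]_(x in D) (f x)%:E)%E = (\int[leb]_(x in D) f x)%:E.
Proof. by move=> mD fi; rewrite /Rintegral fineK//; exact: integrable_fin_num fi. Qed.

Lemma Rintegrable_cst s t c : Rintegrable `[s, t] (fun=> c).
Proof.
by apply: continuous_compact_integrable; [exact: segment_compact|exact: cst_continuous].
Qed.

Lemma Rintegral_itv_cst s t c : s <= t -> \int[leb]_(x in `[s, t]) c = c * (t - s).
Proof.
move=> st; rewrite Rintegral_cst//; congr (_ * _).
transitivity (fine (t - s)%:E); last by [].
congr fine; rewrite [LHS](lebesgue_measure_itv `[s, t])/= lte_fin.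
by move: st; rewrite le_eqVlt => /predU1P[->|->//]; rewrite ltxx subrr.
Qed.

Lemma Rintegral_itv_split s r (b : itv_bound R) f : s <= r -> (BRight r <= b)%O ->
  Rintegrable [set` Interval (BLeft s) b] f ->
  \int[leb]_(x in [set` Interval (BLeft s) b]) f x =
  \int[leb]_(x in `[s, r]) f x + \int[leb]_(x in [set` Interval (BLeft r) b]) f x.
Proof.
move=> sr rb fi; have := Rintegral_itvB fi _ rb; rewrite bnd_simp => /(_ sr).
rewrite Rintegral_itv_obnd_cbnd => [<-|]; first by rewrite addrC subrK.
by apply: RintegrableS fi => //; apply: subset_itvr; rewrite bnd_simp.
Qed.

Lemma Rintegral_itv1 s f : \int[leb]_(x in `[s, s]) f x = 0.
Proof. by rewrite set_itv1 Rintegral_set1. Qed.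

Lemma ge0_subset_Rintegral D E f : measurable D -> measurable E -> E `<=` D ->
  (forall x, D x -> 0 <= f x) -> Rintegrable D f ->
  \int[leb]_(x in E) f x <= \int[leb]_(x in D) f x.
Proof.
move=> mD mE ED f0 fi; have fiE : Rintegrable E f by apply: RintegrableS fi.
rewrite -lee_fin -!EFin_Rintegral//; apply: ge0_subset_integral => //.
by apply/measurable_EFinP; exact: Rintegrable_measurable fi.
Qed.

Lemma Rintegral_sqr_ge0 D f : 0 <= \int[leb]_(x in D) f x ^+ 2.
Proof. by apply: Rintegral_ge0 => x _; exact: sqr_ge0. Qed.

Lemma subset_Rintegral_sqr D E f : measurable D -> measurable E -> E `<=` D ->
  Rintegrable D (fun x => f x ^+ 2) ->
  \int[leb]_(x in E) f x ^+ 2 <= \int[leb]_(x in D) f x ^+ 2.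
Proof. by move=> mD mE ED; apply: ge0_subset_Rintegral => // x _; exact: sqr_ge0. Qed.

Lemma ge0_Rintegral_tail f e : Rintegrable `[0, +oo[ f -> (forall x, 0 <= x -> 0 <= f x) ->
  0 < e -> \forall N \near +oo, \int[leb]_(x in `[N, +oo[) f x <= e.
Proof.
move=> fi f0 e0; pose F (n : nat) : set R := `[0, n%:R]%classic.
have FU : \bigcup_n F n = [set` `[(0:R), +oo[].
  rewrite eqEsubset; split=> [x [n _]|x]; rewrite /F/= !in_itv/= ?andbT; first by case/andP.
  by move=> x0; exists (Num.truncn x).+1; rewrite //= in_itv/= x0 ltW// truncnS_gt.
have ndF : {homo F : n m / (n <= m)%N >-> (n <= m)%O}.
  move=> n m nm; apply/subsetPset => x; rewrite /F/= !in_itv/= => /andP[-> xn]/=.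
  by rewrite (le_trans xn)// ler_nat.
have Fs n : F n `<=` `[0, +oo[ by rewrite -FU => x Fx; exists n.
have : (\int[leb]_(x in F n) (f x)%:E)%E @[n --> \oo] --> (\int[leb]_(x in `[0%R, +oo[) (f x)%:E)%E.
  rewrite -FU; apply: ge0_nondecreasing_set_cvg_integral => //.
  - by move=> n; exact: measurable_itv.
  - by move=> n; apply: measurable_funS (measurable_int _ fi).
  - by move=> n x /Fs; rewrite /= in_itv/= andbT lee_fin; exact: f0.
have FE n : (\int[leb]_(x in F n) (f x)%:E)%E = (\int[leb]_(x in F n) f x)%:E.
  by apply: EFin_Rintegral; last apply: RintegrableS fi => //; exact: measurable_itv.
rewrite EFin_Rintegral// (eq_cvg _ _ FE).
move/fine_cvgP => [_] /= /cvgrPdist_le/(_ e e0)[n _ /(_ n (leqnn n))/=].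
rewrite (Rintegral_itv_split (ler0n R n) _ fi)// addrC addKr => /(le_trans (ler_norm _)) fe.
near=> N; have nN : n%:R <= N by near: N; exact: nbhs_pinfty_ge (num_real _).
apply: le_trans fe; apply: ge0_subset_Rintegral => //.
- by move=> x; rewrite /= !in_itv/= !andbT; exact: le_trans.
- by move=> x; rewrite /= in_itv/= andbT => nx; apply: f0; exact: le_trans nx.
- by apply: RintegrableS fi => // x; rewrite /= !in_itv/= !andbT; exact: le_trans.
Unshelve. all: by end_near. Qed.

End Integrals.

Section SquareIntegrable.
Variable R : realType.
Implicit Types (D E : set R) (f g : R -> R) (c s t tau : R).

Definition sqr_integrable D f := measurable_fun D f /\ Rintegrable D (fun x => f x ^+ 2).

Lemma sqr_integrableS D E f : measurable D -> measurable E -> E `<=` D ->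
  sqr_integrable D f -> sqr_integrable E f.
Proof.
move=> mD mE ED [mf f2]; split; first exact: measurable_funS mf.
exact: RintegrableS f2.
Qed.

Lemma sqr_integrableZl D c f : measurable D -> sqr_integrable D f ->
  sqr_integrable D (fun x => c * f x).
Proof.
move=> mD [mf f2]; split; first by apply: measurable_funM => //; exact: measurable_cst.
rewrite (_ : (fun x => (c * f x) ^+ 2) = (fun x => c ^+ 2 * f x ^+ 2)); first exact: RintegrableZl.
by apply/funext => x; rewrite exprMn.
Qed.

Lemma sqr_integrableD D f g : measurable D -> sqr_integrable D f -> sqr_integrable D g ->
  sqr_integrable D (fun x => f x + g x).
Proof.
move=> mD [mf f2] [mg g2]; have mfg := measurable_funD mf mg; split=> //.
apply: (@le_Rintegrable _ _ _ (fun x => 2 * f x ^+ 2 + 2 * g x ^+ 2)) => //.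
- exact: measurable_funX.
- by move=> x _; rewrite ger0_norm ?sqr_ge0//; have := sqr_ge0 (f x - g x); nra.
- by apply: RintegrableD => //; exact: RintegrableZl.
Qed.

Lemma sqr_integrableB D f g : measurable D -> sqr_integrable D f -> sqr_integrable D g ->
  sqr_integrable D (fun x => f x - g x).
Proof.
move=> mD fi /(sqr_integrableZl (-1) mD) gi.
rewrite (_ : (fun x => f x - g x) = (fun x => f x + -1 * g x)); first exact: sqr_integrableD.
by apply/funext => x; rewrite mulN1r.
Qed.

Lemma sqr_integrable_itv s t f : sqr_integrable `[s, t] f -> Rintegrable `[s, t] f.
Proof.
move=> [mf f2]; apply: (@le_Rintegrable _ _ _ (fun x => 1 * f x ^+ 2 + 1)) => //.
  by move=> x _; have := ler_norm_weighted_sqr (f x) ltr01; rewrite invr1.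
by apply: RintegrableD; [|exact: RintegrableZl|exact: Rintegrable_cst].
Qed.

Lemma le_normr_Rintegral_sqr s t tau f : s <= t -> 0 < tau -> sqr_integrable `[s, t] f ->
  `|\int[leb]_(x in `[s, t]) f x| <= tau * \int[leb]_(x in `[s, t]) f x ^+ 2 + (t - s) / tau.
Proof.
move=> st tau0 f2; have fi := sqr_integrable_itv f2; have [_ f2i] := f2.
apply: le_trans (le_normr_Rintegral _ fi) _ => //.
rewrite -RintegralZl// [(t - s) / tau]mulrC -(Rintegral_itv_cst _ st) -RintegralD//; last 2 first.
- exact: RintegrableZl.
- exact: Rintegrable_cst.
apply: le_Rintegral => //.
- exact: (integrable_norm fi).
- by apply: RintegrableD => //; [exact: RintegrableZl|exact: Rintegrable_cst].
- by move=> x _; exact: ler_norm_weighted_sqr.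
Qed.

End SquareIntegrable.

(** * Sobolev functions on an interval *)

Section InitialSegment.
Variable R : realType.
Implicit Types (D : set R) (l s t : R).

Definition initial_segment D := [/\ is_interval D, D 0 & D `<=` `[0, +oo[].

Lemma initial_segment_itvcc l : 0 <= l -> initial_segment `[0, l].
Proof.
move=> l0; split; first exact: interval_is_interval.
  by rewrite /= in_itv/= lexx l0.
by move=> x; rewrite /= !in_itv/= andbT => /andP[].
Qed.

Lemma initial_segment_itvcy : initial_segment `[0, +oo[.
Proof. by split => //; [exact: interval_is_interval|rewrite /= in_itv/= lexx]. Qed.

Lemma initial_segment_measurable D : initial_segment D -> measurable D.
Proof. by case=> iD _ _; exact: is_interval_measurable. Qed.

Lemma initial_segment_ge0 D t : initial_segment D -> D t -> 0 <= t.
Proof. by move=> [_ _ D0] /D0; rewrite /= in_itv/= andbT. Qed.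

Lemma initial_segment_subset D s t : initial_segment D -> 0 <= s -> D t -> `[s, t] `<=` D.
Proof.
move=> [iD D0 _] s0 Dt x /=; rewrite in_itv/= => /andP[sx xt].
by apply: (iD _ _ D0 Dt); rewrite xt (le_trans s0 sx).
Qed.

End InitialSegment.

Section H1on_theory.
Variable R : realType.
Implicit Types (C c eta p q s t tau A : R).

Definition H1on (D : set R) (u g : R -> R) :=
  [/\ sqr_integrable D g, Rintegrable D (fun x => u x ^+ 2) &
    forall x, D x -> u x = u 0 + \int[leb]_(y in `[0, x]) g y].

Variables (D : set R) (u g : R -> R).
Hypotheses (sD : initial_segment D) (ug : H1on D u g).
Let mD : measurable D. Proof. exact: initial_segment_measurable. Qed.

Lemma H1on_sqr_integrable_itv s t : 0 <= s -> D t -> sqr_integrable `[s, t] g.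
Proof.
move=> s0 Dt; case: ug => g2 _ _; apply: sqr_integrableS g2 => //.
exact: initial_segment_subset.
Qed.

Lemma H1on_Rintegrable_itv s t : 0 <= s -> D t -> Rintegrable `[s, t] g.
Proof. by move=> s0 Dt; apply: sqr_integrable_itv; exact: H1on_sqr_integrable_itv. Qed.

Lemma H1on_FTC s t : 0 <= s <= t -> D t -> u t - u s = \int[leb]_(x in `[s, t]) g x.
Proof.
case: ug => _ _ Hu /andP[s0 st] Dt.
have Ds : D s by apply: (initial_segment_subset sD s0 Dt); rewrite /= in_itv/= lexx st.
rewrite (Hu t Dt) (Hu s Ds) (Rintegral_itv_split s0)//; first by ring.
exact: H1on_Rintegrable_itv.
Qed.

Lemma H1on_dist_le s t tau : D s -> D t -> 0 < tau ->
  `|u t - u s| <= tau * \int[leb]_(x in D) g x ^+ 2 + `|t - s| / tau.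
Proof.
move=> Ds Dt tau0; wlog st : s t Ds Dt / s <= t.
  move=> dist; have [st|/ltW ts] := leP s t; first exact: dist.
  by rewrite distrC (distrC t); exact: dist.
have s0 : 0 <= s := initial_segment_ge0 sD Ds.
rewrite H1on_FTC ?s0// (ger0_norm (x := t - s)) ?subr_ge0//.
apply: le_trans (le_normr_Rintegral_sqr st tau0 (H1on_sqr_integrable_itv s0 Dt)) _.
rewrite lerD2r ler_pM2l//; apply: subset_Rintegral_sqr => //.
  exact: initial_segment_subset.
by case: ug => -[].
Qed.

Lemma H1on_equicontinuous C eta s t : 0 < C -> 0 < eta ->
  \int[leb]_(x in D) g x ^+ 2 <= C -> D s -> D t ->
  `|t - s| <= eta ^+ 2 / (4 * C) -> `|u t - u s| <= eta.
Proof.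
move=> C0 e0 gC Ds Dt ts; have tau0 : 0 < eta / (2 * C) by rewrite divr_gt0// mulr_gt0.
apply: le_trans (H1on_dist_le Ds Dt tau0) _.
have : eta / (2 * C) * \int[leb]_(x in D) g x ^+ 2 <= eta / 2.
  apply: le_trans (ler_wpM2l (ltW tau0) gC) _.
  by rewrite le_eqVlt; apply/orP; left; apply/eqP; field; rewrite gt_eqF.
have : `|t - s| / (eta / (2 * C)) <= eta / 2.
  rewrite ler_pdivrMr// [leRHS](_ : _ = eta ^+ 2 / (4 * C))//.
  by field; rewrite gt_eqF.
lra.
Qed.

Lemma H1on_uniformly_continuous eta : 0 < eta -> exists2 d : R, 0 < d &
  forall s t, D s -> D t -> `|t - s| <= d -> `|u t - u s| <= eta.
Proof.
move=> eta0; pose C := \int[leb]_(x in D) g x ^+ 2 + 1.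
have C0 : 0 < C by rewrite ltr_wpDl// Rintegral_sqr_ge0.
exists (eta ^+ 2 / (4 * C)); first by rewrite divr_gt0 ?exprn_gt0// mulr_gt0.
by move=> s t Ds Dt; apply: H1on_equicontinuous => //; rewrite /C lerDl.
Qed.

Lemma H1on_continuous : {within D, continuous u}.
Proof.
apply/subspace_continuousP => x Dx; apply/cvgrPdist_le => e e0.
have [d d0 ud] := H1on_uniformly_continuous e0.
rewrite near_withinE; near=> y => Dy; apply: (ud _ _ Dy Dx).
by near: y; apply: (@cvgr_dist_le _ _ _ _ _ id).
Unshelve. all: by end_near. Qed.

Lemma H1on_measurable : measurable_fun D u.
Proof. by apply: subspace_continuous_measurable_fun => //; exact: H1on_continuous. Qed.

Lemma H1on_continuous_norm s t : 0 <= s -> D t ->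
  {within `[s, t], continuous (fun x => `|u x|)}.
Proof.
move=> s0 Dt; have /subspace_continuousP cu : {within `[s, t], continuous u}.
  by apply: continuous_subspaceW H1on_continuous; exact: initial_segment_subset.
by apply/subspace_continuousP => x xst; apply: cvg_norm; exact: cu.
Qed.

Lemma H1on_Rintegrable_exprn A n : (forall x, D x -> `|u x| <= A) ->
  Rintegrable D (fun x => u x ^+ n.+2).
Proof.
move=> uA; have u2 : Rintegrable D (fun x => u x ^+ 2) by case: ug.
apply: (@le_Rintegrable _ _ _ (fun x => A ^+ n * u x ^+ 2)) => //.
- by apply: measurable_funX; exact: H1on_measurable.
- move=> x Dx; rewrite -addn2 exprD normrM normrX (ger0_norm (sqr_ge0 _)).
  by rewrite ler_wpM2r ?sqr_ge0// lerXn2r ?nnegrE// ?uA// (le_trans _ (uA x Dx)).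
- exact: RintegrableZl.
Qed.

Lemma H1on_local_mass_ge eta : 0 < eta -> exists2 d : R, 0 < d &
  forall c p q, D c -> eta <= `|u c| -> 0 <= p -> D q -> c - d <= p -> p <= q -> q <= c + d ->
  (eta / 2) ^+ 2 * (q - p) <= \int[leb]_(x in `[p, q]) u x ^+ 2.
Proof.
move=> eta0; have eta20 : 0 < eta / 2 by rewrite divr_gt0.
have [d d0 ud] := H1on_uniformly_continuous eta20; exists d => // c p q Dc uc p0 Dq cp pq qc.
have pqD := initial_segment_subset sD p0 Dq.
rewrite -Rintegral_itv_cst//; apply: le_Rintegral => //; first exact: Rintegrable_cst.
  by case: ug => _ u2 _; apply: RintegrableS u2.
move=> x xpq; have Dx := pqD _ xpq; move: xpq; rewrite /= in_itv/= => /andP[px xq].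
have : `|u x - u c| <= eta / 2 by apply: ud => //; rewrite ler_norml; apply/andP; split; lra.
rewrite distrC => /(le_trans (lerB_dist _ _)) ux.
by rewrite -(real_normK (num_real (u x))) ler_sqr ?nnegrE//; lra.
Qed.

Lemma H1on_mass_gt0 s t c : 0 <= s -> s < t -> D t -> s <= c <= t -> u c != 0 ->
  0 < \int[leb]_(x in `[s, t]) u x ^+ 2.
Proof.
move=> s0 st Dt /andP[sc ct] uc; have uc0 : 0 < `|u c| by rewrite normr_gt0.
have [d d0 ud] := H1on_local_mass_ge uc0.
pose p := Num.max s (c - d); pose q := Num.min t (c + d).
have sp : s <= p by rewrite le_max lexx.
have qt : q <= t by rewrite ge_min lexx.
have pq : p < q.
  by rewrite /p /q gt_max !lt_min st/=; apply/andP; split; [|apply/andP; split]; lra.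
have subD := initial_segment_subset sD s0 Dt.
have subpq : `[p, q] `<=` `[s, t] by apply: subset_itv; rewrite bnd_simp.
apply: (@lt_le_trans _ _ ((`|u c| / 2) ^+ 2 * (q - p))).
  by rewrite mulr_gt0 ?subr_gt0// exprn_gt0// divr_gt0.
apply: (@le_trans _ _ (\int[leb]_(x in `[p, q]) u x ^+ 2)).
  apply: (ud c) => //; rewrite ?(le_trans s0 sp) ?(ltW pq)//.
  - by apply: subD; rewrite /= in_itv/= sc.
  - by apply: subD; apply: subpq; rewrite /= in_itv/= lexx ltW.
  - by rewrite le_max lexx orbT.
  - by rewrite ge_min lexx orbT.
apply: subset_Rintegral_sqr => //.
by case: ug => _ u2 _; exact: RintegrableS u2.
Qed.

End H1on_theory.

Section H1on_halfline.
Variables (R : realType) (u g : R -> R).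
Hypothesis ug : H1on `[0, +oo[ u g.
Let sD := initial_segment_itvcy R.

Lemma H1on_cvgy0 : u x @[x --> +oo] --> 0.
Proof.
apply/cvgr0Pnorm_le => e e0; have [d d0 ud] := H1on_local_mass_ge sD ug e0.
have [_ u2 _] := ug.
have small : 0 < (e / 2) ^+ 2 * d / 2 by rewrite divr_gt0// mulr_gt0// exprn_gt0// divr_gt0.
have tail := ge0_Rintegral_tail u2 (fun x _ => sqr_ge0 _) small.
near=> x; rewrite leNgt; apply/negP => ex.
have x0 : 0 <= x by near: x; exact: nbhs_pinfty_ge (num_real _).
have xx : `[0, +oo[%classic x by rewrite /= in_itv/= x0.
have xd : `[0, +oo[%classic (x + d) by rewrite /= in_itv/= andbT addr_ge0// ltW.
have := ud x x (x + d) xx (ltW ex) x0 xd.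
rewrite lerBlDr lerDl addrAC subrr add0r ltW// => /(_ isT isT (lexx _)).
have : \int[leb]_(y in `[x, x + d]) u y ^+ 2 <= \int[leb]_(y in `[x, +oo[) u y ^+ 2.
  apply: subset_Rintegral_sqr => //; first by apply: subset_itvl; rewrite bnd_simp.
  by apply: RintegrableS u2 => //; apply: subset_itvr; rewrite bnd_simp.
have : \int[leb]_(y in `[x, +oo[) u y ^+ 2 <= (e / 2) ^+ 2 * d / 2 by near: x.
lra.
Unshelve. all: by end_near. Qed.

Lemma H1on_small_tail e eta : 0 < e -> 0 < eta ->
  exists n : nat, [/\ \int[leb]_(x in `[n%:R, +oo[) u x ^+ 2 <= e,
    \int[leb]_(x in `[n%:R, +oo[) g x ^+ 2 <= e & `|u n%:R| <= eta].
Proof.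
move=> e0 eta0; have [[_ g2] u2 _] := ug.
have [X [_ XP]] : \forall N \near +oo, [/\ \int[leb]_(x in `[N, +oo[) u x ^+ 2 <= e,
    \int[leb]_(x in `[N, +oo[) g x ^+ 2 <= e & `|u N| <= eta].
  near=> N; split; near: N.
  - exact: ge0_Rintegral_tail u2 (fun x _ => sqr_ge0 _) e0.
  - exact: ge0_Rintegral_tail g2 (fun x _ => sqr_ge0 _) e0.
  - by have /cvgr0Pnorm_le := H1on_cvgy0; apply.
by exists (Num.truncn X).+1; apply: XP; exact: truncnS_gt.
Unshelve. all: by end_near. Qed.

Lemma H1on_norm_max N : 0 <= N -> exists2 y, N <= y & forall x, N <= x -> `|u x| <= `|u y|.
Proof.
move=> N0; have [u0|] := pselect (forall x, N <= x -> u x = 0).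
  by exists N => // x Nx; rewrite !u0.
move/existsNP => [x0 /not_implyP[Nx0 /eqP ux0]].
have e0 : 0 < `|u x0| by rewrite normr_gt0.
have [X [_ uX]] := (cvgr0Pnorm_le _).1 H1on_cvgy0 _ e0.
pose M := Num.max X x0.
have x0M : x0 <= M by rewrite le_max lexx orbT.
have NM : N <= M := le_trans Nx0 x0M.
have cu : {within `[N, M], continuous (fun x => `|u x|)}.
  by apply: (H1on_continuous_norm sD ug) => //; rewrite /= in_itv/= (le_trans N0 NM).
have [y] := EVT_max NM cu.
rewrite in_itv/= => /andP[Ny yM] uy; exists y => // x Nx.
have [xM|Mx] := leP x M; first by apply: uy; rewrite in_itv/= Nx.
apply: (@le_trans _ _ `|u x0|); last by apply: uy; rewrite in_itv/= Nx0.
by apply: uX; apply: le_lt_trans Mx; rewrite le_max lexx.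
Qed.

End H1on_halfline.

(** * Calibration *)

Section CirclePrimitive.
Variable R : realType.
Implicit Types y : R.

Definition circle_primitive y := y * Num.sqrt (1 - y ^+ 2) + asin y.

Lemma is_derive_circle_primitive y : -1 < y < 1 ->
  is_derive y 1 circle_primitive (2 * Num.sqrt (1 - y ^+ 2)).
Proof.
move=> yI; have p0 : 0 < 1 - y ^+ 2 by nra.
have ds : is_derive y 1 (fun z : R => Num.sqrt (1 - z ^+ 2))
   ((2 * Num.sqrt (1 - y ^+ 2))^-1 * (- (2 * y))).
  apply: (@is_derive1_comp _ Num.sqrt (fun z : R => 1 - z ^+ 2)).
    exact: is_derive1_sqrt.
  by apply: is_derive_eq; rewrite /GRing.scale/=; ring.
rewrite /circle_primitive; apply: is_derive_eq.
rewrite /GRing.scale/= mulr1; set s := Num.sqrt _.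
have s0 : 0 < s by rewrite sqrtr_gt0.
have s2 : s ^+ 2 = 1 - y ^+ 2 by rewrite sqr_sqrtr// ltW.
have y2 : y ^+ 2 = 1 - s ^+ 2 by rewrite s2; ring.
have -> : y * ((2 * s)^-1 * - (2 * y)) = - y ^+ 2 / s by field; rewrite gt_eqF.
by rewrite y2; field; rewrite gt_eqF.
Qed.

Lemma within_continuous_circle_primitive : {within `[-1, 1], continuous circle_primitive}.
Proof.
apply/subspace_continuousP => x xI; apply: cvgD; last first.
  by have /subspace_continuousP := @within_continuous_asin R; exact.
apply: cvg_within_filter; apply: cvgM; first exact: cvg_id.
apply: (@continuous_comp _ _ _ (fun y : R => 1 - y ^+ 2) Num.sqrt); last exact: sqrt_continuous.
by apply: cvgB; [exact: cvg_cst|exact: exprn_continuous].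
Qed.

Lemma circle_primitive0 : circle_primitive 0 = 0.
Proof.
rewrite /circle_primitive mul0r add0r; have := @sinK R 0; rewrite sin0; apply.
by have := pi_ge0 R; rewrite in_itv/=; lra.
Qed.

Lemma circle_primitive1 : circle_primitive 1 = pi / 2.
Proof.
rewrite /circle_primitive expr1n subrr sqrtr0 mulr0 add0r -[X in asin X]sin_pihalf sinK//.
by have := pi_ge0 R; rewrite in_itv/=; lra.
Qed.

End CirclePrimitive.

Lemma ler_dist_minmax (R : realType) (a b x z eta : R) : Num.min a b <= x <= Num.max a b ->
  `|a - z| <= eta -> `|b - z| <= eta -> `|x - z| <= eta.
Proof.
rewrite ge_min le_max !ler_norml => /andP[/orP ax /orP xb] /andP[? ?] /andP[? ?].
by case: ax => ?; case: xb => ?; apply/andP; split; lra.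
Qed.

Section Calibration.
Variables (R : realType) (A : R).
Hypothesis A0 : 0 < A.
Implicit Types a b u v : R.

Definition potential u := (A ^+ 4 * u ^+ 2 - u ^+ 6) / 3.

Definition calib u := A ^+ 4 / (4 * Num.sqrt 3) * circle_primitive (u ^+ 2 / A ^+ 2).

Lemma potentialE u : potential u = u ^+ 2 * (A ^+ 4 - u ^+ 4) / 3.
Proof. by rewrite /potential mulrBr -exprD [_ * A ^+ 4]mulrC. Qed.

Lemma potential_ge0 u : `|u| <= A -> 0 <= potential u.
Proof.
by move=> uA; rewrite potentialE divr_ge0// mulr_ge0 ?sqr_ge0// subr_ge0 ler_even_exprn_norm.
Qed.

Lemma potential_lipschitz : exists2 K : R, 0 < K &
  forall u v, `|u| <= A -> `|v| <= A -> `|potential u - potential v| <= K * `|u - v|.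
Proof.
have [K2 K20 lip2] := exprn_lipschitz 2 (ltW A0).
have [K6 K60 lip6] := exprn_lipschitz 6 (ltW A0).
have K0 : 0 <= A ^+ 4 * K2 + K6 by rewrite addr_ge0// mulr_ge0// exprn_ge0// ltW.
exists (A ^+ 4 * K2 + K6 + 1) => [|u v uA vA]; first by rewrite ltr_wpDl.
rewrite /potential -mulrBl normrM normfV (@ger0_norm _ 3)// ler_pdivrMr//.
have -> : A ^+ 4 * u ^+ 2 - u ^+ 6 - (A ^+ 4 * v ^+ 2 - v ^+ 6) =
  A ^+ 4 * (u ^+ 2 - v ^+ 2) - (u ^+ 6 - v ^+ 6) by ring.
apply: le_trans (ler_normB _ _) _; rewrite normrM (ger0_norm (exprn_ge0 _ (ltW A0))).
have := ler_wpM2l (exprn_ge0 4 (ltW A0)) (lip2 u v uA vA).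
have := lip6 u v uA vA; have := mulr_ge0 K0 (normr_ge0 (u - v)); have := normr_ge0 (u - v).
lra.
Qed.

Lemma sqr_ratio_itv u : `|u| <= A -> 0 <= u ^+ 2 / A ^+ 2 <= 1.
Proof.
move=> uA; rewrite divr_ge0 ?sqr_ge0//= ler_pdivrMr ?exprn_gt0// mul1r.
exact: ler_sqr_norm.
Qed.

Lemma is_derive_calib u : `|u| < A ->
  is_derive u 1 calib (A ^+ 2 / Num.sqrt 3 * u * Num.sqrt (1 - (u ^+ 2 / A ^+ 2) ^+ 2)).
Proof.
move=> uA.
have yI : -1 < u ^+ 2 / A ^+ 2 < 1.
  rewrite ltr_pdivrMr ?exprn_gt0// mul1r -(real_normK (num_real u)) ltrXn2r// andbT.
  by rewrite (lt_le_trans (ltrN10 _))// divr_ge0// sqr_ge0.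
have dy : is_derive u 1 (fun v : R => v ^+ 2 / A ^+ 2) (2 * u / A ^+ 2).
  by apply: is_derive_eq; rewrite /GRing.scale/=; ring.
have dcp := is_derive_circle_primitive yI.
rewrite /calib; apply: is_derive_eq.
rewrite /GRing.scale/=; set s := Num.sqrt (1 - _).
have s3 : Num.sqrt 3 != 0 :> R by rewrite gt_eqF// sqrtr_gt0.
by field; rewrite s3 gt_eqF.
Qed.

Lemma within_continuous_calib : {within `[- A, A], continuous calib}.
Proof.
apply/subspace_continuousP => x xA.
apply: cvgM; first exact: cvg_cst.
have /subspace_continuousP cp := @within_continuous_circle_primitive R.
have inI z : `[- A, A]%classic z -> `[-1, 1]%classic (z ^+ 2 / A ^+ 2).
  rewrite /= !in_itv/= => zA; have /sqr_ratio_itv : `|z| <= A by rewrite ler_norml.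
  by move=> /andP[h ->]; rewrite (le_trans _ h)// lerN10.
apply/cvgrPdist_le => e e0.
have /cvgrPdist_le/(_ e e0) := cp _ (inI _ xA); rewrite near_withinE => cpe.
have cy : (fun v : R => v ^+ 2 / A ^+ 2) v @[v --> x] --> x ^+ 2 / A ^+ 2.
  by apply: cvgM; [exact: exprn_continuous|exact: cvg_cst].
rewrite near_withinE.
have := cy _ cpe; rewrite /nbhs/= => cye; near=> z => zA.
have close : `[-1, 1]%classic (z ^+ 2 / A ^+ 2) ->
    `|circle_primitive (x ^+ 2 / A ^+ 2) - circle_primitive (z ^+ 2 / A ^+ 2)| <= e by near: z.
by apply: close; exact: inI.
Unshelve. all: by end_near. Qed.

Lemma calib0 : calib 0 = 0.
Proof. by rewrite /calib expr0n/= mul0r circle_primitive0 mulr0. Qed.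

Lemma calib_norm u : calib `|u| = calib u.
Proof. by rewrite /calib real_normK// num_real. Qed.

Lemma calib_diag : calib A = A ^+ 4 / 6 * mu_halfline R.
Proof.
rewrite /calib divff ?expf_neq0 ?gt_eqF// circle_primitive1 /mu_halfline.
have s3 : Num.sqrt 3 ^+ 2 = 3 :> R by rewrite sqr_sqrtr.
by field: s3.
Qed.

(* The derivative of [calib] is a square root of [potential]. *)
Lemma calib_MVT a b : `|a| <= A -> `|b| <= A -> exists2 xi : R,
  Num.min a b <= xi <= Num.max a b &
  `|calib b - calib a| <= Num.sqrt (potential xi) * `|b - a|.
Proof.
wlog ab : a b / a <= b.
  move=> mvt; have /orP[ab|ba] := le_total a b; first exact: mvt.
  move=> aA bA; rewrite minC maxC distrC (distrC b); exact: mvt.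
move=> aA bA; move: (aA) (bA); rewrite !ler_norml => /andP[? ?] /andP[? ?].
have [] := @MVT_segment R calib
  (fun u => A ^+ 2 / Num.sqrt 3 * u * Num.sqrt (1 - (u ^+ 2 / A ^+ 2) ^+ 2)) a b ab.
- move=> x; rewrite in_itv/= => /andP[ax xb]; apply: is_derive_calib.
  by rewrite ltr_norml; apply/andP; split; lra.
- apply: continuous_subspaceW within_continuous_calib => x /=; rewrite !in_itv/= => /andP[ax xb].
  by apply/andP; split; lra.
move=> xi; rewrite in_itv/= => /andP[axi xib] ->; exists xi.
  by rewrite ge_min axi le_max xib orbT.
have xiA : `|xi| <= A by rewrite ler_norml; apply/andP; split; lra.
rewrite normrM ler_wpM2r// -ler_sqr ?nnegrE ?sqrtr_ge0// (sqr_sqrtr (potential_ge0 xiA)).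
rewrite real_normK ?num_real// !exprMn exprVn !sqr_sqrtr//; last first.
  by have /andP[? ?] := sqr_ratio_itv xiA; nra.
by rewrite le_eqVlt; apply/orP; left; apply/eqP; rewrite /potential; field; rewrite gt_eqF.
Qed.

Lemma calib_le u : `|u| <= A -> calib u <= A ^+ 2 * u ^+ 2.
Proof.
move=> uA; have [|xi xiI] := @calib_MVT 0 u _ uA; first by rewrite normr0 ltW.
rewrite calib0 !subr0 => /(le_trans (ler_norm _))/le_trans; apply.
have xu : `|xi| <= `|u|.
  by have := ler_dist_minmax xiI (z := 0); rewrite !subr0; apply; rewrite ?normr0.
have -> : A ^+ 2 * u ^+ 2 = A ^+ 2 * `|u| * `|u| by rewrite -mulrA -expr2 real_normK ?num_real.
rewrite ler_wpM2r// -ler_sqr ?nnegrE ?sqrtr_ge0//; last by rewrite mulr_ge0// exprn_ge0// ltW.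
rewrite (sqr_sqrtr (potential_ge0 (le_trans xu uA))) exprMn real_normK ?num_real//.
rewrite /potential -exprM.
have x2 : xi ^+ 2 <= u ^+ 2 by rewrite -(real_normK (num_real u)) ler_sqr_norm.
have A4 : 0 < A ^+ 4 by rewrite exprn_gt0.
have := exprn_even_ge0 (n := 6) xi isT; have := sqr_ge0 xi; nra.
Qed.

Lemma potential_ge u m : `|u| <= A -> 0 <= m -> m <= `|u| ->
  A ^+ 4 * m ^+ 2 / 4 - A ^+ 2 * m ^+ 2 / 2 * u ^+ 2 <= potential u.
Proof.
move=> uA m0 mu.
have vA : u ^+ 2 <= A ^+ 2 by exact: ler_sqr_norm.
have mv : m ^+ 2 <= u ^+ 2 by rewrite -(real_normK (num_real u)) ler_sqr ?nnegrE.
rewrite /potential (exprM u 2 3) (exprM A 2 2).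
move: vA mv (sqr_ge0 m); set v := u ^+ 2; set a := A ^+ 2; set q := m ^+ 2 => va qv q0.
have [h|h] := leP v (a / 2).
  have : q * a ^+ 2 <= v * a ^+ 2 by rewrite ler_wpM2r// sqr_ge0.
  have a0 : 0 <= a by lra.
  have v0 : 0 <= v by lra.
  have := mulr_ge0 (mulr_ge0 a0 q0) v0.
  have : v * v ^+ 2 <= v * (a ^+ 2 / 4) by rewrite ler_wpM2l//; nra.
  lra.
have : 0 <= v * (a ^+ 2 - v ^+ 2) by rewrite mulr_ge0//; nra.
have : 0 <= a * q * (v / 2 - a / 4) by rewrite mulr_ge0// ?mulr_ge0//; lra.
lra.
Qed.

End Calibration.

Lemma calib_diag_le (R : realType) (a t : R) : 0 < a -> 0 <= t <= 1 / 5 ->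
  calib (a * (1 + t)) (a * (1 + t)) <= calib (a * (1 + t)) a + a ^+ 4 * t * Num.sqrt (5 * t).
Proof.
move=> a0 /andP[t0 t5]; set A := a * (1 + t).
have aA : a <= A by rewrite ler_peMr ?lerDl ?(ltW a0).
have A0 : 0 < A := lt_le_trans a0 aA.
have [||xi] := @calib_MVT R A A0 a A; [by rewrite gtr0_norm|by rewrite gtr0_norm|].
rewrite min_l// max_r// => /andP[axi xiA] /(le_trans (ler_norm _)).
rewrite lerBlDl => /le_trans; apply; rewrite lerD2l (ger0_norm (x := A - a)) ?subr_ge0//.
have -> : A - a = a * t by rewrite /A; ring.
have -> : a ^+ 4 * t * Num.sqrt (5 * t) = a ^+ 3 * Num.sqrt (5 * t) * (a * t) by ring.
apply: ler_wpM2r; first by rewrite mulr_ge0// ltW.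
have xi0 : 0 <= xi := le_trans (ltW a0) axi.
rewrite -ler_sqr ?nnegrE ?sqrtr_ge0//; last by rewrite mulr_ge0 ?sqrtr_ge0// exprn_ge0// ltW.
rewrite sqr_sqrtr ?potential_ge0// ?ger0_norm// exprMn sqr_sqrtr ?mulr_ge0// potentialE.
apply: (@le_trans _ _ (A ^+ 2 * (A ^+ 4 - a ^+ 4) / 3)).
  rewrite ler_pM2r ?invr_gt0//; apply: ler_pM; rewrite ?sqr_ge0 ?subr_ge0 ?lerD2l ?lerN2//.
  - by rewrite ler_even_exprn_norm// ger0_norm.
  - by rewrite ler_sqr_norm// ger0_norm.
  - by rewrite ler_even_exprn_norm// ger0_norm// ltW.
have -> : A ^+ 2 * (A ^+ 4 - a ^+ 4) / 3 = (a ^+ 3) ^+ 2 * ((1 + t) ^+ 2 * ((1 + t) ^+ 4 - 1) / 3).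
  by rewrite /A; field.
rewrite ler_wpM2l ?sqr_ge0//.
have : t * t <= t / 5 by rewrite ler_wpM2l//; lra.
move=> tt; have : t * t * t <= t / 5 / 5 by nra.
move=> ttt; have : t * t * t * t <= t / 5 by nra.
move=> t4; have : t * t * t * t * t <= t / 5 by nra.
move=> t5'; have : t * t * t * t * t * t <= t / 5 by nra.
lra.
Qed.

Section EnergyDensity.
Variable R : realType.
Implicit Types (u g F k : R -> R) (A s t : R).

Definition energy_density u g (x : R) := 2^-1 * g x ^+ 2 - 6^-1 * u x ^+ 6.

Definition shifted_density A u g (x : R) := 2^-1 * (g x ^+ 2 + potential A (u x)).

Lemma shifted_densityE A u g :
  shifted_density A u g = (fun x => energy_density u g x + A ^+ 4 / 6 * u x ^+ 2).
Proof. by apply/funext => x; rewrite /shifted_density /energy_density /potential; field. Qed.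

Lemma shifted_density_ge0 A u g x : 0 < A -> `|u x| <= A -> 0 <= shifted_density A u g x.
Proof. by move=> A0 uA; rewrite mulr_ge0// addr_ge0 ?sqr_ge0// potential_ge0. Qed.

Lemma ler_increment_Rintegral F k s t : s <= t -> Rintegrable `[s, t] k ->
  (forall e : R, 0 < e -> exists2 d : R, 0 < d & forall a b : R, s <= a -> a <= b -> b <= t ->
     b - a <= d -> `|F b - F a| <= \int[leb]_(x in `[a, b]) k x + e * (b - a)) ->
  `|F t - F s| <= \int[leb]_(x in `[s, t]) k x.
Proof.
move=> st ki locF; apply: (@ler_addgt0MP _ _ _ (t - s)) => [|e e0]; first by rewrite subr_ge0.
have [d d0 Fd] := locF _ e0.
pose n := (Num.truncn ((t - s) / d)).+1.
pose h := (t - s) / n%:R.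
have h0 : 0 <= h by rewrite divr_ge0 ?subr_ge0// ltW.
have hd : h <= d by rewrite /h ler_pdivrMr// mulrC -ler_pdivrMr// ltW// /n truncnS_gt.
have nh : n%:R * h = t - s by rewrite /h mulrC divfK ?gt_eqF.
suff incr i : (i <= n)%N -> `|F (s + i%:R * h) - F s| <=
    \int[leb]_(x in `[s, s + i%:R * h]) k x + (i%:R * h) * e.
  by have := incr n (leqnn _); rewrite nh subrKC.
elim: i => [_|i IH iN]; first by rewrite mul0r addr0 mul0r addr0 subrr normr0 Rintegral_itv1.
have iN' : i.+1%:R * h <= t - s by rewrite -nh ler_wpM2r// ler_nat.
have ih0 : 0 <= i%:R * h by rewrite mulr_ge0.
have iS : i.+1%:R * h = i%:R * h + h by rewrite -natr1 mulrDl mul1r.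
rewrite (@Rintegral_itv_split _ s (s + i%:R * h)) ?bnd_simp; [|lra|lra|]; last first.
  by apply: RintegrableS ki => //; apply: subset_itvl; rewrite bnd_simp; lra.
have := IH (ltnW iN); have := Fd (s + i%:R * h) (s + i.+1%:R * h).
move=> /(_ ltac:(lra) ltac:(lra) ltac:(lra) ltac:(lra)).
have := ler_distD (F (s + i%:R * h)) (F (s + i.+1%:R * h)) (F s).
by rewrite iS; lra.
Qed.

End EnergyDensity.

(** * Energy on an edge *)

Section CalibrationOnEdge.
Variable R : realType.
Implicit Types (E : set R) (v : R -> R) (s t a b eta K : R).

Definition bounded_on E v (A : R) := forall x, E x -> `|v x| <= A.

Lemma bounded_onS E E' v A : E' `<=` E -> bounded_on E v A -> bounded_on E' v A.
Proof. by move=> E'E vA x /E'E; exact: vA. Qed.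

Variables (D : set R) (u g : R -> R) (A : R).
Hypotheses (sD : initial_segment D) (ug : H1on D u g) (A0 : 0 < A).
Let mD : measurable D. Proof. exact: initial_segment_measurable. Qed.

Lemma Rintegrable_potential E : measurable E -> E `<=` D -> bounded_on E u A ->
  Rintegrable E (fun x => potential A (u x)).
Proof.
move=> mE ED uA; case: (ug) => _ u2 _.
have u2E : Rintegrable E (fun x => u x ^+ 2) by exact: RintegrableS u2.
apply: (@le_Rintegrable _ _ _ (fun x => A ^+ 4 * u x ^+ 2)) => //; last exact: RintegrableZl.
  have mu : measurable_fun E u by apply: measurable_funS (H1on_measurable sD ug).
  apply: measurable_funM; last exact: measurable_cst.
  apply: measurable_funB; last exact: measurable_funX.
  by apply: measurable_funM; [exact: measurable_cst|exact: measurable_funX].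
move=> x Ex; rewrite ger0_norm ?potential_ge0 ?uA// /potential.
have := exprn_even_ge0 (n := 6) (u x) isT; have : 0 <= A ^+ 4 * u x ^+ 2.
  by rewrite mulr_ge0 ?sqr_ge0// exprn_ge0// ltW.
by lra.
Qed.

Lemma Rintegrable_shifted_density E : measurable E -> E `<=` D -> bounded_on E u A ->
  Rintegrable E (shifted_density A u g).
Proof.
move=> mE ED uA; apply: RintegrableZl => //; apply: RintegrableD => //.
  by case: ug => -[_ g2] _ _; exact: RintegrableS g2.
exact: Rintegrable_potential.
Qed.

Lemma Rintegral_shifted_density_ge0 E : bounded_on E u A ->
  0 <= \int[leb]_(x in E) shifted_density A u g x.
Proof. by move=> uA; apply: Rintegral_ge0 => x Ex; apply: shifted_density_ge0 => //; exact: uA. Qed.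

Lemma subset_Rintegral_shifted_density E E' : measurable E -> measurable E' ->
  E' `<=` E -> E `<=` D -> bounded_on E u A ->
  \int[leb]_(x in E') shifted_density A u g x <= \int[leb]_(x in E) shifted_density A u g x.
Proof.
move=> mE mE' E'E ED uA; apply: ge0_subset_Rintegral => //.
  by move=> x Ex; apply: shifted_density_ge0 => //; exact: uA.
exact: Rintegrable_shifted_density.
Qed.

Lemma Rintegrable_energy_density E : measurable E -> E `<=` D -> bounded_on E u A ->
  Rintegrable E (energy_density u g).
Proof.
move=> mE ED uA.
have -> : energy_density u g = (fun x => shifted_density A u g x - A ^+ 4 / 6 * u x ^+ 2).
  by apply/funext => x; rewrite shifted_densityE addrK.
apply: RintegrableB => //; first exact: Rintegrable_shifted_density.
by apply: RintegrableZl => //; case: ug => _ u2 _; exact: RintegrableS u2.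
Qed.

Lemma Rintegral_shifted_density E : measurable E -> E `<=` D -> bounded_on E u A ->
  \int[leb]_(x in E) shifted_density A u g x =
  \int[leb]_(x in E) energy_density u g x + A ^+ 4 / 6 * \int[leb]_(x in E) u x ^+ 2.
Proof.
move=> mE ED uA.
have u2 : Rintegrable E (fun x => u x ^+ 2) by case: ug => _ u2 _; exact: RintegrableS u2.
rewrite shifted_densityE RintegralD//; last exact: RintegrableZl.
  by rewrite RintegralZl.
exact: Rintegrable_energy_density.
Qed.

(* AM-GM: [c |g| <= (g^2 + c^2) / 2], where [c^2] is a value of the potential on [[a, b]]. *)
Lemma calib_increment_le_osc K eta a b : 0 <= K ->
  (forall y z : R, `|y| <= A -> `|z| <= A -> `|potential A y - potential A z| <= K * `|y - z|) ->
  0 <= a -> a <= b -> D b -> bounded_on `[a, b] u A ->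
  (forall x y, `[a, b]%classic x -> `[a, b]%classic y -> `|u x - u y| <= eta) ->
  `|calib A (u b) - calib A (u a)| <=
    \int[leb]_(x in `[a, b]) shifted_density A u g x + K * eta * (b - a).
Proof.
move=> K0 lip a0 ab Db uA osc.
have aab : `[a, b]%classic a by rewrite /= in_itv/= lexx.
have bab : `[a, b]%classic b by rewrite /= in_itv/= lexx ab.
have [xi xiab le_xi] := calib_MVT A0 (uA _ aab) (uA _ bab).
have xiA : `|xi| <= A.
  by have := ler_dist_minmax (z := 0) xiab; rewrite !subr0; apply; exact: uA.
apply: (le_trans le_xi); rewrite (H1on_FTC sD ug) ?a0//.
have gi := H1on_Rintegrable_itv sD ug a0 Db.
have gn : Rintegrable `[a, b] (fun x => `|g x|) by exact: (integrable_norm gi).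
have di : Rintegrable `[a, b] (shifted_density A u g).
  by apply: Rintegrable_shifted_density => //; exact: initial_segment_subset.
set c := Num.sqrt (potential A xi); have c0 : 0 <= c by exact: sqrtr_ge0.
apply: (@le_trans _ _ (\int[leb]_(x in `[a, b]) (c * `|g x|))).
  by rewrite RintegralZl// ler_wpM2l//; exact: le_normr_Rintegral.
rewrite -(Rintegral_itv_cst _ ab) -RintegralD//; last exact: Rintegrable_cst.
apply: le_Rintegral => //; first exact: RintegrableZl.
  by apply: RintegrableD => //; exact: Rintegrable_cst.
move=> x xab.
have := lip _ _ xiA (uA x xab); rewrite ler_norml => /andP[_ pxi].
have : K * `|xi - u x| <= K * eta.
  by rewrite ler_wpM2l//; apply: (ler_dist_minmax xiab); exact: osc.
have c2 : c ^+ 2 = potential A xi by rewrite sqr_sqrtr// potential_ge0.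
rewrite /shifted_density -(real_normK (num_real (g x))).
have := mulr_ge0 K0 (normr_ge0 (xi - u x)); have := sqr_ge0 (c - `|g x|); nra.
Qed.

Lemma calib_increment_le s t : 0 <= s -> s <= t -> D t -> bounded_on `[s, t] u A ->
  `|calib A (u t) - calib A (u s)| <= \int[leb]_(x in `[s, t]) shifted_density A u g x.
Proof.
move=> s0 st Dt uA; have sub := initial_segment_subset sD s0 Dt.
apply: (@ler_increment_Rintegral _ (fun x => calib A (u x))) => //.
  exact: Rintegrable_shifted_density.
have [K K0 lip] := potential_lipschitz A0; move=> e e0.
have eta0 : 0 < e / K by rewrite divr_gt0.
have [d d0 ud] := H1on_uniformly_continuous sD ug eta0; exists d => // a b sa ab bt bad.
have subab : `[a, b] `<=` `[s, t] by apply: subset_itv; rewrite bnd_simp.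
have := @calib_increment_le_osc K (e / K) a b (ltW K0) lip (le_trans s0 sa) ab.
rewrite mulrCA divff ?gt_eqF// mulr1; apply.
- by apply/sub/subab; rewrite /= in_itv/= ab lexx.
- exact: bounded_onS uA.
move=> x y xab yab; apply: ud; [exact/sub/subab|exact/sub/subab|].
apply: le_trans bad; move: xab yab; rewrite /= !in_itv/= => /andP[? ?] /andP[? ?].
by rewrite ler_norml; apply/andP; split; lra.
Qed.

End CalibrationOnEdge.

Section CalibrationOnHalfline.
Variables (R : realType) (u g : R -> R).
Hypothesis ug : H1on `[0, +oo[ u g.
Let sD := initial_segment_itvcy R.

Lemma calib_le_tail A s : 0 < A -> 0 <= s -> bounded_on `[s, +oo[ u A ->
  calib A (u s) <= \int[leb]_(x in `[s, +oo[) shifted_density A u g x.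
Proof.
move=> A0 s0 uA; apply/ler_addgt0Pr => e e0.
have eta0 : 0 < Num.sqrt e / A by rewrite divr_gt0// sqrtr_gt0.
have [X [_ uX]] := (cvgr0Pnorm_le _).1 (H1on_cvgy0 ug) _ eta0.
pose t := Num.max (X + 1) s.
have st : s <= t by rewrite le_max lexx orbT.
have Xt : X < t by rewrite lt_max ltrDl ltr01.
have Dt : `[0, +oo[%classic t by rewrite /= in_itv/= (le_trans s0 st).
have sub : `[s, +oo[ `<=` `[0, +oo[ by apply: subset_itvr; rewrite bnd_simp.
have subt : `[s, t] `<=` `[s, +oo[ by apply: subset_itvl; rewrite bnd_simp.
have := calib_increment_le sD ug A0 s0 st Dt (bounded_onS subt uA).
rewrite distrC => /(le_trans (ler_norm _)).
have := subset_Rintegral_shifted_density sD ug A0 (measurable_itv _) (measurable_itv _) subt sub uA.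
have : calib A (u t) <= e.
  apply: le_trans (calib_le A0 (uA t _)) _; first by rewrite /= in_itv/= st.
  apply: le_trans (ler_wpM2l (sqr_ge0 A) (ler_sqr_norm (uX t Xt))) _.
  by rewrite -exprMn mulrC divfK ?gt_eqF// sqr_sqrtr// ltW.
lra.
Qed.

Lemma mu_lineE : mu_line R = 2 * mu_halfline R.
Proof. by rewrite /mu_line /mu_halfline; field. Qed.

(* With [a] the maximum of [|u|] beyond [N], reached at [y], going from [N] to [y] and from [y]
   to infinity costs twice [calib a a], which pays for a mass up to [mu_line R]. *)
Lemma tail_energy_ge N A : 0 <= N -> \int[leb]_(x in `[N, +oo[) u x ^+ 2 <= mu_line R ->
  bounded_on `[N, +oo[ u A ->
  - (A ^+ 2 * u N ^+ 2) <= \int[leb]_(x in `[N, +oo[) energy_density u g x.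
Proof.
move=> N0 mass uA; have [y Ny uy] := H1on_norm_max ug N0.
have y0 : 0 <= y := le_trans N0 Ny.
have [uy0|uy0] := eqVneq (u y) 0.
  have u0 x : N <= x -> u x = 0.
    by move=> /uy; rewrite uy0 normr0 normr_le0 => /eqP.
  rewrite u0// expr0n/= mulr0 oppr0; apply: Rintegral_ge0 => x; rewrite /= in_itv/= andbT => Nx.
  by rewrite /energy_density u0// expr0n/= mulr0 subr0 mulr_ge0// sqr_ge0.
set a := `|u y|; have a0 : 0 < a by rewrite normr_gt0.
have sub : `[N, +oo[ `<=` `[0, +oo[ by apply: subset_itvr; rewrite bnd_simp.
have ua : bounded_on `[N, +oo[ u a by move=> x; rewrite /= in_itv/= andbT; exact: uy.
have suby : `[y, +oo[ `<=` `[N, +oo[ by apply: subset_itvr; rewrite bnd_simp.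
have subNy : `[N, y] `<=` `[N, +oo[ by apply: subset_itvl; rewrite bnd_simp.
have := Rintegral_shifted_density sD ug a0 (measurable_itv _) sub ua.
rewrite (Rintegral_itv_split Ny)//; last exact: (Rintegrable_shifted_density sD ug a0).
have := calib_le_tail a0 y0 (bounded_onS suby ua).
have Dy : `[0, +oo[%classic y by rewrite /= in_itv/= y0.
have := calib_increment_le sD ug a0 N0 Ny Dy (bounded_onS subNy ua).
move=> /(le_trans (ler_norm _)); rewrite -(calib_norm a (u y)) -/a calib_diag//.
have a4 : 0 < a ^+ 4 / 6 by rewrite divr_gt0// exprn_gt0.
have aA : a ^+ 2 <= A ^+ 2.
  by apply: ler_sqr_norm; rewrite normr_id uA//= in_itv/= Ny.
have := ler_wpM2r (sqr_ge0 (u N)) aA.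
have := calib_le a0 (uy _ (lexx N)).
have := ler_wpM2l (ltW a4) mass; rewrite mu_lineE; lra.
Qed.

End CalibrationOnHalfline.

Section Escape.
Variables (R : realType) (D : set R) (u g : R -> R) (A s t M : R).
Hypotheses (sD : initial_segment D) (ug : H1on D u g) (A0 : 0 < A).
Hypotheses (s0 : 0 <= s) (Dt : D t) (uA : bounded_on `[s, t] u A).
Hypothesis uM : \int[leb]_(x in `[s, t]) u x ^+ 2 <= M.
Implicit Types a b l w z : R.

Let subD : `[s, t] `<=` D. Proof. exact: initial_segment_subset. Qed.

Let subitv a b : s <= a -> b <= t -> `[a, b] `<=` `[s, t].
Proof. by move=> sa bt; apply: subset_itv; rewrite bnd_simp. Qed.

Let u2 : Rintegrable `[s, t] (fun x => u x ^+ 2).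
Proof.
have mD := initial_segment_measurable sD.
by case: ug => _ u2 _; exact: RintegrableS u2.
Qed.

Lemma exists_small_value a b : s <= a -> a < b -> b <= t -> 4 * M <= A ^+ 2 * (b - a) ->
  exists2 z, a <= z <= b & u z ^+ 2 * (b - a) <= M /\
    A ^+ 4 * u z ^+ 2 * (b - a) / 8 <= \int[leb]_(x in `[a, b]) potential A (u x).
Proof.
move=> sa ab bt MA; have sub := subitv sa bt; have a0 : 0 <= a := le_trans s0 sa.
have Db : D b by apply/subD/sub; rewrite /= in_itv/= lexx ltW.
have [z] := EVT_min (ltW ab) (H1on_continuous_norm sD ug a0 Db).
rewrite in_itv/= => zab zmin; exists z => //.
have u2ab : Rintegrable `[a, b] (fun x => u x ^+ 2) by exact: RintegrableS u2.
have uMab : \int[leb]_(x in `[a, b]) u x ^+ 2 <= M.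
  by apply: le_trans uM; exact: subset_Rintegral_sqr.
split.
  apply: le_trans uMab; rewrite -(Rintegral_itv_cst _ (ltW ab)); apply: le_Rintegral => //.
    exact: Rintegrable_cst.
  move=> x xab; rewrite -(real_normK (num_real (u x))); apply: ler_sqr_norm; exact: zmin.
have low : \int[leb]_(x in `[a, b]) (A ^+ 4 * `|u z| ^+ 2 / 4 -
    A ^+ 2 * `|u z| ^+ 2 / 2 * u x ^+ 2) <= \int[leb]_(x in `[a, b]) potential A (u x).
  apply: le_Rintegral => //.
  - by apply: RintegrableB => //; [exact: Rintegrable_cst|exact: RintegrableZl].
  - apply: (Rintegrable_potential sD ug A0) => //; last exact: bounded_onS uA.
    exact: subset_trans subD.
  - by move=> x xab; apply: potential_ge => //; [exact/uA/sub|exact: zmin].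
apply: le_trans low; rewrite RintegralB//; [|exact: Rintegrable_cst|exact: RintegrableZl].
rewrite (Rintegral_itv_cst _ (ltW ab)) RintegralZl// real_normK ?num_real//.
have q0 : 0 <= A ^+ 2 * u z ^+ 2 by rewrite mulr_ge0 ?sqr_ge0.
set I := Rintegral _ _ _ in uMab *; rewrite (exprM A 2 2).
move: MA q0; set q := A ^+ 2; set p := u z ^+ 2 => MA q0.
have : q * p * (4 * I) <= q * p * (q * (b - a)) by rewrite ler_wpM2l//; lra.
lra.
Qed.

Definition separates z w a b := (w <= z <= a) || (b <= z <= w).

Lemma calib_escape_le w z a b : s <= w <= t -> s <= z <= t -> s <= a -> a <= b -> b <= t ->
  separates z w a b ->
  calib A (u w) - calib A (u z) + (\int[leb]_(x in `[a, b]) potential A (u x)) / 2 <=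
  \int[leb]_(x in `[s, t]) shifted_density A u g x.
Proof.
move=> /andP[sw wt] /andP[sz zt] sa ab bt wzab.
have sub x y : s <= x -> y <= t -> `[x, y] `<=` D.
  by move=> sx yt; apply: subset_trans subD; exact: subitv.
have bnd x y : s <= x -> y <= t -> bounded_on `[x, y] u A.
  by move=> sx yt; apply: bounded_onS uA; exact: subitv.
have mono x y x' y' : s <= x -> y <= t -> x <= x' -> y' <= y ->
    \int[leb]_(x in `[x', y']) shifted_density A u g x <=
    \int[leb]_(x in `[x, y]) shifted_density A u g x.
  move=> sx yt xx' yy'; apply: (subset_Rintegral_shifted_density sD ug A0) => //.
  - by apply: subset_itv; rewrite bnd_simp.
  - exact: sub.
  - exact: bnd.
have pot : (\int[leb]_(x in `[a, b]) potential A (u x)) / 2 <=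
    \int[leb]_(x in `[a, b]) shifted_density A u g x.
  have pi : Rintegrable `[a, b] (fun x => potential A (u x)).
    by apply: (Rintegrable_potential sD ug A0) => //; [exact: sub|exact: bnd].
  rewrite mulrC -RintegralZl//; apply: le_Rintegral => //; first exact: RintegrableZl.
    by apply: (Rintegrable_shifted_density sD ug A0) => //; [exact: sub|exact: bnd].
  by move=> x _; rewrite /shifted_density mulrDr lerDr mulr_ge0// sqr_ge0.
have incr x y : s <= x -> x <= y -> y <= t -> `|calib A (u y) - calib A (u x)| <=
    \int[leb]_(x in `[x, y]) shifted_density A u g x.
  move=> sx xy yt; apply: (calib_increment_le sD ug A0) => //; first exact: le_trans sx.
    by apply: (sub x y) => //; rewrite /= in_itv/= xy lexx.
  exact: bnd.
have splitE : \int[leb]_(x in `[s, t]) shifted_density A u g x =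
    \int[leb]_(x in `[s, z]) shifted_density A u g x +
    \int[leb]_(x in `[z, t]) shifted_density A u g x.
  by apply: Rintegral_itv_split => //; exact: (Rintegrable_shifted_density sD ug A0).
rewrite splitE; case/orP: wzab => /andP[]; last rewrite addrC.
  move=> wz za; apply: lerD; last by apply: (le_trans pot); exact: mono.
  apply: le_trans (ler_norm _) _; rewrite distrC; apply: le_trans (incr w z sw wz zt) _.
  exact: mono.
move=> bz zw; apply: lerD; first by apply: (le_trans pot); exact: mono.
by apply: le_trans (ler_norm _) _; apply: le_trans (incr z w sz zw wt) _; exact: mono.
Qed.

Let T := \int[leb]_(x in `[s, t]) shifted_density A u g x.

Lemma escape_step w z a b : T < calib A (u w) -> s <= w <= t -> s <= z <= t ->
  s <= a -> a < b -> b <= t -> separates z w a b -> 4 * M <= A ^+ 2 * (b - a) ->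
  exists2 z', a <= z' <= b & A ^+ 2 * (b - a) * u z' ^+ 2 <= 16 * u z ^+ 2.
Proof.
move=> Tw wst zst sa ab bt wzab MA.
have [z' z'ab [_ potz']] := exists_small_value sa ab bt MA; exists z' => //.
have A20 : 0 < A ^+ 2 by rewrite exprn_gt0.
rewrite -(ler_pM2l A20); move: potz'; rewrite (exprM A 2 2).
have := calib_escape_le wst zst sa (ltW ab) bt wzab; rewrite -/T.
have := calib_le A0 (uA zst); lra.
Qed.

Lemma escape_through_three w a1 a2 a3 l : s <= w <= t -> 0 < l -> 4 * M <= A ^+ 2 * l ->
  [/\ s <= a1, s <= a2 & s <= a3] -> [/\ a1 + l <= t, a2 + l <= t & a3 + l <= t] ->
  (forall z, a1 <= z <= a1 + l -> separates z w a2 (a2 + l)) ->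
  (forall z, a2 <= z <= a2 + l -> separates z w a3 (a3 + l)) ->
  calib A (u w) - 256 * M / (A ^+ 2 * l ^+ 3) <= T.
Proof.
move=> wst l0 MA [sa1 sa2 sa3] [a1t a2t a3t] separates12 separates23.
have A20 : 0 < A ^+ 2 by rewrite exprn_gt0.
have M0 : 0 <= M := le_trans (Rintegral_sqr_ge0 _ _) uM.
have Al : 0 < A ^+ 2 * l ^+ 3 by rewrite mulr_gt0// exprn_gt0.
have loss0 : 0 <= 256 * M / (A ^+ 2 * l ^+ 3) by rewrite divr_ge0 ?mulr_ge0// ltW.
have [wT|Tw] := leP (calib A (u w)) T; first by lra.
have al a : a < a + l by rewrite ltrDl.
have lE a : a + l - a = l by rewrite addrC addKr.
have inst a z : s <= a -> a + l <= t -> a <= z <= a + l -> s <= z <= t.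
  by move=> sa at' /andP[az zal]; rewrite (le_trans sa az) (le_trans zal at').
have [|z1 z1I [uz1 _]] := exists_small_value sa1 (al a1) a1t; first by rewrite lE.
have [|z2 z2I] := escape_step Tw wst (inst _ _ sa1 a1t z1I) sa2 (al _) a2t (separates12 _ z1I).
  by rewrite lE.
have [|z3 z3I] := escape_step Tw wst (inst _ _ sa2 a2t z2I) sa3 (al _) a3t (separates23 _ z2I).
  by rewrite lE.
rewrite !lE in uz1 * => uz3 uz2; have z3st := inst _ _ sa3 a3t z3I.
have [sz3 z3t] := andP z3st.
have /(calib_escape_le wst z3st sz3 (lexx z3) z3t) : separates z3 w z3 z3.
  by rewrite /separates !lexx andbT le_total.
rewrite Rintegral_itv1 mul0r addr0 -/T; have := calib_le A0 (uA z3st).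
suff : A ^+ 2 * u z3 ^+ 2 <= 256 * M / (A ^+ 2 * l ^+ 3) by lra.
rewrite ler_pdivlMr//.
have := ler_wpM2r (ltW (mulr_gt0 A20 (exprn_gt0 2 l0))) uz3.
have := ler_wpM2r (ltW l0) uz2; lra.
Qed.

(* Leaving an endpoint, each third of [[s, t]] met on the way divides the least value of [u^2]
   by a multiple of [A^2], unless [T >= calib A (u w)]; three thirds make the loss O(M / A^2). *)
Lemma escape_endpoints : s < t -> 4 * M <= A ^+ 2 * ((t - s) / 3) ->
  calib A (u s) - 256 * M / (A ^+ 2 * ((t - s) / 3) ^+ 3) <= T /\
  calib A (u t) - 256 * M / (A ^+ 2 * ((t - s) / 3) ^+ 3) <= T.
Proof.
move=> st MA; set l := (t - s) / 3 in MA *.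
have l0 : 0 < l by rewrite /l; lra.
have st3 : s + 2 * l + l = t by rewrite /l; field.
split.
  apply: (@escape_through_three s s (s + l) (s + 2 * l)) => //; [|by split; lra|by split; lra| |].
  - by rewrite lexx ltW.
  - by move=> z /andP[sz zl]; rewrite /separates sz zl.
  - by move=> z /andP[sz zl]; rewrite /separates; apply/orP; left; apply/andP; split; lra.
apply: (@escape_through_three t (s + 2 * l) (s + l) s) => //; [|by split; lra|by split; lra| |].
- by rewrite lexx ltW.
- by move=> z /andP[sz zl]; rewrite /separates; apply/orP; right; apply/andP; split; lra.
- by move=> z /andP[sz zl]; rewrite /separates; apply/orP; right; apply/andP; split; lra.
Qed.

End Escape.

(** * Paths *)

Lemma card_set_pred (T : finType) (P : pred T) : #|[set x | P x]| = #|P|.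
Proof. by apply: eq_card => x; apply/idP/idP => [/set_mem//|Px]; exact/mem_set. Qed.

Section Paths.
Variables (R : realType) (G : metric_graph R).
Implicit Types (w v : V G) (e : BE G) (h : HL G) (b : bool) (E : {set BE G}).

Definition edge_end e b := if b then bsrc e else btgt e.

Definition joins e w v := (bsrc e = w /\ btgt e = v) \/ (bsrc e = v /\ btgt e = w).

Local Notation half_edge := (BE G * bool + HL G)%type.

Definition half_edge_vertex (i : half_edge) :=
  match i with inl (e, b) => edge_end e b | inr h => hsrc h end.

Lemma deg_half_edges v : deg v = #|[pred i | half_edge_vertex i == v]|.
Proof.
rewrite /deg !card_set_pred -!sum1_card [RHS]big_sumType; congr (_ + _)%N.
transitivity (\sum_e \sum_(b | edge_end e b == v) 1)%N.
  rewrite big_mkcond [X in (_ + X)%N]big_mkcond -big_split; apply: eq_bigr => e _.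
  by rewrite [RHS]big_mkcond big_bool.
by rewrite pair_big_dep; apply: eq_bigl => -[e b].
Qed.

Lemma exists_other_half_edge (i : half_edge) v : half_edge_vertex i = v -> deg v <> 1%N ->
  exists2 i', i' != i & half_edge_vertex i' = v.
Proof.
move=> iv dv; apply: contrapT => no; apply: dv; rewrite deg_half_edges.
rewrite (eq_card (B := pred1 i)) ?card1//.
move=> j; rewrite !inE; apply/eqP/eqP => [jv|->//].
by apply: contrapT => /eqP ji; apply: no; exists j.
Qed.

(* The only property of a path with edge set [E] that is needed: increments telescope along it. *)
Definition linked w v E := forall psi : V G -> R,
  `|psi w - psi v| <= \sum_(e in E) `|psi (bsrc e) - psi (btgt e)|.

Lemma linked0 w : linked w w finset.set0.
Proof. by move=> psi; rewrite subrr normr0 big_set0. Qed.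

Lemma linkedU1 e w w' v E : e \notin E -> joins e w w' -> linked w' v E -> linked w v (e |: E).
Proof.
move=> eE eww' lE psi; rewrite big_setU1//=.
apply: le_trans (ler_distD (psi w') _ _) _; rewrite lerD//.
by case: eww' => [[-> ->]|[-> ->]] //; rewrite distrC.
Qed.

Lemma adj_joins w w' : adj w w' -> exists e, joins e w w'.
Proof.
by move=> /existsP[e /orP[/andP[/eqP ? /eqP ?]|/andP[/eqP ? /eqP ?]]]; exists e; [left|right].
Qed.

Lemma joins_edge_end e w w' : joins e w w' -> exists b, edge_end e b = w /\ edge_end e (~~ b) = w'.
Proof. by case=> -[<- <-]; [exists true|exists false]. Qed.

Lemma path_linked p w : path (@adj R G) w p -> uniq (w :: p) ->
  exists2 E, linked w (last w p) E & forall e b, e \in E -> edge_end e b \in w :: p.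
Proof.
elim: p w => [w _ _|w' p IH w /= /andP[/adj_joins[e eww'] pth] /andP[wp up]].
  by exists finset.set0 => [|e b]; [exact: linked0|rewrite finset.in_set0].
have [E lE Ep] := IH w' pth up; have [b0 [eb0 eb0']] := joins_edge_end eww'.
have eE : e \notin E by apply: contra wp => /(Ep e b0); rewrite eb0.
exists (e |: E); first exact: linkedU1 lE.
move=> e' b; rewrite finset.in_setU1 => /predU1P[->|/(Ep e' b) h]; last by rewrite in_cons h orbT.
by have [->|->] : b = b0 \/ b = ~~ b0; [case: b b0 {eb0 eb0'} => [] []; auto| |];
  rewrite ?eb0 ?eb0' !in_cons eqxx ?orbT.
Qed.

Hypothesis conn : connected_graph G.

Lemma connected_first_edge w v : w <> v -> exists e w' E,
  [/\ w <> w', joins e w w', linked w' v E & forall e' b, e' \in E -> edge_end e' b <> w].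
Proof.
have /connectP[p pth ->] := conn w v.
case/shortenP: pth => -[|w' q] //= pth up _ _.
move: pth up => /andP[/adj_joins[e eww'] pth] /andP[wp up].
have [E lE Eq] := path_linked pth up.
exists e, w', E; split => //; first by move=> ww'; rewrite ww' mem_head in wp.
by move=> e' b /(Eq e' b) eq ew; rewrite ew (negbTE wp) in eq.
Qed.

Lemma linked_avoiding_edge e0 v : exists E b, e0 \notin E /\ linked (edge_end e0 b) v E.
Proof.
have [<-|/eqP sv] := eqVneq (bsrc e0) v.
  by exists finset.set0, true; rewrite finset.in_set0; split => //; exact: linked0.
have [e [w' [E [sw' esw' lE avoid]]]] := connected_first_edge sv.
have e0E : e0 \notin E by apply/negP => /(avoid _ true); apply.
have [ee0|ee0] := eqVneq e e0.
  exists E, false; split => //; case: esw' => [[_ ew']|[ew' _]]; first by rewrite /= -ee0 ew'.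
  by case: sw'; rewrite -ew' ee0.
exists (e |: E), true; rewrite finset.in_setU1 eq_sym (negbTE ee0) (negbTE e0E); split => //.
have [b [eb _]] := joins_edge_end esw'.
by apply: linkedU1 esw' lE; apply/negP => /(avoid _ b); apply.
Qed.

Hypothesis oneHL : #|HL G| = 1%N.

Lemma HL_unique h h' : h = h'.
Proof. by have /card_le1_eqP : (#|HL G| <= 1)%N; [rewrite oneHL|apply]. Qed.

Lemma exists_HL : inhabited (HL G).
Proof. by have /card_gt0P[h _] : (0 < #|HL G|)%N; [rewrite oneHL|constructor]. Qed.

Lemma exists_edge_at_halfline h : deg (hsrc h) <> 1%N -> exists e b, edge_end e b = hsrc h.
Proof.
move=> /(exists_other_half_edge (i := inr h) erefl)[[[e b]|h'] ih ?]; first by exists e, b.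
by rewrite (HL_unique h' h) eqxx in ih.
Qed.

Lemma linked_avoiding_end w h : (forall v, deg v <> 1%N) ->
  exists E e b, [/\ linked w (hsrc h) E, e \notin E & edge_end e b = w].
Proof.
move=> noterm.
have [->|/eqP wh] := eqVneq w (hsrc h).
  have [e [b eb]] := exists_edge_at_halfline (noterm (hsrc h)).
  by exists finset.set0, e, b; split => //; [exact: linked0|rewrite finset.in_set0].
have [e [w' [E [ww' eww' lE avoid]]]] := connected_first_edge wh.
have [b [eb eb']] := joins_edge_end eww'.
have eE : e \notin E by apply/negP => /(avoid _ b); apply.
have [[[e' b']|h'] /eqP ie ei] := exists_other_half_edge (i := inl (e, b)) eb (noterm w).
  exists (e |: E), e', b'; split => //; first exact: linkedU1 lE.
  rewrite finset.in_setU1 negb_or; apply/andP; split; last by apply/negP => /(avoid _ b'); apply.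
  apply/eqP => e'e; subst e'; apply: ww'; rewrite -ei -eb'.
  by have -> : b' = ~~ b by move: ie; case: (b) (b') => [] [].
by case: wh; rewrite -ei (HL_unique h' h).
Qed.

End Paths.

(** * Functions on the graph *)

Section NonnegativeSums.
Variables (R : numDomainType) (I : finType) (t : I -> R).
Hypothesis t0 : forall i, 0 <= t i.

Lemma ler_sum_term i : t i <= \sum_i t i.
Proof. by rewrite (bigD1 i)//= lerDl sumr_ge0. Qed.

Lemma ler_sum_two_terms i j : i != j -> t i + t j <= \sum_i t i.
Proof.
move=> ij; rewrite (bigD1 i)//= lerD2l (bigD1 j)//=; last by rewrite eq_sym.
by rewrite lerDl sumr_ge0.
Qed.

End NonnegativeSums.

Section H1Intervals.
Variable R : realType.
Implicit Types (D : set R) (u g : R -> R) (l c : R).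

Lemma continuous_primitive l u g : 0 <= l -> sqr_integrable `[0, l] g ->
  (forall x, `[0, l]%classic x -> u x = u 0 + \int[leb]_(y in `[0, x]) g y) ->
  {within `[0, l], continuous u}.
Proof.
move=> l0 /sqr_integrable_itv gi uE.
apply: (@subspace_eq_continuous _ `[0, l] _ (fun x => u 0 + \int[leb]_(y in `[0, x]) g y)).
  by move=> x; rewrite inE => /uE.
apply/subspace_continuousP => x xl; apply: cvgD; first exact: cvg_cst.
by have /subspace_continuousP := parameterized_integral_continuous l0 gi; exact.
Qed.

Lemma H1_segE l u g : 0 < l -> H1_seg l u g <-> H1on `[0, l] u g.
Proof.
move=> l0; split=> [[mg g2 uE]|[[mg g2] _ uE]]; last first.
  by split=> //; rewrite (EFin_Rintegral _ g2)// ltry.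
have gL2 : sqr_integrable `[0, l] g.
  by split=> //; apply: ge0_Rintegrable => //; [exact: measurable_funX|move=> x _; exact: sqr_ge0].
split=> //; apply: continuous_compact_integrable; first exact: segment_compact.
have /subspace_continuousP cu := continuous_primitive (ltW l0) gL2 uE.
apply/subspace_continuousP => x xl.
exact: cvg_exprn (cu x xl).
Qed.

Lemma H1_hlE u g : H1_hl u g <-> H1on `[0, +oo[ u g.
Proof.
have half x : `[0, +oo[%classic x = (0 <= x) :> Prop by rewrite /= in_itv/= andbT.
split=> [[mg g2 u2 uE]|[[mg g2] u2 uE]]; last first.
  split=> //; first by rewrite (EFin_Rintegral _ g2)// ltry.
    by rewrite (EFin_Rintegral _ u2)// ltry.
  by move=> x x0; apply: uE; rewrite half.
have gL2 : sqr_integrable `[0, +oo[ g.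
  by split=> //; apply: ge0_Rintegrable => //; [exact: measurable_funX|move=> x _; exact: sqr_ge0].
split=> //; last by move=> x; rewrite half; exact: uE.
apply: ge0_Rintegrable => //; last by move=> x _; exact: sqr_ge0.
apply: measurable_funX; rewrite itv_bndy_bigcup_BRight; apply/measurable_fun_bigcup => // n.
rewrite add0r; apply: subspace_continuous_measurable_fun => //.
apply: (@continuous_primitive _ _ g) => //.
  by apply: sqr_integrableS gL2 => //; apply: subset_itvl; rewrite bnd_simp.
by move=> x; rewrite /= in_itv/= => /andP[x0 _]; exact: uE.
Qed.

Lemma H1onZl D u g c : initial_segment D -> H1on D u g ->
  H1on D (fun x => c * u x) (fun x => c * g x).
Proof.
move=> sD ug; have mD := initial_segment_measurable sD; have [g2 u2 uE] := ug.
have mu := H1on_measurable sD ug.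
split; [exact: sqr_integrableZl|by have [] := sqr_integrableZl c mD (conj mu u2)|].
move=> x Dx; rewrite uE// mulrDr RintegralZl//.
exact: (H1on_Rintegrable_itv sD ug).
Qed.

End H1Intervals.

Section GraphFunctions.
Variables (R : realType) (G : metric_graph R).
Implicit Types (f : gfun G) (j : edge G) (A : R) (phi : V G -> R).

Definition edge_dom j : set R :=
  match j with inl e => `[0, blen e]%classic | inr h => `[0, +oo[%classic end.
Definition edge_fun f j := match j with inl e => ub f e | inr h => uh f h end.
Definition edge_deriv f j := match j with inl e => gb f e | inr h => gh f h end.

Definition vertex_values f phi :=
  (forall e, ub f e 0 = phi (bsrc e) /\ ub f e (blen e) = phi (btgt e)) /\
  (forall h, uh f h 0 = phi (hsrc h)).

Definition gbounded f A := forall j, bounded_on (edge_dom j) (edge_fun f j) A.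

Lemma initial_segment_edge_dom j : initial_segment (edge_dom j).
Proof.
case: j => [e|h]; last exact: initial_segment_itvcy.
exact: initial_segment_itvcc (ltW (blen_gt0 e)).
Qed.

Lemma measurable_edge_dom j : measurable (edge_dom j).
Proof. exact: initial_segment_measurable (initial_segment_edge_dom j). Qed.

Lemma H1P f : H1 f <-> (exists phi, vertex_values f phi) /\
  (forall j, H1on (edge_dom j) (edge_fun f j) (edge_deriv f j)).
Proof.
split=> [[phi [fb fh]]|[phi fH]]; split=> //.
  case=> [e|h]; last exact/H1_hlE/fh.
  by apply/(H1_segE _ _ (blen_gt0 e)); exact: fb.
split=> [e|h]; last exact/H1_hlE/(fH (inr h)).
by apply/(H1_segE _ _ (blen_gt0 e)); exact: (fH (inl e)).
Qed.

Lemma H1_edge f j : H1 f -> H1on (edge_dom j) (edge_fun f j) (edge_deriv f j).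
Proof. by case/H1P. Qed.

Lemma edge_norm_max f j : H1 f -> exists2 y, edge_dom j y &
  bounded_on (edge_dom j) (edge_fun f j) `|edge_fun f j y|.
Proof.
move=> /(H1_edge j); case: j => [e|h] /= fj.
  have l0 := ltW (blen_gt0 e); have sD := initial_segment_itvcc l0.
  have el : `[0, blen e]%classic (blen e) by rewrite /= in_itv/= l0 lexx.
  have [y ye ymax] := EVT_max l0 (H1on_continuous_norm sD fj (lexx 0) el).
  by exists y.
have [y y0 ymax] := H1on_norm_max fj (lexx 0).
exists y; first by rewrite in_itv/= y0.
by move=> x; rewrite /= in_itv/= andbT; exact: ymax.
Qed.

Lemma gfun_norm_max f j0 : H1 f -> exists j y, edge_dom j y /\ gbounded f `|edge_fun f j y|.
Proof.
move=> Hf.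
have [y yP] := choice (fun j => (exists2P _ _).1 (edge_norm_max j Hf)).
have [j _ jmax] := @Order.TotalTheory.arg_maxP _ _ _ j0 xpredT (fun j => `|edge_fun f j (y j)|) isT.
exists j, (y j); split; first by case: (yP j).
by move=> j' x jx; apply: le_trans ((yP j').2 x jx) _; exact: jmax.
Qed.

Lemma gfun_bounded f : H1 f -> exists A, gbounded f A.
Proof.
move=> Hf; have [B BP] := choice (fun j => let: ex_intro2 y _ yP := edge_norm_max j Hf in
   ex_intro (fun B => bounded_on (edge_dom j) (edge_fun f j) B) _ yP).
exists (\sum_j `|B j|) => j x jx; apply: le_trans (BP j x jx) _; apply: le_trans (ler_norm _) _.
by apply: (ler_sum_term (t := fun j => `|B j|)).
Qed.

Definition Rmass f := \sum_j \int[leb]_(x in edge_dom j) edge_fun f j x ^+ 2.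
Definition Rdnorm f := \sum_j \int[leb]_(x in edge_dom j) edge_deriv f j x ^+ 2.
Definition Rp6 f := \sum_j \int[leb]_(x in edge_dom j) edge_fun f j x ^+ 6.
Definition Renergy f :=
  \sum_j \int[leb]_(x in edge_dom j) energy_density (edge_fun f j) (edge_deriv f j) x.

Lemma Rmass_ge0 f : 0 <= Rmass f.
Proof. by apply: sumr_ge0 => j _; exact: Rintegral_sqr_ge0. Qed.

Lemma Rdnorm_ge0 f : 0 <= Rdnorm f.
Proof. by apply: sumr_ge0 => j _; exact: Rintegral_sqr_ge0. Qed.

Lemma Rp6_ge0 f : 0 <= Rp6 f.
Proof. by apply: sumr_ge0 => j _; apply: Rintegral_ge0 => x _; exact: exprn_even_ge0. Qed.

Lemma edge_mass_le f j : \int[leb]_(x in edge_dom j) edge_fun f j x ^+ 2 <= Rmass f.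
Proof.
apply: (ler_sum_term (t := fun j => \int[leb]_(x in edge_dom j) edge_fun f j x ^+ 2)) => i.
exact: Rintegral_sqr_ge0.
Qed.

Lemma edge_dnorm_le f j : \int[leb]_(x in edge_dom j) edge_deriv f j x ^+ 2 <= Rdnorm f.
Proof.
apply: (ler_sum_term (t := fun j => \int[leb]_(x in edge_dom j) edge_deriv f j x ^+ 2)) => i.
exact: Rintegral_sqr_ge0.
Qed.

Lemma Rmass_eq0 f : (forall j x, edge_dom j x -> edge_fun f j x = 0) -> Rmass f = 0.
Proof.
move=> f0; rewrite /Rmass big1// => j _.
rewrite (@eq_Rintegral _ _ _ _ _ (fun=> 0)); first by rewrite /Rintegral integral0.
by move=> x; rewrite inE => jx; rewrite f0// expr0n.
Qed.

Lemma gintE (F : R -> R) (w : edge G -> R -> R) :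
  (forall j, Rintegrable (edge_dom j) (fun x => F (w j x))) ->
  gint F (w \o inl) (w \o inr) = (\sum_j \int[leb]_(x in edge_dom j) F (w j x))%:E.
Proof.
move=> wi; rewrite /gint big_sumType EFinD -!sumEFin; congr (_ + _)%E.
  by apply: eq_bigr => e _; rewrite -(EFin_Rintegral (measurable_edge_dom _) (wi (inl e))).
by apply: eq_bigr => h _; rewrite -(EFin_Rintegral (measurable_edge_dom _) (wi (inr h))).
Qed.

Section SobolevFunction.
Variable f : gfun G.
Hypothesis Hf : H1 f.

Lemma massE : mass f = (Rmass f)%:E.
Proof. by apply: (gintE (w := edge_fun f)) => j; have [] := H1_edge j Hf. Qed.

Lemma dnormE : dnorm f = (Rdnorm f)%:E.
Proof. by apply: (gintE (w := edge_deriv f)) => j; have [[]] := H1_edge j Hf. Qed.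

Lemma Rintegrable_edge_exprn j n : Rintegrable (edge_dom j) (fun x => edge_fun f j x ^+ n.+2).
Proof.
have [A fA] := gfun_bounded Hf.
exact: (H1on_Rintegrable_exprn (initial_segment_edge_dom j) (H1_edge j Hf) n (fA j)).
Qed.

Lemma p6E : p6 f = (Rp6 f)%:E.
Proof.
have norm6 : (fun y : R => `|y| ^+ 6) = (fun y => y ^+ 6).
  by apply/funext => y; rewrite -normrX ger0_norm// exprn_even_ge0.
rewrite /p6 norm6; apply: (gintE (F := fun y => y ^+ 6) (w := edge_fun f)) => j.
exact: Rintegrable_edge_exprn.
Qed.

Lemma RenergyE : Renergy f = 2^-1 * Rdnorm f - 6^-1 * Rp6 f.
Proof.
rewrite /Renergy /Rdnorm /Rp6 !mulr_sumr -sumrB; apply: eq_bigr => j _.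
have mj := measurable_edge_dom j; have [[_ g2] _ _] := H1_edge j Hf.
have u6 := Rintegrable_edge_exprn j 4.
by rewrite RintegralB//; [rewrite !RintegralZl|exact: RintegrableZl..].
Qed.

Lemma energyE : energy f = (Renergy f)%:E.
Proof. by rewrite /energy dnormE p6E RenergyE -!EFinM -EFinB. Qed.

Lemma sum_shifted_density A : 0 < A -> gbounded f A ->
  \sum_j \int[leb]_(x in edge_dom j) shifted_density A (edge_fun f j) (edge_deriv f j) x =
  Renergy f + A ^+ 4 / 6 * Rmass f.
Proof.
move=> A0 fA; rewrite /Renergy /Rmass mulr_sumr -big_split/=; apply: eq_bigr => j _.
have mj := measurable_edge_dom j.
by rewrite (Rintegral_shifted_density (initial_segment_edge_dom j) (H1_edge j Hf) A0).
Qed.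

Lemma Rp6_le A : gbounded f A -> Rp6 f <= A ^+ 4 * Rmass f.
Proof.
move=> fA; rewrite /Rp6 /Rmass mulr_sumr; apply: ler_sum => j _.
have mj := measurable_edge_dom j; have [_ u2 _] := H1_edge j Hf.
rewrite -RintegralZl//; apply: le_Rintegral => //; last first.
- by move=> x jx; rewrite (exprD _ 4 2) ler_wpM2r ?sqr_ge0// ler_even_exprn_norm// fA.
- exact: RintegrableZl.
- exact: Rintegrable_edge_exprn.
Qed.

Lemma Renergy_ge A : gbounded f A -> - (A ^+ 4 * Rmass f) <= Renergy f.
Proof.
by move=> /Rp6_le; rewrite RenergyE; have := Rp6_ge0 f; have := Rdnorm_ge0 f; lra.
Qed.

End SobolevFunction.
End GraphFunctions.

Section Scaling.
Variables (R : realType) (G : metric_graph R).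
Implicit Types (f : gfun G) (j : edge G) (c : R).

Definition gscale c f : gfun G := GFun
  (fun e x => c * ub f e x) (fun e x => c * gb f e x)
  (fun h x => c * uh f h x) (fun h x => c * gh f h x).

Lemma edge_fun_gscale c f j : edge_fun (gscale c f) j = (fun x => c * edge_fun f j x).
Proof. by case: j. Qed.

Lemma edge_deriv_gscale c f j : edge_deriv (gscale c f) j = (fun x => c * edge_deriv f j x).
Proof. by case: j. Qed.

Lemma H1_gscale c f : H1 f -> H1 (gscale c f).
Proof.
move=> /H1P[[phi [fb fh]] fH]; apply/H1P; split.
  exists (fun v => c * phi v); split=> [e|h] /=; last by rewrite fh.
  by have [-> ->] := fb e.
move=> j; rewrite edge_fun_gscale edge_deriv_gscale.
by apply: H1onZl => //; exact: initial_segment_edge_dom.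
Qed.

Lemma Rintegral_exprnZl (D : set R) (u : R -> R) c n : measurable D ->
  Rintegrable D (fun x => u x ^+ n) ->
  \int[leb]_(x in D) (c * u x) ^+ n = c ^+ n * \int[leb]_(x in D) u x ^+ n.
Proof. by move=> mD ui; rewrite -RintegralZl//; apply: eq_Rintegral => x _; rewrite exprMn. Qed.

Lemma Rmass_gscale c f : H1 f -> Rmass (gscale c f) = c ^+ 2 * Rmass f.
Proof.
move=> Hf; rewrite /Rmass mulr_sumr; apply: eq_bigr => j _.
rewrite edge_fun_gscale Rintegral_exprnZl//; first exact: measurable_edge_dom.
by have [] := H1_edge j Hf.
Qed.

Lemma Rdnorm_gscale c f : H1 f -> Rdnorm (gscale c f) = c ^+ 2 * Rdnorm f.
Proof.
move=> Hf; rewrite /Rdnorm mulr_sumr; apply: eq_bigr => j _.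
rewrite edge_deriv_gscale Rintegral_exprnZl//; first exact: measurable_edge_dom.
by have [[]] := H1_edge j Hf.
Qed.

Lemma Rp6_gscale c f : H1 f -> Rp6 (gscale c f) = c ^+ 6 * Rp6 f.
Proof.
move=> Hf; rewrite /Rp6 mulr_sumr; apply: eq_bigr => j _.
rewrite edge_fun_gscale Rintegral_exprnZl//; first exact: measurable_edge_dom.
exact: Rintegrable_edge_exprn.
Qed.

Lemma Renergy_gscale c f : H1 f ->
  Renergy (gscale c f) = 2^-1 * c ^+ 2 * Rdnorm f - 6^-1 * c ^+ 6 * Rp6 f.
Proof.
move=> Hf; rewrite RenergyE; last exact: H1_gscale.
by rewrite Rdnorm_gscale// Rp6_gscale//; ring.
Qed.

End Scaling.

Section EdgeCost.
Variables (R : realType) (G : metric_graph R).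
Implicit Types (f : gfun G) (j : edge G) (A s r t : R) (E : set R).

Definition edge_cost A f j E :=
  \int[leb]_(x in E) shifted_density A (edge_fun f j) (edge_deriv f j) x.

Lemma gboundedW f a A : a <= A -> gbounded f a -> gbounded f A.
Proof. by move=> aA fa j x jx; apply: le_trans (fa j x jx) aA. Qed.

Variables (f : gfun G) (A : R) (phi : V G -> R).
Hypotheses (Hf : H1 f) (A0 : 0 < A) (fA : gbounded f A).

Lemma edge_cost_ge0 j E : E `<=` edge_dom j -> 0 <= edge_cost A f j E.
Proof.
by move=> Ej; apply: Rintegral_shifted_density_ge0 => //; exact: (bounded_onS Ej (@fA j)).
Qed.

Lemma edge_cost_le j E E' : measurable E -> measurable E' -> E' `<=` E -> E `<=` edge_dom j ->
  edge_cost A f j E' <= edge_cost A f j E.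
Proof.
move=> mE mE' E'E Ej.
apply: (subset_Rintegral_shifted_density (initial_segment_edge_dom j) (H1_edge j Hf)) => //.
exact: (bounded_onS Ej (@fA j)).
Qed.

Lemma edge_cost_split j s r (b : itv_bound R) : s <= r -> (BRight r <= b)%O ->
  [set` Interval (BLeft s) b] `<=` edge_dom j ->
  edge_cost A f j [set` Interval (BLeft s) b] =
  edge_cost A f j `[s, r] + edge_cost A f j [set` Interval (BLeft r) b].
Proof.
move=> sr rb sub; apply: Rintegral_itv_split => //.
apply: (Rintegrable_shifted_density (initial_segment_edge_dom j) (H1_edge j Hf)) => //.
exact: (bounded_onS sub (@fA j)).
Qed.

Lemma calib_edge_increment_le j s t : 0 <= s -> s <= t -> edge_dom j t ->
  `|calib A (edge_fun f j t) - calib A (edge_fun f j s)| <= edge_cost A f j `[s, t].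
Proof.
move=> s0 st jt; have sD := initial_segment_edge_dom j.
apply: (calib_increment_le sD (H1_edge j Hf)) => //.
exact: (bounded_onS (initial_segment_subset sD s0 jt) (@fA j)).
Qed.

Lemma calib_halfline_le h s : 0 <= s -> calib A (uh f h s) <= edge_cost A f (inr h) `[s, +oo[.
Proof.
move=> s0; apply: (calib_le_tail (H1_edge (inr h) Hf)) => //.
by apply: (bounded_onS _ (@fA (inr h))); apply: subset_itvr; rewrite bnd_simp.
Qed.

Lemma sum_edge_cost :
  \sum_j edge_cost A f j (edge_dom j) = Renergy f + A ^+ 4 / 6 * Rmass f.
Proof. exact: sum_shifted_density. Qed.

Lemma edge_cost_dom_ge0 j : 0 <= edge_cost A f j (edge_dom j).
Proof. exact: edge_cost_ge0. Qed.

Lemma edge_cost_dom_le_sum j :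
  edge_cost A f j (edge_dom j) <= \sum_i edge_cost A f i (edge_dom i).
Proof. exact: (ler_sum_term (t := fun i => edge_cost A f i (edge_dom i)) edge_cost_dom_ge0). Qed.

Lemma edge_cost_dom_le_sum2 i j : i != j ->
  edge_cost A f i (edge_dom i) + edge_cost A f j (edge_dom j) <=
  \sum_k edge_cost A f k (edge_dom k).
Proof.
exact: (ler_sum_two_terms (t := fun i => edge_cost A f i (edge_dom i)) edge_cost_dom_ge0).
Qed.

Hypothesis fphi : vertex_values f phi.

Lemma edge_fun_end e b : ub f e (if b then 0 else blen e) = phi (edge_end e b).
Proof. by have [fb _] := fphi; case: b; have [] := fb e. Qed.

Lemma calib_edge_le e :
  `|calib A (phi (bsrc e)) - calib A (phi (btgt e))| <= edge_cost A f (inl e) (edge_dom (inl e)).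
Proof.
rewrite -(edge_fun_end e true) -(edge_fun_end e false) distrC.
have l0 := ltW (blen_gt0 e).
by apply: (@calib_edge_increment_le (inl e) 0 (blen e)) => //=; rewrite in_itv/= l0 lexx.
Qed.

Lemma path_cost_le w h P e0 : linked w (hsrc h) P -> e0 \notin P ->
  edge_cost A f (inl e0) (edge_dom (inl e0)) + calib A (phi w) <=
  \sum_j edge_cost A f j (edge_dom j).
Proof.
move=> lP e0P; rewrite big_sumType/=.
have edge0 e := edge_cost_dom_ge0 (inl e); have hl0 h := edge_cost_dom_ge0 (inr h).
have last_step : calib A (phi (hsrc h)) <= edge_cost A f (inr h) (edge_dom (inr h)).
  by have [_ <-] := fphi; exact: calib_halfline_le.
have := ler_sum_term hl0 h.
have : calib A (phi w) - calib A (phi (hsrc h)) <=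
    \sum_(e in P) edge_cost A f (inl e) (edge_dom (inl e)).
  apply: le_trans (ler_norm _) _; apply: le_trans (lP (fun v => calib A (phi v))) _.
  by apply: ler_sum => e _; exact: calib_edge_le.
have : edge_cost A f (inl e0) (edge_dom (inl e0)) +
    \sum_(e in P) edge_cost A f (inl e) (edge_dom (inl e)) <=
    \sum_e edge_cost A f (inl e) (edge_dom (inl e)).
  rewrite [leRHS](bigID (fun e => e \in P))/= addrC lerD2r (bigD1 e0)//= lerDl.
  by apply: sumr_ge0 => e _; exact: edge0.
lra.
Qed.

End EdgeCost.

(** * The Gagliardo-Nirenberg inequality *)

Section SparedSet.
Variables (R : realType) (G : metric_graph R).
Hypotheses (conn : connected_graph G) (oneHL : #|HL G| = 1%N).
Hypothesis noterm : forall v : V G, ~ terminal_point v.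
Variables (f : gfun G) (a : R) (phi : V G -> R) (h0 : HL G).
Hypotheses (Hf : H1 f) (a0 : 0 < a) (fa : gbounded f a) (fphi : vertex_values f phi).

(* A set of positive mass avoided by some path from a point where [|u| = a] to infinity. *)
Definition spared j S := [/\ measurable S, S `<=` edge_dom j,
  0 < \int[leb]_(x in S) edge_fun f j x ^+ 2 &
  forall A, a <= A ->
    calib A a + edge_cost A f j S <= \sum_j edge_cost A f j (edge_dom j)].

Let edge_mass_gt0 j s t c : 0 <= s -> s < t -> edge_dom j t -> s <= c <= t ->
  `|edge_fun f j c| = a -> 0 < \int[leb]_(x in `[s, t]) edge_fun f j x ^+ 2.
Proof.
move=> s0 st jt cst fc.
apply: (H1on_mass_gt0 (initial_segment_edge_dom j) (H1_edge j Hf) s0 st jt cst).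
by rewrite -normr_gt0 fc.
Qed.

Lemma spared_from_vertex w : `|phi w| = a -> exists j S, spared j S.
Proof.
move=> wa; have [P [e [b [lP eP eb]]]] := linked_avoiding_end conn oneHL w h0 noterm.
have l0 := blen_gt0 e; exists (inl e), (edge_dom (inl e)); split => //.
- exact: measurable_edge_dom.
- apply: (@edge_mass_gt0 (inl e) 0 (blen e) (if b then 0 else blen e)) => //.
  + by rewrite /= in_itv/= lexx ltW.
  + by case: (b); rewrite lexx ltW.
  + by rewrite /= (edge_fun_end fphi) eb.
- move=> A aA; rewrite addrC -wa calib_norm.
  exact: (path_cost_le Hf (lt_le_trans a0 aA) (gboundedW aA fa) fphi lP eP).
Qed.

Lemma spared_from_halfline h y : 0 < y -> `|uh f h y| = a -> exists j S, spared j S.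
Proof.
move=> y0 ya; have y0' := ltW y0.
have hy : edge_dom (inr h) y by rewrite /= in_itv/= y0'.
exists (inr h), [set` `[0, y]]; split => //.
- by apply: subset_itvl; rewrite bnd_simp.
- by apply: (@edge_mass_gt0 (inr h) 0 y y) => //; rewrite lexx y0'.
- move=> A aA; have A0 := lt_le_trans a0 aA; have fA := gboundedW aA fa.
  apply: le_trans (edge_cost_dom_le_sum A0 fA (inr h)).
  have -> := edge_cost_split (j := inr h) (b := BInfty R false) Hf A0 fA y0' isT (fun=> id).
  by rewrite addrC lerD2l -ya calib_norm; exact: calib_halfline_le.
Qed.

Lemma spared_from_edge e y : 0 < y -> y < blen e -> `|ub f e y| = a -> exists j S, spared j S.
Proof.
move=> y0 yl ya; have [y0' yl'] := (ltW y0, ltW yl).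
have el : edge_dom (inl e) (blen e) by rewrite /= in_itv/= lexx (le_trans y0').
have ey : edge_dom (inl e) y by rewrite /= in_itv/= y0'.
have [P [b [eP lP]]] := linked_avoiding_edge conn e (hsrc h0).
suff cost A : a <= A ->
    calib A a + edge_cost A f (inl e) (if b then `[y, blen e]%classic else `[0, y]%classic) <=
    \sum_j edge_cost A f j (edge_dom j).
  case: b lP cost => _ cost.
    exists (inl e), [set` `[y, blen e]]; split=> //.
      by apply: subset_itvr; rewrite bnd_simp.
    by apply: (edge_mass_gt0 (c := y)); rewrite ?lexx.
  exists (inl e), [set` `[0, y]]; split=> //.
    by apply: subset_itvl; rewrite bnd_simp.
  by apply: (edge_mass_gt0 (c := y)); rewrite ?lexx ?y0'.
move=> aA; have A0 := lt_le_trans a0 aA; have fA := gboundedW aA fa.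
apply: le_trans (path_cost_le Hf A0 fA fphi lP eP).
have -> := edge_cost_split (j := inl e) (b := BRight (blen e)) Hf A0 fA y0' yl' (fun=> id).
rewrite -(edge_fun_end fphi) -ya calib_norm.
have incr s t := calib_edge_increment_le (j := inl e) Hf A0 fA (s := s) (t := t).
case: (b) => /=.
  by have := le_trans (ler_norm _) (incr 0 y (lexx _) y0' ey); rewrite /=; lra.
by have := incr y _ y0' yl' el; rewrite distrC => /(le_trans (ler_norm _)) /=; lra.
Qed.

Lemma exists_spared j y : edge_dom j y -> `|edge_fun f j y| = a -> exists j S, spared j S.
Proof.
have [fb fh] := fphi; case: j => [e|h] /=; rewrite in_itv/=; last first.
  rewrite andbT le_eqVlt => /predU1P[<-|y0]; last exact: spared_from_halfline.
  by rewrite fh; exact: spared_from_vertex.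
case/andP; rewrite le_eqVlt => /predU1P[<- _|y0].
  by rewrite (fb e).1; exact: spared_from_vertex.
rewrite le_eqVlt => /predU1P[->|yl]; last exact: spared_from_edge.
by rewrite (fb e).2; exact: spared_from_vertex.
Qed.

Lemma Renergy_ge_spared j S A : spared j S -> a <= A ->
  calib A a - A ^+ 4 / 6 * (Rmass f - \int[leb]_(x in S) edge_fun f j x ^+ 2)
    - a ^+ 4 / 6 * \int[leb]_(x in S) edge_fun f j x ^+ 2 <= Renergy f.
Proof.
move=> [mS Sj S0 /(_ A)cost] aA; move: (cost aA).
have A0 := lt_le_trans a0 aA; have fA := gboundedW aA fa.
have sD := initial_segment_edge_dom j; have fj := H1_edge j Hf.
rewrite (sum_edge_cost Hf A0 fA) /edge_cost.
rewrite (Rintegral_shifted_density sD fj A0 mS Sj (bounded_onS Sj (@fA j))).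
have := Rintegral_shifted_density sD fj a0 mS Sj (bounded_onS Sj (@fa j)).
have := edge_cost_ge0 a0 fa Sj; rewrite /edge_cost; lra.
Qed.

End SparedSet.

Section GagliardoNirenberg.
Variables (R : realType) (G : metric_graph R).
Hypotheses (conn : connected_graph G) (oneHL : #|HL G| = 1%N).
Hypothesis noterm : forall v : V G, ~ terminal_point v.
Implicit Types f : gfun G.

Lemma mu_halfline_gt0 : 0 < mu_halfline R.
Proof. by rewrite /mu_halfline divr_gt0// mulr_gt0 ?pi_gt0// sqrtr_gt0. Qed.

Lemma exists_norm_max_gt0 f : H1 f -> Rmass f != 0 ->
  exists j y, [/\ edge_dom j y, gbounded f `|edge_fun f j y| & 0 < `|edge_fun f j y|].
Proof.
move=> Hf f0; have [h] := exists_HL oneHL.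
have [j [y [jy fmax]]] := gfun_norm_max (inr h) Hf; exists j, y; split => //.
rewrite normr_gt0; apply: contra f0 => /eqP fy; apply/eqP/Rmass_eq0 => i x ix.
by have := fmax i x ix; rewrite fy normr0 normr_le0 => /eqP.
Qed.

(* The calibration is used with [A = a (1 + t)], [t] small: the spared mass earns a multiple of
   [t], while [calib A a] falls short of [calib A A] by [O(t^(3/2))] only. *)
Lemma Renergy_gt0 f : H1 f -> Rmass f != 0 -> Rmass f <= mu_halfline R -> 0 < Renergy f.
Proof.
move=> Hf f0 fle; have [j0 [y [jy fmax a0]]] := exists_norm_max_gt0 Hf f0.
have [[phi fphi] _] := (H1P f).1 Hf; have [h0] := exists_HL oneHL.
have [j [S sS]] := exists_spared conn oneHL noterm h0 Hf a0 fmax fphi jy erefl.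
have [_ _ S0 _] := sS; set a := `|edge_fun f j0 y| in a0 sS *.
set mS := \int[leb]_(x in S) edge_fun f j x ^+ 2 in S0.
pose s := Num.min 1 (mS / 2).
have s0 : 0 < s by rewrite lt_min ltr01 divr_gt0.
have s1 : s <= 1 by rewrite ge_min lexx.
have sS2 : s <= mS / 2 by rewrite ge_min lexx orbT.
pose t := s ^+ 2 / 5.
have t0 : 0 < t by rewrite divr_gt0// exprn_gt0.
have t5 : t <= 1 / 5 by rewrite ler_pM2r// expr_le1// ltW.
have st : Num.sqrt (5 * t) = s.
  by rewrite /t mulrC divfK// sqrtr_sqr ger0_norm// ltW.
have tI : 0 <= t <= 1 / 5 by rewrite ltW.
have := calib_diag_le a0 tI.
have aA : a <= a * (1 + t) by rewrite ler_peMr ?(ltW a0)// lerDl ltW.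
have := Renergy_ge_spared Hf a0 fmax sS aA; rewrite -/mS.
rewrite (calib_diag (lt_le_trans a0 aA)) st exprMn.
have a4 : 0 < a ^+ 4 by rewrite exprn_gt0.
set q := a ^+ 4 in a4 *; set c := calib _ _.
have growth : 4 * t <= (1 + t) ^+ 4 - 1.
  have -> : (1 + t) ^+ 4 - 1 = 4 * t + t ^+ 2 * (6 + 4 * t + t ^+ 2) by ring.
  by rewrite lerDl mulr_ge0 ?sqr_ge0// !addr_ge0 ?sqr_ge0// mulr_ge0// ltW.
have p0 : 0 <= q * (1 + t) ^+ 4 / 6 by rewrite divr_ge0// mulr_ge0 ?(ltW a4)// exprn_ge0//; lra.
have := ler_wpM2l p0 fle.
have : q * (4 * t) * mS <= q * ((1 + t) ^+ 4 - 1) * mS by rewrite ler_pM2r// ler_pM2l.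
have : q * t * s <= q * t * (mS / 2) by rewrite ler_pM2l// mulr_gt0.
have : 0 < q * t * mS by rewrite !mulr_gt0.
lra.
Qed.

Lemma gagliardo_nirenberg f : H1 f -> Rmass f != 0 ->
  Rp6 f * mu_halfline R ^+ 2 < 3 * Rmass f ^+ 2 * Rdnorm f.
Proof.
move=> Hf f0; have fgt : 0 < Rmass f by rewrite lt_neqAle eq_sym f0 Rmass_ge0.
have m0 := mu_halfline_gt0.
pose c := Num.sqrt (mu_halfline R / Rmass f).
have c2 : c ^+ 2 = mu_halfline R / Rmass f by rewrite sqr_sqrtr// divr_ge0// ltW.
have cmass : Rmass (gscale c f) = mu_halfline R by rewrite Rmass_gscale// c2 divfK// gt_eqF.
have := @Renergy_gt0 (gscale c f) (H1_gscale c Hf); rewrite cmass gt_eqF// => /(_ isT (lexx _)).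
rewrite Renergy_gscale// (exprM c 2 3) c2.
set q := mu_halfline R in m0 *; set M := Rmass f in fgt *.
have -> : 2^-1 * (q / M) * Rdnorm f - 6^-1 * (q / M) ^+ 3 * Rp6 f =
  q / (6 * M ^+ 3) * (3 * M ^+ 2 * Rdnorm f - Rp6 f * q ^+ 2) by field; rewrite gt_eqF.
by rewrite pmulr_rgt0 ?subr_gt0// divr_gt0// mulr_gt0// exprn_gt0.
Qed.

End GagliardoNirenberg.

(** * Coercivity *)

Section CoreScale.
Variables (R : realType) (G : metric_graph R).

(* A harmonic sum rather than a minimum, so that no edge needs to be exhibited. *)
Definition core_scale : R := (1 + \sum_e (blen (m := G) e / 12)^-1)^-1.

Let inv_len_ge0 (e : BE G) : 0 <= (blen e / 12)^-1.
Proof. by rewrite invr_ge0 divr_ge0// ltW// blen_gt0. Qed.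

Lemma core_scale_gt0 : 0 < core_scale.
Proof. by rewrite invr_gt0 ltr_pwDl// sumr_ge0. Qed.

Lemma core_scale_le (e : BE G) : core_scale <= blen e / 12.
Proof.
have len0 : 0 < blen e / 12 by rewrite divr_gt0// blen_gt0.
rewrite -[leRHS]invrK lef_pV2 ?posrE ?invr_gt0//; last by rewrite ltr_pwDl// sumr_ge0.
by apply: le_trans (ler_sum_term inv_len_ge0 e) _; rewrite lerDr.
Qed.

End CoreScale.

Section Coercivity.
Variables (R : realType) (G : metric_graph R).
Hypothesis oneHL : #|HL G| = 1%N.
Hypothesis noterm : forall v : V G, ~ terminal_point v.

Definition escape_loss (m a : R) := 256 * m / (a ^+ 2 * core_scale G ^+ 3).

Section TwoEscapes.
Variables (f : gfun G) (a : R) (phi : V G -> R).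
Hypotheses (Hf : H1 f) (a0 : 0 < a) (fa : gbounded f a) (fphi : vertex_values f phi).
Hypothesis large : 4 * Rmass f <= a ^+ 2 * core_scale G.
Local Notation cost := (edge_cost a f).
Local Notation loss := (escape_loss (Rmass f) a).
Local Notation total := (\sum_j cost j (edge_dom j)).

Lemma escape_loss_ge0 : 0 <= loss.
Proof.
have k0 := core_scale_gt0 G.
by rewrite divr_ge0 ?mulr_ge0 ?Rmass_ge0// ltW// ?exprn_gt0.
Qed.

Lemma edge_escape e s t : 0 <= s -> t <= blen e -> blen e / 4 <= t - s ->
  calib a (ub f e s) - loss <= cost (inl e) `[s, t] /\
  calib a (ub f e t) - loss <= cost (inl e) `[s, t].
Proof.
move=> s0 tl st; have l0 := blen_gt0 e; have stlt : s < t by lra.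
have sD := initial_segment_edge_dom (inl e : edge G); have mD := initial_segment_measurable sD.
have te : edge_dom (inl e) t by rewrite /= in_itv/=; apply/andP; split; lra.
have sub := initial_segment_subset sD s0 te.
have k0 := core_scale_gt0 G; have kl : core_scale G <= (t - s) / 3.
  by have := core_scale_le e; lra.
have fM : \int[leb]_(x in `[s, t]) ub f e x ^+ 2 <= Rmass f.
  apply: le_trans (edge_mass_le f (inl e)); apply: subset_Rintegral_sqr => //.
  by have [] := H1_edge (inl e) Hf.
have [|escs esct] := escape_endpoints sD (H1_edge (inl e) Hf) a0 s0 te
  (bounded_onS sub (@fa (inl e))) fM stlt.
  by apply: le_trans large _; rewrite ler_wpM2l// sqr_ge0.
have le_loss : 256 * Rmass f / (a ^+ 2 * ((t - s) / 3) ^+ 3) <= loss.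
  have l3 : 0 < (t - s) / 3 := lt_le_trans k0 kl.
  have pos l : 0 < l -> 0 < a ^+ 2 * l ^+ 3 by move=> lpos; rewrite mulr_gt0 ?exprn_gt0.
  apply: ler_wpM2l; first by rewrite mulr_ge0 ?Rmass_ge0.
  rewrite lef_pV2 ?posrE ?pos//; apply: ler_wpM2l; first exact: sqr_ge0.
  by apply: lerXn2r => //; rewrite nnegrE ltW.
by split; [apply: le_trans escs|apply: le_trans esct]; rewrite lerD2l lerN2.
Qed.

Definition quarter (e : BE G) (b : bool) : set R :=
  if b then `[0, blen e / 4]%classic else `[3 * blen e / 4, blen e]%classic.

Lemma quarter_subset e b : quarter e b `<=` edge_dom (inl e).
Proof.
have l0 := blen_gt0 e.
by case: b => x; rewrite /= !in_itv/= => /andP[? ?]; apply/andP; split; lra.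
Qed.

Lemma quarter_escape e b : calib a (phi (edge_end e b)) - loss <= cost (inl e) (quarter e b).
Proof.
have l0 := blen_gt0 e; rewrite -(edge_fun_end fphi); case: b => /=.
  by have [] := @edge_escape e 0 (blen e / 4); [| |lra|]; lra.
by have [] := @edge_escape e (3 * blen e / 4) (blen e); [| |lra|]; lra.
Qed.

Lemma quarter_cost_ge0 e b : 0 <= cost (inl e) (quarter e b).
Proof. by apply: edge_cost_ge0 => //; exact: quarter_subset. Qed.

Lemma edge_dom_escape e b : calib a (phi (edge_end e b)) - loss <= cost (inl e) (edge_dom (inl e)).
Proof.
apply: le_trans (quarter_escape e b) _.
apply: edge_cost_le => //; [exact: measurable_edge_dom| |exact: quarter_subset].
by case: b; exact: measurable_itv.
Qed.

(* An end of an edge has degree at least two, so it can be left without using the edge, except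
   possibly through the quarter at its other end. *)
Lemma escape_past_end e b X :
  X + cost (inl e) (quarter e (~~ b)) <= cost (inl e) (edge_dom (inl e)) ->
  X + (calib a (phi (edge_end e b)) - loss) <= total.
Proof.
move=> Xe; have Xle : X <= cost (inl e) (edge_dom (inl e)).
  by apply: le_trans Xe; rewrite lerDl quarter_cost_ge0.
have [[[e' b']|h] ie ve] := exists_other_half_edge (i := inl (e, b)) erefl (@noterm _).
  rewrite /= in ve; have [e'e|e'e] := eqVneq e' e.
    apply: le_trans (edge_cost_dom_le_sum a0 fa (inl e)); apply: le_trans Xe.
    have -> : ~~ b = b' by move: ie; rewrite e'e; case: (b) (b') => [] []; rewrite ?eqxx.
    by rewrite lerD2l -ve -e'e; exact: quarter_escape.
  apply: le_trans (edge_cost_dom_le_sum2 a0 fa (i := inl e) (j := inl e') _); last first.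
    by apply: contra e'e => /eqP[->].
  by apply: lerD => //; rewrite -ve; exact: edge_dom_escape.
apply: le_trans (edge_cost_dom_le_sum2 a0 fa (i := inl e) (j := inr h) isT).
apply: lerD => //; rewrite /= in ve; rewrite -ve -fphi.2.
by have := calib_halfline_le Hf a0 fa h (lexx 0); have := escape_loss_ge0; rewrite /=; lra.
Qed.

Lemma two_escapes_from_halfline h y : 0 <= y -> `|uh f h y| = a ->
  2 * (calib a a - loss) <= total.
Proof.
move=> y0 ya; have [e [b eb]] := exists_edge_at_halfline oneHL (@noterm (hsrc h)).
apply: le_trans (edge_cost_dom_le_sum2 a0 fa (i := inl e) (j := inr h) isT).
have := edge_dom_escape e b; rewrite eb -fphi.2.
have := calib_halfline_le Hf a0 fa h y0.
have hy : edge_dom (inr h) y by rewrite /= in_itv/= y0.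
have := calib_edge_increment_le Hf a0 fa (lexx 0) y0 hy => /(le_trans (ler_norm _)).
have -> := edge_cost_split (j := inr h) (b := BInfty R false) Hf a0 fa y0 isT (fun=> id).
have -> : calib a (edge_fun f (inr h) y) = calib a a by rewrite -calib_norm ya.
by rewrite /=; have := escape_loss_ge0; lra.
Qed.

Let edge_cost_split3 e s t : 0 <= s -> s <= t -> t <= blen e ->
  cost (inl e) (edge_dom (inl e)) =
  cost (inl e) `[0, s] + cost (inl e) `[s, t] + cost (inl e) `[t, blen e].
Proof.
move=> s0 st tl; have t0 : 0 <= t := le_trans s0 st.
have -> := edge_cost_split (j := inl e) (b := BRight (blen e)) Hf a0 fa t0 tl (fun=> id).
congr (_ + _); apply: (@edge_cost_split _ _ f a Hf a0 fa (inl e) 0 s (BRight t)) => //.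
by apply: subset_itvl; rewrite bnd_simp.
Qed.

Let edge_increment e s t : 0 <= s -> s <= t -> t <= blen e ->
  `|calib a (ub f e t) - calib a (ub f e s)| <= cost (inl e) `[s, t].
Proof.
move=> s0 st tl; apply: (calib_edge_increment_le Hf a0 fa (j := inl e)) => //=.
by rewrite in_itv/= tl (le_trans s0 st).
Qed.

Lemma two_escapes_from_edge e y : 0 <= y -> y <= blen e -> `|ub f e y| = a ->
  2 * (calib a a - loss) <= total.
Proof.
move=> y0 yl ya; have l0 := blen_gt0 e.
have cy : calib a (ub f e y) = calib a a by rewrite -calib_norm ya.
have [ly|yl2] := leP (blen e / 2) y.
  have : cost (inl e) `[blen e / 4, y] + cost (inl e) `[y, blen e] +
      cost (inl e) (quarter e true) <= cost (inl e) (edge_dom (inl e)).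
    by rewrite (@edge_cost_split3 e (blen e / 4) y)/=; lra.
  move/(@escape_past_end e false); apply: le_trans; rewrite -(edge_fun_end fphi e false).
  have [|||_] := @edge_escape e (blen e / 4) y; [lra|lra|lra|].
  have := edge_increment y0 yl (lexx _); rewrite cy distrC => /(le_trans (ler_norm _)).
  lra.
have : cost (inl e) `[0, y] + cost (inl e) `[y, 3 * blen e / 4] +
    cost (inl e) (quarter e false) <= cost (inl e) (edge_dom (inl e)).
  by rewrite (@edge_cost_split3 e y (3 * blen e / 4))/=; lra.
move/(@escape_past_end e true); apply: le_trans; rewrite -(edge_fun_end fphi e true).
have [|||+ _] := @edge_escape e y (3 * blen e / 4); [lra|lra|lra|].
have := edge_increment (lexx 0) y0 yl; rewrite cy => /(le_trans (ler_norm _)).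
lra.
Qed.

Lemma two_escapes j y : edge_dom j y -> `|edge_fun f j y| = a -> 2 * (calib a a - loss) <= total.
Proof.
case: j => [e|h] /=; rewrite in_itv/=; last by rewrite andbT; exact: two_escapes_from_halfline.
by case/andP; exact: two_escapes_from_edge.
Qed.

End TwoEscapes.

Lemma Renergy_coercive (f : gfun G) j y : H1 f -> Rmass f <= mu_line R -> edge_dom j y ->
  gbounded f `|edge_fun f j y| -> 0 < `|edge_fun f j y| ->
  4 * Rmass f <= `|edge_fun f j y| ^+ 2 * core_scale G ->
  - (2 * escape_loss (Rmass f) `|edge_fun f j y|) <= Renergy f.
Proof.
move=> Hf fle jy fa a0 large; have [[phi fphi] _] := (H1P f).1 Hf.
have := two_escapes Hf a0 fa fphi large jy erefl.
rewrite (sum_edge_cost Hf a0 fa) calib_diag//; set a := `|edge_fun f j y| in a0 *.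
have a4 : 0 <= a ^+ 4 / 6 by rewrite divr_ge0// exprn_ge0// ltW.
by have := ler_wpM2l a4 fle; rewrite mu_lineE; lra.
Qed.

Lemma negative_energy_bounded (m c : R) : 0 < m -> m <= mu_line R -> 0 < c ->
  exists2 A : R, 0 <= A & forall f : gfun G, H1 f -> Rmass f = m -> Renergy f <= - c ->
    gbounded f A.
Proof.
move=> m0 ml c0; have k0 := core_scale_gt0 G.
have k30 : 0 < core_scale G ^+ 3 by rewrite exprn_gt0.
pose Q := 4 * m / core_scale G + 512 * m / (c * core_scale G ^+ 3).
have Q1 : 0 <= 4 * m / core_scale G by rewrite divr_ge0 ?mulr_ge0// ltW.
have Q2 : 0 <= 512 * m / (c * core_scale G ^+ 3) by rewrite divr_ge0 ?mulr_ge0// ltW.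
exists (Q + 1) => [|f Hf fm fc]; first by rewrite /Q; lra.
have fn0 : Rmass f != 0 by rewrite fm gt_eqF.
have [j [y [jy fmax a0]]] := exists_norm_max_gt0 oneHL Hf fn0.
apply: (gboundedW _ fmax); set a := `|edge_fun f j y| in a0 *.
suff : a ^+ 2 <= Q by have := sqr_ge0 (a - 1); rewrite /Q; lra.
have [large|small] := leP (4 * Rmass f) (a ^+ 2 * core_scale G); last first.
  by rewrite fm -ltr_pdivlMr// in small; rewrite /Q; lra.
have := Renergy_coercive Hf _ jy _ a0 large; rewrite fm => /(_ ml fmax) Ef.
have : c <= 512 * m / (a ^+ 2 * core_scale G ^+ 3) by rewrite /escape_loss -/a in Ef; lra.
rewrite ler_pdivlMr; last by rewrite mulr_gt0// exprn_gt0.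
rewrite mulrCA -ler_pdivlMr; last by rewrite mulr_gt0.
by rewrite /Q; lra.
Qed.

Lemma Renergy_bounded_below (m : R) : 0 < m -> m <= mu_line R ->
  exists b : R, forall f : gfun G, H1 f -> Rmass f = m -> b <= Renergy f.
Proof.
move=> m0 ml; have [A A0 bnd] := negative_energy_bounded m0 ml ltr01.
exists (- 1 - A ^+ 4 * m) => f Hf fm.
have := mulr_ge0 (exprn_ge0 4 A0) (ltW m0).
have [f1|f1] := leP (Renergy f) (- 1); last by lra.
by have := Renergy_ge Hf (bnd f Hf fm f1); rewrite fm; lra.
Qed.

End Coercivity.

(** * Solitons *)

Section HyperbolicFunctions.
Variable R : realType.
Implicit Types y : R.

Definition sech y := 2 / (expR y + expR (- y)).
Definition tanh y := (expR y - expR (- y)) / (expR y + expR (- y)).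

Lemma expRDN_gt0 y : 0 < expR y + expR (- y).
Proof. by rewrite addr_gt0 ?expR_gt0. Qed.

Lemma sech_gt0 y : 0 < sech y.
Proof. by rewrite divr_gt0// expRDN_gt0. Qed.

Lemma sech_le y : sech y <= 2 * expR (- y).
Proof.
rewrite ler_pdivrMr ?expRDN_gt0// -mulrA ler_peMr// mulrDr -expRD addNr expR0.
by rewrite lerDl -expRD expR_ge0.
Qed.

Lemma sqr_tanh y : tanh y ^+ 2 = 1 - sech y ^+ 2.
Proof.
rewrite /tanh /sech !expRN; have e0 := expR_gt0 y; field.
by rewrite gt_eqF//= gt_eqF// addr_gt0// ?mulr_gt0.
Qed.

Lemma normr_tanh_le1 y : `|tanh y| <= 1.
Proof.
rewrite -ler_sqr ?nnegrE// expr1n real_normK ?num_real// sqr_tanh.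
by rewrite lerBlDr lerDl sqr_ge0.
Qed.

Lemma sech0 : sech 0 = 1.
Proof. by rewrite /sech oppr0 expR0; field. Qed.

Lemma sechN y : sech (- y) = sech y.
Proof. by rewrite /sech opprK addrC. Qed.

Lemma tanhN y : tanh (- y) = - tanh y.
Proof. by rewrite /tanh opprK [expR (- y) + expR y]addrC -mulNr opprB. Qed.

Lemma is_derive_continuous (f : R -> R) (x d : R) : is_derive x 1 f d -> {for x, continuous f}.
Proof. by move=> [df _]; apply: differentiable_continuous; exact/derivable1_diffP. Qed.

Let is_derive_expRN y : is_derive y 1 (fun z : R => expR (- z)) (- expR (- y)).
Proof. by apply: is_derive_eq; rewrite mulrN1. Qed.

Let is_derive_expRDNV y : is_derive y 1 (fun z : R => (expR z + expR (- z))^-1)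
  (- (expR y - expR (- y)) / (expR y + expR (- y)) ^+ 2).
Proof.
have dN := is_derive_expRN y.
have dD : is_derive y 1 (fun z : R => expR z + expR (- z)) (expR y - expR (- y)).
  exact: is_derive_eq.
have c0 := expRDN_gt0 y; have dV := @is_deriveV R _ y _ 1 (lt0r_neq0 c0) dD.
by apply: is_derive_eq; rewrite /GRing.scale/=; field; rewrite gt_eqF.
Qed.

Lemma is_derive_sech y : is_derive y 1 sech (- (sech y * tanh y)).
Proof.
have dV := is_derive_expRDNV y; have c0 := expRDN_gt0 y.
rewrite /sech; apply: is_derive_eq; rewrite /GRing.scale/= /tanh.
by field; rewrite gt_eqF.
Qed.

Lemma is_derive_tanh y : is_derive y 1 tanh (sech y ^+ 2).
Proof.
have dV := is_derive_expRDNV y; have dN := is_derive_expRN y; have c0 := expRDN_gt0 y.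
rewrite /tanh; apply: is_derive_eq; rewrite /GRing.scale/= opprK.
have -> : sech y ^+ 2 = 1 - tanh y ^+ 2 by rewrite sqr_tanh; ring.
by rewrite /tanh; field; rewrite gt_eqF.
Qed.

Lemma continuous_sech : continuous sech.
Proof. by move=> y; exact: is_derive_continuous (is_derive_sech y). Qed.

Lemma cvgy_sech : sech y @[y --> +oo] --> 0.
Proof.
apply: (@squeeze_cvgr _ _ _ _ (fun=> 0) (fun y => 2 * expR (- y))).
- by near=> y; rewrite ltW ?sech_gt0// sech_le.
- exact: cvg_cst.
- by rewrite -(mulr0 2); apply: cvgM; [exact: cvg_cst|exact: cvgr_expR].
Unshelve. all: by end_near. Qed.

Definition sech_primitive y := 2 * atan (expR y).

Definition sech3_primitive y := 2^-1 * (sech y * tanh y + sech_primitive y).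

Lemma is_derive_sech_primitive y : is_derive y 1 sech_primitive (sech y).
Proof.
have d1 : is_derive y 1 (fun z : R => atan (expR z)) ((1 + expR y ^+ 2)^-1 * expR y).
  exact: is_derive1_comp.
rewrite /sech_primitive; apply: is_derive_eq; rewrite /GRing.scale/= /sech expRN.
have e0 := expR_gt0 y; field.
by rewrite gt_eqF//= gt_eqF// addr_gt0// ?mulr_gt0.
Qed.

Lemma is_derive_sech3_primitive y : is_derive y 1 sech3_primitive (sech y ^+ 3).
Proof.
have ds := is_derive_sech y; have dt := is_derive_tanh y; have dp := is_derive_sech_primitive y.
rewrite /sech3_primitive; apply: is_derive_eq; rewrite /GRing.scale/=.
have t2 := sqr_tanh y.
have -> : 2^-1 * (sech y * sech y ^+ 2 + tanh y * - (sech y * tanh y) + sech y) =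
  2^-1 * (sech y * sech y ^+ 2 - sech y * tanh y ^+ 2 + sech y) by ring.
by rewrite t2; field.
Qed.

Lemma cvgy_sech_primitive : sech_primitive y @[y --> +oo] --> pi.
Proof.
rewrite (_ : pi = 2 * (pi / 2)); last by field.
apply: cvgM; first exact: cvg_cst.
apply: (cvg_comp _ _ _ (@cvgy_atan R)).
apply/cvgryPge => M; near=> x; apply: (@le_trans _ _ (1 + x)); last exact: expR_ge1Dx.
by rewrite -lerBlDl; near: x; exact: nbhs_pinfty_ge (num_real _).
Unshelve. all: by end_near. Qed.

Lemma cvgy_sech_tanh : sech y * tanh y @[y --> +oo] --> 0.
Proof.
apply: (@squeeze_cvgr _ _ _ _ (fun y => - sech y) sech); last exact: cvgy_sech.
  near=> y; have := normr_tanh_le1 y; have := sech_gt0 y; rewrite ler_norml => s0 /andP[? ?].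
  by apply/andP; split; nra.
by rewrite -oppr0; apply: cvgN; exact: cvgy_sech.
Unshelve. all: by end_near. Qed.

Lemma cvgy_sech3_primitive : sech3_primitive y @[y --> +oo] --> pi / 2.
Proof.
rewrite (_ : pi / 2 = 2^-1 * (0 + pi)); last by rewrite add0r mulrC.
apply: cvgM; first exact: cvg_cst.
by apply: cvgD; [exact: cvgy_sech_tanh|exact: cvgy_sech_primitive].
Qed.

Lemma cvgy_sech_primitiveN : sech_primitive (- y) @[y --> +oo] --> 0.
Proof.
rewrite -(mulr0 2); apply: cvgM; first exact: cvg_cst.
rewrite -[X in _ --> X]atan0; apply: (cvg_comp _ _ (@cvgr_expR R)); exact: continuous_atan.
Qed.

Lemma cvgy_sech3_primitiveN : sech3_primitive (- y) @[y --> +oo] --> 0.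
Proof.
rewrite -(mulr0 2^-1); apply: cvgM; first exact: cvg_cst.
rewrite -[X in _ --> X]addr0; apply: cvgD; last exact: cvgy_sech_primitiveN.
have sech_tanhN : (fun y => sech (- y) * tanh (- y)) = (fun y => - (sech y * tanh y)).
  by apply/funext => y; rewrite sechN tanhN mulrN.
by rewrite sech_tanhN -oppr0; apply: cvgN; exact: cvgy_sech_tanh.
Qed.

Lemma sech_primitive0 : sech_primitive 0 = pi / 2.
Proof. by rewrite /sech_primitive expR0 atan1; field. Qed.

Lemma sech3_primitive0 : sech3_primitive 0 = pi / 4.
Proof.
by rewrite /sech3_primitive sech_primitive0 /tanh oppr0 subrr mul0r mulr0 add0r; field.
Qed.

End HyperbolicFunctions.

Section Soliton.
Variables (R : realType) (A k T : R).
Hypothesis k0 : 0 < k.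
Implicit Types (x l : R) (f F : R -> R).

Let phase x := k * x - T.

Let is_derive_phase F x (d : R) : is_derive (phase x) 1 F d ->
  is_derive x 1 (fun z => F (phase z)) (d * k).
Proof.
have dp : is_derive x 1 phase k.
  by rewrite /phase; apply: is_derive_eq; rewrite /GRing.scale/= mulr1 subr0.
by move=> dF; exact: (@is_derive1_comp _ F phase x d k dF dp).
Qed.

Let cvgy_phase : phase x @[x --> +oo] --> +oo.
Proof.
by apply/cvgryPge => M; near=> x; rewrite lerBrDr mulrC -ler_pdivrMr.
Unshelve. all: by end_near. Qed.

Let continuous_phase f : continuous f -> continuous (fun x => f (phase x)).
Proof.
move=> cf x; apply: (@continuous_comp _ _ _ phase f); last exact: cf.
by apply: cvgB; [apply: cvgM; [exact: cvg_cst|exact: cvg_id]|exact: cvg_cst].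
Qed.

Lemma ge0_integral_phase f F l : (forall y, 0 <= f y) -> continuous f ->
  (forall y : R, is_derive y 1 F (f y)) -> F y @[y --> +oo] --> l ->
  (\int[leb]_(x in `[0%R, +oo[) (f (k * x - T))%:E = (k^-1 * (l - F (- T)))%:E)%E.
Proof.
move=> f0 cf dF Fl; pose P x := k^-1 * F (phase x).
have dP x : is_derive x 1 P (f (phase x)).
  have d := is_derive_phase (dF (phase x)); rewrite /P; apply: is_derive_eq.
  by rewrite /GRing.scale/=; field; rewrite gt_eqF.
rewrite (@ge0_continuous_FTC2y R (fun x => f (phase x)) P 0 (k^-1 * l)).
- by rewrite -EFinB /P /phase mulr0 sub0r -mulrBr.
- by move=> x _; exact: f0.
- by apply: continuous_subspaceT; exact: continuous_phase.
- by apply: cvgM; [exact: cvg_cst|exact: cvg_comp cvgy_phase Fl].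
- by move=> x _; have [] := dP x.
- by apply: cvg_at_right_filter; exact: is_derive_continuous (dP 0).
- by move=> x _; rewrite derive1E; have [_ ->] := dP x.
Qed.

Lemma ge0_Rintegrable_phase f F l : (forall y, 0 <= f y) -> continuous f ->
  (forall y : R, is_derive y 1 F (f y)) -> F y @[y --> +oo] --> l ->
  Rintegrable `[0, +oo[ (fun x => f (k * x - T)).
Proof.
move=> f0 cf dF Fl; apply: ge0_Rintegrable => //.
  by apply: measurable_funS (continuous_measurable_fun (continuous_phase cf)).
by rewrite (ge0_integral_phase f0 cf dF Fl) ltry.
Qed.

Let sech3_ge0 y : 0 <= sech y ^+ 3 :> R.
Proof. by rewrite exprn_ge0// ltW// sech_gt0. Qed.

Let continuous_sech3 : continuous (fun y : R => sech y ^+ 3).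
Proof. by move=> x; apply: cvg_exprn; exact: continuous_sech. Qed.

Lemma Rintegrable_sech : Rintegrable `[0, +oo[ (fun x => sech (k * x - T)).
Proof.
apply: ge0_Rintegrable_phase (@continuous_sech R) (@is_derive_sech_primitive R)
  (@cvgy_sech_primitive R).
by move=> y; rewrite ltW ?sech_gt0.
Qed.

Lemma Rintegral_sech :
  \int[leb]_(x in `[0, +oo[) sech (k * x - T) = k^-1 * (pi - sech_primitive (- T)).
Proof.
rewrite /Rintegral (ge0_integral_phase _ (@continuous_sech R) (@is_derive_sech_primitive R)
  (@cvgy_sech_primitive R))// => y.
by rewrite ltW ?sech_gt0.
Qed.

Lemma Rintegrable_sech3 : Rintegrable `[0, +oo[ (fun x => sech (k * x - T) ^+ 3).
Proof.
exact: (ge0_Rintegrable_phase sech3_ge0 continuous_sech3 (@is_derive_sech3_primitive R)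
  (@cvgy_sech3_primitive R)).
Qed.

Lemma Rintegral_sech3 :
  \int[leb]_(x in `[0, +oo[) sech (k * x - T) ^+ 3 = k^-1 * (pi / 2 - sech3_primitive (- T)).
Proof.
by rewrite /Rintegral (ge0_integral_phase sech3_ge0 continuous_sech3
  (@is_derive_sech3_primitive R) (@cvgy_sech3_primitive R)).
Qed.

Definition soliton x := A * Num.sqrt (sech (k * x - T)).
Definition soliton_deriv x := - (k / 2) * tanh (k * x - T) * soliton x.

Lemma sqr_soliton : (fun x => soliton x ^+ 2) = (fun x => A ^+ 2 * sech (k * x - T)).
Proof. by apply/funext => x; rewrite /soliton exprMn sqr_sqrtr// ltW// sech_gt0. Qed.

Lemma soliton6 : (fun x => soliton x ^+ 6) = (fun x => A ^+ 6 * sech (k * x - T) ^+ 3).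
Proof.
by apply/funext => x; rewrite (exprM _ 2 3) (congr1 (@^~ x) sqr_soliton) exprMn -exprM.
Qed.

Lemma sqr_soliton_deriv : (fun x => soliton_deriv x ^+ 2) =
  (fun x => k ^+ 2 * A ^+ 2 / 4 * (sech (k * x - T) - sech (k * x - T) ^+ 3)).
Proof.
apply/funext => x; rewrite /soliton_deriv exprMn (congr1 (@^~ x) sqr_soliton) exprMn sqr_tanh.
by field.
Qed.

Lemma is_derive_soliton x : is_derive x 1 soliton (soliton_deriv x).
Proof.
have s0 := sech_gt0 (phase x).
have ds : is_derive (phase x) 1 (fun z : R => Num.sqrt (sech z))
   ((2 * Num.sqrt (sech (phase x)))^-1 * - (sech (phase x) * tanh (phase x))).
  apply: (@is_derive1_comp _ Num.sqrt (@sech R)); last exact: is_derive_sech.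
  exact: is_derive1_sqrt.
have dp := is_derive_phase ds.
rewrite /soliton -/(phase x); apply: is_derive_eq.
rewrite /GRing.scale/= /soliton_deriv /soliton -/(phase x).
have q0 : 0 < Num.sqrt (sech (phase x)) by rewrite sqrtr_gt0.
have q2 : Num.sqrt (sech (phase x)) ^+ 2 = sech (phase x) by rewrite sqr_sqrtr// ltW.
by rewrite -{2}q2; field; rewrite gt_eqF.
Qed.

Lemma continuous_soliton : continuous soliton.
Proof. by move=> x; exact: is_derive_continuous (is_derive_soliton x). Qed.

Lemma continuous_soliton_deriv : continuous soliton_deriv.
Proof.
move=> x; apply: cvgM; last exact: continuous_soliton.
apply: cvgM; first exact: cvg_cst.
exact: is_derive_continuous (is_derive_phase (is_derive_tanh (phase x))).
Qed.

Lemma Rintegral_soliton2 :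
  \int[leb]_(x in `[0, +oo[) soliton x ^+ 2 = A ^+ 2 * (k^-1 * (pi - sech_primitive (- T))).
Proof. by rewrite sqr_soliton RintegralZl ?Rintegral_sech//; exact: Rintegrable_sech. Qed.

Lemma Rintegral_soliton6 :
  \int[leb]_(x in `[0, +oo[) soliton x ^+ 6 = A ^+ 6 * (k^-1 * (pi / 2 - sech3_primitive (- T))).
Proof. by rewrite soliton6 RintegralZl ?Rintegral_sech3//; exact: Rintegrable_sech3. Qed.

Lemma Rintegral_soliton_deriv2 : \int[leb]_(x in `[0, +oo[) soliton_deriv x ^+ 2 =
  k * A ^+ 2 / 4 * ((pi - sech_primitive (- T)) - (pi / 2 - sech3_primitive (- T))).
Proof.
have si := Rintegrable_sech; have s3i := Rintegrable_sech3.
rewrite sqr_soliton_deriv RintegralZl//; last exact: RintegrableB.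
by rewrite RintegralB// Rintegral_sech Rintegral_sech3; field; rewrite gt_eqF.
Qed.

Lemma H1on_soliton : H1on `[0, +oo[ soliton soliton_deriv.
Proof.
have si := Rintegrable_sech; have s3i := Rintegrable_sech3.
split; [split| |].
- by apply: measurable_funS (continuous_measurable_fun continuous_soliton_deriv).
- by rewrite sqr_soliton_deriv; apply: RintegrableZl => //; exact: RintegrableB.
- by rewrite sqr_soliton; exact: RintegrableZl.
move=> x; rewrite /= in_itv/= andbT le_eqVlt => /predU1P[<-|x0].
  by rewrite Rintegral_itv1 addr0.
rewrite /Rintegral (@continuous_FTC2 _ soliton_deriv soliton 0 x x0).
- by rewrite -EFinB/= addrC subrK.
- by apply: continuous_subspaceT; exact: continuous_soliton_deriv.
- split.
  + by move=> y _; have [] := is_derive_soliton y.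
  + by apply: cvg_at_right_filter; exact: continuous_soliton.
  + by apply: cvg_at_left_filter; exact: continuous_soliton.
- by move=> y _; rewrite derive1E; have [_ ->] := is_derive_soliton y.
Qed.

End Soliton.

(** * Competitors *)

Section Competitors.
Variables (R : realType) (G : metric_graph R).
Hypothesis oneHL : #|HL G| = 1%N.
Hypothesis noterm : forall v : V G, ~ terminal_point v.
Implicit Types (A k T m : R).

Definition core_length : R := \sum_e blen (m := G) e.

Lemma core_length_gt0 : 0 < core_length.
Proof.
have [h] := exists_HL oneHL; have [e _] := exists_edge_at_halfline oneHL (@noterm (hsrc h)).
apply: lt_le_trans (blen_gt0 e) (ler_sum_term (t := @blen R G) _ e) => e'.
exact: ltW (blen_gt0 e').
Qed.

Definition competitor A k T : gfun G := GFun
  (fun _ _ => A * Num.sqrt (sech T)) (fun _ _ => 0)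
  (fun _ => soliton A k T) (fun _ => soliton_deriv A k T).

Lemma sum_HL (F : HL G -> R) c : (forall h, F h = c) -> \sum_h F h = c.
Proof. by move=> Fc; rewrite (eq_bigr _ (fun h _ => Fc h)) sumr_const oneHL. Qed.

Section Functionals.
Variables A k T : R.
Hypothesis k0 : 0 < k.

Lemma H1_competitor : H1 (competitor A k T).
Proof.
apply/H1P; split.
  exists (fun _ => A * Num.sqrt (sech T)); split=> //= h.
  by rewrite /soliton mulr0 sub0r sechN.
case=> [e|h] /=; last exact: H1on_soliton.
apply/(H1_segE _ _ (blen_gt0 e)); split.
- exact: measurable_cst.
- by rewrite expr0n/= integral0 ltry.
- by move=> x _; rewrite /Rintegral integral0 addr0.
Qed.

Let plateau_exprn n (e : BE G) :
  \int[leb]_(x in edge_dom (inl e)) edge_fun (competitor A k T) (inl e) x ^+ n =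
  (A * Num.sqrt (sech T)) ^+ n * blen e.
Proof. by rewrite /= Rintegral_itv_cst ?subr0// ltW// blen_gt0. Qed.

Lemma Rmass_competitor : Rmass (competitor A k T) =
  A ^+ 2 * (sech T * core_length + k^-1 * (pi - sech_primitive (- T))).
Proof.
rewrite /Rmass big_sumType/= (eq_bigr _ (fun e _ => plateau_exprn 2 e)) -mulr_sumr -/core_length.
rewrite (sum_HL (fun=> Rintegral_soliton2 A T k0)) exprMn sqr_sqrtr ?ltW ?sech_gt0//.
by ring.
Qed.

Lemma Rp6_competitor : Rp6 (competitor A k T) =
  A ^+ 6 * (sech T ^+ 3 * core_length + k^-1 * (pi / 2 - sech3_primitive (- T))).
Proof.
rewrite /Rp6 big_sumType/= (eq_bigr _ (fun e _ => plateau_exprn 6 e)) -mulr_sumr -/core_length.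
rewrite (sum_HL (fun=> Rintegral_soliton6 A T k0)) exprMn (exprM (Num.sqrt _) 2 3).
by rewrite sqr_sqrtr ?ltW ?sech_gt0//; ring.
Qed.

Lemma Rdnorm_competitor : Rdnorm (competitor A k T) =
  k * A ^+ 2 / 4 * ((pi - sech_primitive (- T)) - (pi / 2 - sech3_primitive (- T))).
Proof.
rewrite /Rdnorm big_sumType/= big1 ?add0r; last first.
  by move=> e _; rewrite /= expr0n/= /Rintegral integral0.
by rewrite (sum_HL (fun=> Rintegral_soliton_deriv2 A T k0)).
Qed.

Lemma Rmass_competitor0 : T = 0 ->
  Rmass (competitor A k T) = A ^+ 2 * (core_length + pi / (2 * k)).
Proof.
by move=> T0; rewrite Rmass_competitor T0 oppr0 sech0 sech_primitive0; field; rewrite gt_eqF.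
Qed.

Lemma Rp6_competitor0 : T = 0 ->
  Rp6 (competitor A k T) = A ^+ 6 * (core_length + pi / (4 * k)).
Proof.
move=> T0; rewrite Rp6_competitor T0 oppr0 sech0 sech3_primitive0 expr1n.
by field; rewrite gt_eqF.
Qed.

Lemma Rdnorm_competitor0 : T = 0 -> Rdnorm (competitor A k T) = A ^+ 2 * (k * pi / 16).
Proof.
by move=> T0; rewrite Rdnorm_competitor T0 oppr0 sech_primitive0 sech3_primitive0; field.
Qed.

End Functionals.

Lemma exists_negative_energy m : mu_halfline R < m ->
  exists f : gfun G, [/\ H1 f, Rmass f = m & Renergy f < 0].
Proof.
move=> hm; have L0 := core_length_gt0.
have s3 : 0 < Num.sqrt 3 :> R by rewrite sqrtr_gt0.
have s32 : Num.sqrt 3 ^+ 2 = 3 :> R by rewrite sqr_sqrtr.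
pose q := (m - mu_halfline R) / core_length.
have q0 : 0 < q by rewrite divr_gt0// subr_gt0.
have A2 : Num.sqrt q ^+ 2 = q by rewrite sqr_sqrtr// ltW.
pose k := 2 * q / Num.sqrt 3; have k0 : 0 < k by rewrite divr_gt0// mulr_gt0.
exists (competitor (Num.sqrt q) k 0); split; first exact: H1_competitor.
  rewrite Rmass_competitor0// A2.
  have -> : q * (core_length + pi / (2 * k)) = q * core_length + pi * Num.sqrt 3 / 4.
    by rewrite /k; field; rewrite !gt_eqF.
  by rewrite /q divfK ?gt_eqF// /mu_halfline subrK.
rewrite RenergyE; last exact: H1_competitor.
rewrite Rdnorm_competitor0// Rp6_competitor0// (exprM _ 2 3) A2.
have -> : 2^-1 * (q * (k * pi / 16)) - 6^-1 * (q ^+ 3 * (core_length + pi / (4 * k))) =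
   - (q ^+ 3 * core_length / 6) + q ^+ 2 * pi / (48 * Num.sqrt 3) * (3 - Num.sqrt 3 ^+ 2).
  by rewrite /k; field; rewrite !gt_eqF.
by rewrite s32 subrr mulr0 addr0 oppr_lt0 divr_gt0// mulr_gt0// exprn_gt0.
Qed.

Lemma exists_small_energy m e : 0 < m -> 0 < e ->
  exists f : gfun G, [/\ H1 f, Rmass f = m & Renergy f <= e].
Proof.
move=> m0 e0; have L0 := core_length_gt0; have p0 := pi_gt0 R.
pose k := Num.min 1 (16 * e / m).
have k0 : 0 < k by rewrite lt_min ltr01 divr_gt0// mulr_gt0.
have k1 : k <= 1 by rewrite ge_min lexx.
have ke : k * m <= 16 * e by rewrite -ler_pdivlMr// ge_min lexx orbT.
have unit_mass0 : 0 < core_length + pi / (2 * k) by rewrite addr_gt0// divr_gt0// mulr_gt0.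
pose q := m / (core_length + pi / (2 * k)).
have q0 : 0 < q by rewrite divr_gt0.
have A2 : Num.sqrt q ^+ 2 = q by rewrite sqr_sqrtr// ltW.
have H1c := H1_competitor (Num.sqrt q) 0 k0.
exists (competitor (Num.sqrt q) k 0); split=> //.
  by rewrite Rmass_competitor0// A2 /q divfK// gt_eqF.
have := Rp6_ge0 (competitor (Num.sqrt q) k 0); rewrite RenergyE// Rdnorm_competitor0// A2.
have qpi : q * pi <= 2 * k * m.
  rewrite /q mulrAC ler_pdivrMr//.
  have -> : 2 * k * m * (core_length + pi / (2 * k)) = 2 * k * m * core_length + m * pi.
    by field; rewrite gt_eqF.
  by rewrite lerDr !mulr_ge0 ?(ltW m0) ?(ltW L0) ?(ltW k0).
have : k * (q * pi) <= k * (2 * k * m) by rewrite ler_pM2l.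
have : k * (k * m) <= k * m by rewrite ler_piMl// mulr_ge0// ltW.
lra.
Qed.

Let cvgy_gap (l : R) (F : R -> R) : F (- T) @[T --> +oo] --> 0 ->
  (l - F (- T)) @[T --> +oo] --> l.
Proof. by move=> F0; rewrite -[X in _ --> X]subr0; apply: cvgB => //; exact: cvg_cst. Qed.

Lemma cvgy_Rmass_competitor A k : 0 < k ->
  Rmass (competitor A k T) @[T --> +oo] --> A ^+ 2 * (k^-1 * pi).
Proof.
move=> k0; rewrite (eq_cvg _ _ (fun T => Rmass_competitor A T k0)).
apply: cvgM; first exact: cvg_cst.
rewrite -[X in _ --> X]add0r -[X in _ --> X + _](mul0r core_length); apply: cvgD.
  by apply: cvgM; [exact: cvgy_sech|exact: cvg_cst].
by apply: cvgM; [exact: cvg_cst|apply: cvgy_gap; exact: cvgy_sech_primitiveN].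
Qed.

Lemma cvgy_Rp6_competitor A k : 0 < k ->
  Rp6 (competitor A k T) @[T --> +oo] --> A ^+ 6 * (k^-1 * (pi / 2)).
Proof.
move=> k0; rewrite (eq_cvg _ _ (fun T => Rp6_competitor A T k0)).
apply: cvgM; first exact: cvg_cst.
rewrite -[X in _ --> X]add0r -[X in _ --> X + _](mul0r core_length); apply: cvgD.
  apply: cvgM; last exact: cvg_cst.
  rewrite -[X in _ --> X](_ : 0 ^+ 3 = 0); last by rewrite expr0n.
  by apply: cvg_exprn; exact: cvgy_sech.
by apply: cvgM; [exact: cvg_cst|apply: cvgy_gap; exact: cvgy_sech3_primitiveN].
Qed.

Lemma cvgy_Rdnorm_competitor A k : 0 < k ->
  Rdnorm (competitor A k T) @[T --> +oo] --> k * A ^+ 2 / 4 * (pi / 2).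
Proof.
move=> k0; rewrite (eq_cvg _ _ (fun T => Rdnorm_competitor A T k0)).
apply: cvgM; first exact: cvg_cst.
rewrite [X in _ --> X](_ : pi / 2 = pi - pi / 2); last by field.
by apply: cvgB; apply: cvgy_gap; [exact: cvgy_sech_primitiveN|exact: cvgy_sech3_primitiveN].
Qed.

(* As T grows, the competitor tends to a full soliton moved to infinity. *)
Lemma cvgy_Renergy_rescaled_competitor A k m : 0 < m -> A != 0 -> 0 < k ->
  let f T := competitor A k T in let w := m / (A ^+ 2 * (k^-1 * pi)) in
  Renergy (gscale (Num.sqrt (m / Rmass (f T))) (f T)) @[T --> +oo] -->
  2^-1 * w * (k * A ^+ 2 / 4 * (pi / 2)) - 6^-1 * w ^+ 3 * (A ^+ 6 * (k^-1 * (pi / 2))).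
Proof.
move=> m0 A0 k0 f w.
have mass0 : 0 < A ^+ 2 * (k^-1 * pi).
  by rewrite mulr_gt0 ?exprn_even_gt0// mulr_gt0 ?invr_gt0 ?pi_gt0.
have cw : m / Rmass (f T) @[T --> +oo] --> w.
  apply: cvgM; first exact: cvg_cst.
  by apply: cvgV; [rewrite gt_eqF|exact: cvgy_Rmass_competitor].
have E T : Renergy (gscale (Num.sqrt (m / Rmass (f T))) (f T)) =
    2^-1 * (m / Rmass (f T)) * Rdnorm (f T) - 6^-1 * (m / Rmass (f T)) ^+ 3 * Rp6 (f T).
  rewrite Renergy_gscale; last exact: H1_competitor.
  by rewrite (exprM _ 2 3) sqr_sqrtr// divr_ge0 ?(ltW m0)// Rmass_ge0.
rewrite (eq_cvg _ _ E); apply: cvgB.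
  apply: cvgM; last exact: cvgy_Rdnorm_competitor.
  by apply: cvgM; [exact: cvg_cst|exact: cw].
apply: cvgM; last exact: cvgy_Rp6_competitor.
apply: cvgM; first exact: cvg_cst.
exact: cvg_exprn cw.
Qed.

Lemma exists_energy_lt m M : mu_line R < m ->
  exists f : gfun G, [/\ H1 f, Rmass f = m & Renergy f < M].
Proof.
move=> hm; have p0 := pi_gt0 R.
have s3 : 0 < Num.sqrt 3 :> R by rewrite sqrtr_gt0.
have s32 : Num.sqrt 3 ^+ 2 = 3 :> R by rewrite sqr_sqrtr.
have l0 : 0 < mu_line R by rewrite divr_gt0// mulr_gt0.
have m0 : 0 < m := lt_trans l0 hm.
pose w := m / mu_line R; have w1 : 1 < w by rewrite ltr_pdivlMr// mul1r.
pose c := Num.sqrt 3 * pi / 24 * (w ^+ 3 - w).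
have c0 : 0 < c.
  rewrite mulr_gt0 ?divr_gt0 ?mulr_gt0// subr_gt0 -[ltLHS]expr1.
  by rewrite ltr_eXn2l.
pose A := 1 + `|M| / c.
have A1 : 1 <= A by rewrite lerDl divr_ge0// ltW.
have A0 : 0 < A by lra.
pose k := 2 * A ^+ 2 / Num.sqrt 3.
have k0 : 0 < k by rewrite divr_gt0// mulr_gt0// exprn_gt0.
have massE : A ^+ 2 * (k^-1 * pi) = mu_line R.
  by rewrite /mu_line /k; field; rewrite !gt_eqF.
have := cvgy_Renergy_rescaled_competitor m0 (lt0r_neq0 A0) k0; rewrite /= massE -/w.
have -> : 2^-1 * w * (k * A ^+ 2 / 4 * (pi / 2)) - 6^-1 * w ^+ 3 * (A ^+ 6 * (k^-1 * (pi / 2)))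
    = - (c * A ^+ 4).
  by rewrite /c /k; field: s32; rewrite !gt_eqF.
move=> /cvgr_lt/(_ M) lim_lt.
have cM : - (c * A ^+ 4) < M.
  have : c * A <= c * A ^+ 4 by rewrite ler_pM2l// ler_eXnr.
  have : c * A = c + `|M| by rewrite /A; field; rewrite gt_eqF.
  by have := ler_norm (- M); rewrite normrN; lra.
have := @cvgy_Rmass_competitor A k k0; rewrite massE => /cvgr_gt/(_ 0 l0) mass_gt0.
have [T [/= T1 T2]] := filter_ex (filterI (lim_lt cM) mass_gt0).
exists (gscale (Num.sqrt (m / Rmass (competitor A k T))) (competitor A k T)); split=> //.
  by apply: H1_gscale; exact: H1_competitor.
rewrite Rmass_gscale; last exact: H1_competitor.
by rewrite sqr_sqrtr; [rewrite divfK// gt_eqF|rewrite divr_ge0 ?(ltW m0)// Rmass_ge0].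
Qed.

End Competitors.

(** * Limits in L^2 *)

Section L2Completeness.
Variable R : realType.
Implicit Types (D N : set R) (v g : R -> R) (w h : nat -> R -> R) (c K : R).

Lemma Rintegral_fatou D N w v c : measurable D -> measurable N -> leb N = 0%E ->
  (forall k, Rintegrable D (w k)) -> (forall k x, D x -> 0 <= w k x) ->
  (forall k, \int[leb]_(x in D) w k x <= c) ->
  measurable_fun D v -> (forall x, D x -> 0 <= v x) ->
  (forall x, D x -> ~ N x -> w k x @[k --> \oo] --> v x) ->
  Rintegrable D v /\ \int[leb]_(x in D) v x <= c.
Proof.
move=> mD mN N0 wi w0 wc mv v0 wv.
have mDN : measurable (D `\` N) by exact: measurableD.
have subDN : D `\` N `<=` D by exact: subDsetl.
suff vc : (\int[leb]_(x in D) (v x)%:E <= c%:E)%E.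
  have vi : Rintegrable D v by apply: ge0_Rintegrable => //; apply: le_lt_trans vc _; exact: ltry.
  by split=> //; rewrite -lee_fin -EFin_Rintegral.
rewrite (@ge0_negligible_integral _ (measurableTypeR R) _ leb D N)//; last first.
  exact/measurable_EFinP.
have -> : (\int[leb]_(x in D `\` N) (v x)%:E =
    \int[leb]_(x in D `\` N) limn_einf (fun k => (w k x)%:E))%E.
  apply: eq_integral => x; rewrite inE => -[Dx Nx].
  rewrite (@cvg_limn_einf_sup _ _ (v x)%:E)//.
  by apply/fine_cvgP; split; [near=> k|exact: wv].
apply: le_trans (fatou _ _ _ _) _ => //.
- move=> k; apply/measurable_EFinP; apply: measurable_funS (Rintegrable_measurable (wi k)) => //.
- by move=> k x [Dx _]; rewrite lee_fin w0.
rewrite limn_einf_lim; apply: lime_le; first exact: is_cvg_einfs.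
near=> n; apply: (@le_trans _ _ (\int[leb]_(x in D `\` N) (w n x)%:E)%E).
  by apply: ereal_inf_lbound; exists n => /=.
apply: (@le_trans _ _ (\int[leb]_(x in D) (w n x)%:E)%E); last by rewrite EFin_Rintegral// lee_fin.
apply: ge0_subset_integral => //; last by move=> x Dx; rewrite lee_fin w0.
by apply/measurable_EFinP; exact: Rintegrable_measurable (wi n).
Unshelve. all: by end_near. Qed.

(* AM-GM makes the increments summable: [|d_n| <= 2^n d_n^2 + 2^-n]. *)
Lemma cvgn_weighted_sqr_increments (u : R^nat) (S : R) :
  (forall n, \sum_(0 <= i < n) (2 ^+ i * (u i.+1 - u i) ^+ 2) <= S) -> cvgn u.
Proof.
move=> HS; have -> : u = (fun n => u 0%N + series (telescope u) n).
  by apply/funext => n; rewrite -eq_sum_telescope.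
apply: is_cvgD; first exact: is_cvg_cst.
apply: normed_cvg; apply: nondecreasing_is_cvgn.
  by apply: nondecreasing_series => n _ _; exact: normr_ge0.
exists (S + 2) => _ [n _ <-]; rewrite /series/=.
apply: (@le_trans _ _ (\sum_(0 <= i < n) (2 ^+ i * (u i.+1 - u i) ^+ 2) +
   \sum_(0 <= i < n) (2^-1) ^+ i)).
  rewrite -big_split/=; apply: ler_sum => i _; rewrite /telescope/= exprVn.
  by apply: ler_norm_weighted_sqr; rewrite exprn_gt0.
rewrite lerD//.
have -> : \sum_(0 <= i < n) 2^-1 ^+ i = series (geometric 1 2^-1) n :> R.
  by rewrite /series/=; apply: eq_bigr => i _; rewrite mul1r.
rewrite (geometric_seriesE 1)/=; last by rewrite lt_eqF// invf_lt1//; lra.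
have -> : 1 - 2^-1 = 2^-1 :> R by field.
by rewrite mul1r invrK; have : 0 <= 2^-1 ^+ n :> R; [rewrite exprn_ge0// invr_ge0|lra].
Qed.

Lemma L2_geometric_ae_cvg D h K : measurable D -> (forall n, sqr_integrable D (h n)) ->
  (forall n, \int[leb]_(x in D) (h n x - h n.+1 x) ^+ 2 <= K / 4 ^+ n) ->
  exists N, [/\ measurable N, leb N = 0%E & forall x, D x -> ~ N x -> cvgn (h^~ x)].
Proof.
move=> mD h2 hK.
pose f n x := (2 ^+ n * (h n.+1 x - h n x) ^+ 2)%:E.
have f0 n x : (0 <= f n x)%E by rewrite lee_fin mulr_ge0 ?sqr_ge0// exprn_ge0.
have fi n : Rintegrable D (fun x => 2 ^+ n * (h n.+1 x - h n x) ^+ 2).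
  by apply: RintegrableZl => //; have [] := sqr_integrableB mD (h2 n.+1) (h2 n).
have mf n : measurable_fun D (f n).
  by apply/measurable_EFinP; exact: Rintegrable_measurable (fi n).
pose F x := (\sum_(0 <= n <oo) f n x)%E.
have mF : measurable_fun D F.
  by apply: (@ge0_emeasurable_sum _ _ R D f xpredT) => // k x Dx _; exact: f0.
have F0 x : (0 <= F x)%E by apply: nneseries_ge0 => n _ _; exact: f0.
have iF : leb.-integrable D F.
  apply/integrableP; split => //.
  have -> : (\int[leb]_(x in D) `|F x| = \int[leb]_(x in D) F x)%E.
    by apply: eq_integral => x _; rewrite gee0_abs.
  rewrite /F integral_nneseries//.
  apply: (@le_lt_trans _ _ (\sum_(0 <= n <oo) (2 * K / (2 ^ (n + 1))%:R)%:E)%E).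
    apply: lee_nneseries => n _; first by move=> _; exact: integral_ge0.
    rewrite (EFin_Rintegral _ (fi n))// lee_fin RintegralZl//; last first.
      by have [] := sqr_integrableB mD (h2 n.+1) (h2 n).
    have -> : \int[leb]_(x in D) (h n.+1 x - h n x) ^+ 2 =
        \int[leb]_(x in D) (h n x - h n.+1 x) ^+ 2.
      by apply: eq_Rintegral => x _; rewrite -sqrrN opprB.
    apply: le_trans (ler_wpM2l _ (hK n)) _; first by rewrite exprn_ge0.
    rewrite addn1 natrX exprS (_ : 4 = 2 * 2)%R; last by ring.
    by rewrite exprMn le_eqVlt; apply/orP; left; apply/eqP; field; rewrite expf_neq0.
  by have /cvg_lim -> // := @cvg_geometric_eseries_half R (2 * K) 0; exact: ltry.
have mD' : @measurable _ (measurableTypeR R) D by [].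
have [N [mN N0 DN]] := integrable_ae mD' iF; exists N; split=> // x Dx Nx.
have Ff : F x \is a fin_num.
  by apply: contrapT => nF; apply: Nx; apply: DN => /(_ Dx).
apply: (@cvgn_weighted_sqr_increments _ (fine (F x))) => n.
rewrite -lee_fin fineK// -sumEFin.
by apply: nneseries_lim_ge => k _ _; exact: f0.
Qed.

Lemma exists_measurable_limit D N h : measurable D -> measurable N ->
  (forall n, measurable_fun D (h n)) -> (forall x, D x -> ~ N x -> cvgn (h^~ x)) ->
  exists2 g : R -> R, measurable_fun D g & forall x, D x -> ~ N x -> h n x @[n --> \oo] --> g x.
Proof.
move=> mD mN mh cvgh; pose hN n x := h n x * (\1_(~` N) x).
have hNE n x : ~ N x -> hN n x = h n x by move=> Nx; rewrite /hN indicE mem_set// mulr1.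
have mhN n : measurable_fun D (hN n).
  by apply: measurable_funM => //; apply: measurable_indic; exact: measurableC.
have cvgN x : D x -> hN n x @[n --> \oo] --> limn (hN^~ x).
  move=> Dx; have [Nx|Nx] := pselect (N x).
    rewrite (_ : hN^~ x = (fun=> 0)); first exact: is_cvg_cst.
    by apply/funext => n; rewrite /hN indicE memNset ?mulr0.
  by rewrite (_ : hN^~ x = h^~ x); [exact: cvgh|apply/funext => n; rewrite hNE].
exists (fun x => limn (hN^~ x)); first exact: measurable_fun_cvg cvgN.
by move=> x Dx Nx; have := cvgN x Dx; rewrite (eq_cvg _ _ (fun n => hNE n x Nx)).
Qed.

Lemma L2_geometric_cauchy_cvg D h K : measurable D -> (forall n, sqr_integrable D (h n)) ->
  (forall n m, (n <= m)%N -> \int[leb]_(x in D) (h n x - h m x) ^+ 2 <= K / 4 ^+ n) ->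
  exists2 g : R -> R, sqr_integrable D g &
    forall n, \int[leb]_(x in D) (h n x - g x) ^+ 2 <= K / 4 ^+ n.
Proof.
move=> mD h2 hK.
have [N [mN N0 cvgh]] := L2_geometric_ae_cvg mD h2 (fun n => hK n n.+1 (leqnSn n)).
have [g mg hg] := exists_measurable_limit mD mN (fun n => (h2 n).1) cvgh.
have close n : Rintegrable D (fun x => (h n x - g x) ^+ 2) /\
    \int[leb]_(x in D) (h n x - g x) ^+ 2 <= K / 4 ^+ n.
  apply: (@Rintegral_fatou D N (fun k x => (h n x - h (k + n)%N x) ^+ 2)) => //.
  - by move=> k; have [] := sqr_integrableB mD (h2 n) (h2 (k + n)%N).
  - by move=> k x _; exact: sqr_ge0.
  - by move=> k; rewrite hK// leq_addl.
  - by apply: measurable_funX; apply: measurable_funB => //; have [] := h2 n.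
  - by move=> x _; exact: sqr_ge0.
  move=> x Dx Nx.
  have shift : h (k + n)%N x @[k --> \oo] --> g x by have := hg x Dx Nx; rewrite -(cvg_shiftn n).
  have diff : (h n x - h (k + n)%N x) @[k --> \oo] --> h n x - g x.
    by apply: cvgB => //; exact: cvg_cst.
  exact: cvg_exprn diff.
exists g => [|n]; last by have [] := close n.
have diff0 : sqr_integrable D (fun x => h 0%N x - g x).
  by split; [apply: measurable_funB => //; have [] := h2 0%N|have [] := close 0%N].
rewrite (_ : g = (fun x => h 0%N x - (h 0%N x - g x))); first exact: sqr_integrableB.
by apply/funext => x; rewrite subKr.
Qed.

End L2Completeness.

Section NearMinimizers.
Variables (R : realType) (T : Type) (S : nat -> set T) (cost : T -> R) (C : R).
Hypothesis S_mono : forall n m, (n <= m)%N -> S m `<=` S n.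
Hypothesis S_neq0 : forall n, S n !=set0.
Hypothesis cost_bounds : forall n x, S n x -> 0 <= cost x <= C.

Lemma exists_near_minimizers (eps : nat -> R) : (forall j, 0 < eps j) ->
  exists (c : R) (x : nat -> T) (M : nat -> nat), forall j,
    [/\ (j <= M j)%N, S (M j) (x j), cost (x j) <= c + eps j &
      forall y, S (M j) y -> c - eps j <= cost y].
Proof.
move=> eps0; pose I n := [set cost x | x in S n].
have Ilb n : has_lbound (I n) by exists 0 => _ [x /cost_bounds/andP[x0 _] <-].
have Iinf n : has_inf (I n) by split=> //; have [x Sx] := S_neq0 n; exists (cost x), x.
have inf_le n x : S n x -> inf (I n) <= cost x by move=> Sx; apply: ge_inf => //; exists x.
have inf_mono n m : (n <= m)%N -> inf (I n) <= inf (I m).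
  move=> nm; apply: lb_le_inf; first by case: (Iinf m).
  by move=> _ [x Sx <-]; apply: inf_le; exact: S_mono nm _ Sx.
have sup_infs : has_sup (range (inf \o I)).
  split; first by exists (inf (I 0%N)), 0%N.
  exists C => _ [n _ <-]; have [x Sx] := S_neq0 n.
  by apply: le_trans (inf_le _ _ Sx) _; have /andP[] := cost_bounds Sx.
pose c := sup (range (inf \o I)).
have near_min j : exists xM : T * nat, [/\ (j <= xM.2)%N, S xM.2 xM.1,
    cost xM.1 <= c + eps j & forall y, S xM.2 y -> c - eps j <= cost y].
  have [_ [m _ <-] cm] := sup_adherent (eps0 j) sup_infs.
  have [_ [x Sx <-] xc] := inf_adherent (eps0 j) (Iinf (maxn m j)).
  exists (x, maxn m j); split=> //=; first exact: leq_maxr.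
    apply: le_trans (ltW xc) _; rewrite lerD2r; apply: ub_le_sup; first by case: sup_infs.
    by exists (maxn m j).
  move=> y Sy; apply: le_trans (ltW cm) _; apply: le_trans (inf_le _ _ Sy).
  by apply: inf_mono; exact: leq_maxl.
have [xM xMP] := choice near_min.
by exists c, (fst \o xM), (snd \o xM).
Qed.

End NearMinimizers.

Section L2Convexity.
Variable R : realType.
Implicit Types (D E : set R) (f g h : R -> R) (c d C K : R).

Lemma sqr_integrable_mid D f g : measurable D -> sqr_integrable D f -> sqr_integrable D g ->
  sqr_integrable D (fun x => (f x + g x) / 2).
Proof.
move=> mD fi gi; rewrite (_ : (fun x => _) = (fun x => 2^-1 * (f x + g x))).
  by apply: sqr_integrableZl => //; exact: sqr_integrableD.
by apply/funext => x; rewrite mulrC.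
Qed.

Lemma Rintegral_parallelogram D f g : measurable D -> sqr_integrable D f -> sqr_integrable D g ->
  \int[leb]_(x in D) (f x - g x) ^+ 2 + 4 * \int[leb]_(x in D) ((f x + g x) / 2) ^+ 2 =
  2 * \int[leb]_(x in D) f x ^+ 2 + 2 * \int[leb]_(x in D) g x ^+ 2.
Proof.
move=> mD fi gi; have [_ f2] := fi; have [_ g2] := gi.
have [_ mid2] := sqr_integrable_mid mD fi gi; have [_ diff2] := sqr_integrableB mD fi gi.
rewrite -!RintegralZl// -!RintegralD//; try exact: RintegrableZl.
by apply: eq_Rintegral => x _; field.
Qed.

Lemma Rintegral_sqr_mid_le D f g c : measurable D -> sqr_integrable D f -> sqr_integrable D g ->
  \int[leb]_(x in D) f x ^+ 2 <= c -> \int[leb]_(x in D) g x ^+ 2 <= c ->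
  \int[leb]_(x in D) ((f x + g x) / 2) ^+ 2 <= c.
Proof.
move=> mD fi gi fc gc; have := Rintegral_parallelogram mD fi gi.
by have := Rintegral_sqr_ge0 D (fun x => f x - g x); lra.
Qed.

(* Near-minimisers of the norm over a decreasing sequence of midpoint-convex sets form a
   Cauchy sequence by the parallelogram identity; this replaces weak compactness. *)
Lemma L2_nested_convex_limit D (S : nat -> set (R -> R)) C : measurable D ->
  (forall n h, S n h -> sqr_integrable D h) ->
  (forall n h, S n h -> \int[leb]_(x in D) h x ^+ 2 <= C) ->
  (forall n m, (n <= m)%N -> S m `<=` S n) ->
  (forall n f g, S n f -> S n g -> S n (fun x => (f x + g x) / 2)) ->
  (forall n, S n !=set0) ->
  exists (g : R -> R) (h : nat -> R -> R), [/\ forall n, S n (h n), sqr_integrable D g &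
    forall n, \int[leb]_(x in D) (h n x - g x) ^+ 2 <= 8 / 4 ^+ n].
Proof.
move=> mD S2 SC Snd Smid Sne.
have eps0 j : 0 < (4 ^+ j)^-1 :> R by rewrite invr_gt0 exprn_gt0.
have bounds n h : S n h -> 0 <= \int[leb]_(x in D) h x ^+ 2 <= C.
  by move=> Sh; rewrite Rintegral_sqr_ge0 (SC n).
have [c [h [M hM]]] := exists_near_minimizers Snd Sne bounds eps0.
have Sh j : S j (h j) by have [jM SMh _ _] := hM j; exact: Snd jM _ SMh.
have [g g2 hg] : exists2 g, sqr_integrable D g &
    forall n, \int[leb]_(x in D) (h n x - g x) ^+ 2 <= 8 / 4 ^+ n; last by exists g, h.
apply: L2_geometric_cauchy_cvg => // [n|n m nm]; first exact: S2 (Sh n).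
have [_ Sn hn cn] := hM n; have [_ Sm hm cm] := hM m.
have eps_le : (4 ^+ m)^-1 <= (4 ^+ n)^-1 :> R.
  by rewrite ler_invXn2l ?ler1n.
have mid_ge : c - (4 ^+ n)^-1 <= \int[leb]_(x in D) ((h n x + h m x) / 2) ^+ 2.
  have [nM|mM] := leqP (M n) (M m); first exact/cn/Smid/(Snd _ _ nM).
  have := cm _ (Smid _ _ _ (Snd _ _ (ltnW mM) _ Sn) Sm); lra.
have := Rintegral_parallelogram mD (S2 _ _ (Sh n)) (S2 _ _ (Sh m)).
by rewrite mulrC; lra.
Qed.

Lemma Rintegral_sqr_le_near D E f g d : measurable D -> measurable E -> E `<=` D -> 0 < d ->
  sqr_integrable D f -> sqr_integrable D g ->
  \int[leb]_(x in E) g x ^+ 2 <=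
  (1 + d) * \int[leb]_(x in E) f x ^+ 2 + (1 + d^-1) * \int[leb]_(x in D) (f x - g x) ^+ 2.
Proof.
move=> mD mE ED d0 fi gi; have [_ diffD] := sqr_integrableB mD fi gi.
have [fE gE] := (sqr_integrableS mD mE ED fi, sqr_integrableS mD mE ED gi).
have [_ diffE] := sqr_integrableB mE fE gE; case: fE gE => _ f2 [_ g2].
have diff_le := subset_Rintegral_sqr mD mE ED diffD.
have dd : 0 <= 1 + d^-1 by rewrite addr_ge0// invr_ge0 ltW.
apply: le_trans (_ : _ <= (1 + d) * \int[leb]_(x in E) f x ^+ 2 +
  (1 + d^-1) * \int[leb]_(x in E) (f x - g x) ^+ 2) _; last by rewrite lerD2l ler_wpM2l.
rewrite -!RintegralZl// -RintegralD//; try exact: RintegrableZl.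
apply: le_Rintegral => //; first by apply: RintegrableD => //; exact: RintegrableZl.
move=> x _; rewrite -subr_ge0.
have -> : (1 + d) * f x ^+ 2 + (1 + d^-1) * (f x - g x) ^+ 2 - g x ^+ 2 =
  d^-1 * ((1 + d) * f x - g x) ^+ 2 by field; rewrite gt_eqF.
by rewrite mulr_ge0 ?sqr_ge0// invr_ge0 ltW.
Qed.

Lemma Rintegral_sqr_limit_le D E g (h : nat -> R -> R) K c k : measurable D -> measurable E ->
  E `<=` D -> sqr_integrable D g -> (forall n, sqr_integrable D (h n)) ->
  (forall n, \int[leb]_(x in D) (h n x - g x) ^+ 2 <= K / 4 ^+ n) ->
  (forall n, (k <= n)%N -> \int[leb]_(x in E) h n x ^+ 2 <= c + (2 ^+ n)^-1) ->
  \int[leb]_(x in E) g x ^+ 2 <= c.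
Proof.
move=> mD mE ED g2 h2 hg hc; set X := \int[leb]_(x in E) g x ^+ 2.
have K0 : 0 <= K.
  have := le_trans (Rintegral_sqr_ge0 D (fun x => h 0%N x - g x)) (hg 0%N).
  by rewrite expr0 divr1.
have le_d d : 0 < d -> X <= (1 + d) * c.
  move=> d0; have dV0 : 0 < d^-1 by rewrite invr_gt0.
  have b0 : 0 <= (1 + d) + (1 + d^-1) * K by rewrite addr_ge0 ?mulr_ge0//; lra.
  apply: (ler_addgt0MP b0) => e e0; have [n0 n0e] := exists_exprV2_le e0.
  pose n := maxn k n0.
  have en : (2 ^+ n)^-1 <= e by apply: le_trans n0e; rewrite ler_invXn2l ?ler1n// leq_maxr.
  have e4 : (4 ^+ n)^-1 <= (2 ^+ n)^-1 :> R.
    by rewrite lef_pV2 ?posrE ?exprn_gt0// lerXn2r ?nnegrE//; lra.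
  have := Rintegral_sqr_le_near mD mE ED d0 (h2 n) g2; rewrite -/X.
  have d1 : 0 <= 1 + d by lra.
  have := ler_wpM2l d1 (hc n (leq_maxl _ _)).
  have dV1 : 0 <= 1 + d^-1 by lra.
  have := ler_wpM2l dV1 (hg n); have := ler_wpM2l d1 en.
  have : (1 + d^-1) * (K / 4 ^+ n) <= (1 + d^-1) * (K * e).
    by rewrite ler_wpM2l// ler_wpM2l//; exact: le_trans e4 en.
  lra.
have c0 : 0 <= c by have := le_d 1 ltr01; have := Rintegral_sqr_ge0 E g; rewrite -/X; lra.
by apply: (ler_addgt0MP c0) => e /le_d; rewrite mulrDl mul1r mulrC.
Qed.

End L2Convexity.

Section WeakDerivative.
Variables (R : realType) (D : set R) (phi : R -> R) (c : nat -> R) (C : R).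
Hypotheses (sD : initial_segment D) (phi2 : Rintegrable D (fun x => phi x ^+ 2)).
Implicit Types (n k : nat) (f g h : R -> R).
Let mD : measurable D. Proof. exact: initial_segment_measurable. Qed.

Definition truncation n : set R := D `&` `[0, n%:R].

Lemma measurable_truncation n : measurable (truncation n).
Proof. exact: measurableI. Qed.

Lemma truncation_subset n : truncation n `<=` D.
Proof. exact: subIsetl. Qed.

Lemma sqr_integrable_initial h x : D x -> sqr_integrable D h -> sqr_integrable `[0, x] h.
Proof. by move=> Dx; apply: sqr_integrableS => //; exact: initial_segment_subset. Qed.

Definition near_derivative n h := [/\ sqr_integrable D h, \int[leb]_(x in D) h x ^+ 2 <= C,
  forall k, (k <= n)%N -> \int[leb]_(x in truncation k) h x ^+ 2 <= c k + (2 ^+ n)^-1 &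
  forall x, D x -> x <= n%:R ->
    `|phi 0 + \int[leb]_(y in `[0, x]) h y - phi x| <= 2 * (2 ^+ n)^-1].

Lemma near_derivativeS n m : (n <= m)%N -> near_derivative m `<=` near_derivative n.
Proof.
move=> nm h [h2 hC hc hphi]; have le2 := ler_invXn2l (ler1n R 2) nm; split=> //.
  by move=> k kn; apply: le_trans (hc k (leq_trans kn nm)) _; rewrite lerD2l.
move=> x Dx xn; apply: le_trans (hphi x Dx _) _; last by rewrite ler_pM2l.
by apply: le_trans xn _; rewrite ler_nat.
Qed.

Lemma near_derivative_mid n f g : near_derivative n f -> near_derivative n g ->
  near_derivative n (fun x => (f x + g x) / 2).
Proof.
move=> [f2 fC fc fphi] [g2 gC gc gphi]; split.
- exact: sqr_integrable_mid.
- exact: Rintegral_sqr_mid_le.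
- have subS k := sqr_integrableS mD (measurable_truncation k) (@truncation_subset k).
  move=> k kn; apply: Rintegral_sqr_mid_le; rewrite ?fc ?gc//; [exact: measurable_truncation|
    exact: subS|exact: subS].
move=> x Dx xn.
have fi := sqr_integrable_itv (sqr_integrable_initial Dx f2).
have gi := sqr_integrable_itv (sqr_integrable_initial Dx g2).
have -> : \int[leb]_(y in `[0, x]) ((f y + g y) / 2) =
   2^-1 * \int[leb]_(y in `[0, x]) f y + 2^-1 * \int[leb]_(y in `[0, x]) g y.
  rewrite -!RintegralZl// -RintegralD//; [|exact: RintegrableZl..].
  by apply: eq_Rintegral => y _; field.
move: (fphi x Dx xn) (gphi x Dx xn); rewrite !ler_norml => /andP[? ?] /andP[? ?].
by apply/andP; split; lra.
Qed.

Lemma near_derivative_limit (g : R -> R) (h : nat -> R -> R) (K : R) :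
  (forall n, near_derivative n (h n)) -> sqr_integrable D g ->
  (forall n, \int[leb]_(x in D) (h n x - g x) ^+ 2 <= K / 4 ^+ n) ->
  forall x, D x -> phi x = phi 0 + \int[leb]_(y in `[0, x]) g y.
Proof.
move=> hn g2 hg x Dx; have x0 := initial_segment_ge0 sD Dx.
have K0 : 0 <= K.
  have := le_trans (Rintegral_sqr_ge0 D (fun x => h 0%N x - g x)) (hg 0%N).
  by rewrite expr0 divr1.
apply/eqP; rewrite eq_sym -subr_eq0 -normr_le0.
have b0 : 0 <= K + x + 2 by lra.
apply: (ler_addgt0MP b0) => e e0; have [n0 n0e] := exists_exprV2_le e0.
pose n := maxn n0 (Num.truncn x).+1.
have en : (2 ^+ n)^-1 <= e by apply: le_trans n0e; rewrite ler_invXn2l ?ler1n// leq_maxl.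
have xn : x <= n%:R.
  by apply: le_trans (ltW (truncnS_gt x)) _; rewrite ler_nat leq_maxr.
have [h2 _ _ hphi] := hn n; have diff := sqr_integrableB mD h2 g2.
have hx := sqr_integrable_itv (sqr_integrable_initial Dx h2).
have gx := sqr_integrable_itv (sqr_integrable_initial Dx g2).
have dx := sqr_integrable_initial Dx diff.
have P0 : 0 < 2 ^+ n :> R by rewrite exprn_gt0.
have := le_normr_Rintegral_sqr x0 P0 dx; rewrite RintegralB// subr0.
have : 2 ^+ n * \int[leb]_(y in `[0, x]) (h n y - g y) ^+ 2 <= K * (2 ^+ n)^-1.
  apply: le_trans (ler_wpM2l (ltW P0) (_ : _ <= K / 4 ^+ n)) _.
    apply: le_trans (hg n); apply: subset_Rintegral_sqr => //; last by case: diff.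
    exact: initial_segment_subset.
  rewrite (_ : 4 = 2 * 2); last by ring.
  by rewrite exprMn le_eqVlt; apply/orP; left; apply/eqP; field; rewrite gt_eqF.
have := hphi x Dx xn; have := ler_wpM2l b0 en.
rewrite !ler_norml => ? /andP[? ?] ? /andP[? ?].
by rewrite add0r; apply/andP; split; lra.
Qed.

Lemma exists_weak_derivative : (forall n, near_derivative n !=set0) ->
  exists g, H1on D phi g /\
    forall k, \int[leb]_(x in truncation k) g x ^+ 2 <= c k.
Proof.
move=> ne.
have [g [h [hn g2 hg]]] := L2_nested_convex_limit mD
  (fun n h (hn : near_derivative n h) => let: And4 h2 _ _ _ := hn in h2)
  (fun n h (hn : near_derivative n h) => let: And4 _ hC _ _ := hn in hC)
  near_derivativeS near_derivative_mid ne.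
exists g; split; first by split=> //; exact: near_derivative_limit hn g2 hg.
have h2 n : sqr_integrable D (h n) by have [] := hn n.
move=> k; apply: (Rintegral_sqr_limit_le (k := k) mD (measurable_truncation k) _ g2 h2 hg).
  exact: truncation_subset.
by move=> n kn; have [_ _ hc _] := hn n; exact: hc.
Qed.

End WeakDerivative.

(** * Limits along ultrafilters *)

Lemma ultra_bounded_cvg (R : realType) (I : Type) (U : set_system I) {UU : UltraFilter U}
    (v : I -> R) (M : R) :
  (\forall i \near U, `|v i| <= M) -> exists l : R, v i @[i --> U] --> l.
Proof.
move=> vM; have compactM : compact `[- M, M] by exact: segment_compact.
have [|l [_ cluster_l]] := compactM (v @ U) _.
  by apply: filterS vM => i; rewrite /= in_itv/= ler_norml.
exists l => B Bl; have [//|nB] := in_ultra_setVsetC (v @^-1` B) UU.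
by have [x []] := cluster_l (~` B) B nB Bl.
Qed.

Definition H1_ball (R : realType) (D : set R) (C m A : R) (u g : R -> R) :=
  [/\ H1on D u g, \int[leb]_(x in D) g x ^+ 2 <= C, \int[leb]_(x in D) u x ^+ 2 <= m &
    bounded_on D u A].

Section EdgeLimit.
Variables (R : realType) (I : Type) (U : set_system I).
Context {UU : UltraFilter U}.
Variables (D : set R) (u g : I -> R -> R) (C m A : R).
Hypotheses (sD : initial_segment D) (C0 : 0 < C) (A0 : 0 <= A).
Hypothesis ugP : \forall i \near U, H1_ball D C m A (u i) (g i).
Implicit Types (k n : nat) (e eta s t x : R) (gam : R -> R).
Let mD : measurable D. Proof. exact: initial_segment_measurable. Qed.
Let mT := measurable_truncation sD.

Lemma exists_pointwise_limit : exists phi : R -> R, forall x, D x -> u i x @[i --> U] --> phi x.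
Proof.
have /choice[phi phiP] : forall x, exists l : R, D x -> u i x @[i --> U] --> l.
  move=> x; have [Dx|nDx] := pselect (D x); last by exists 0.
  have [|l ul] := @ultra_bounded_cvg R I U UU (u^~ x) A; last by exists l.
  by apply: filterS ugP => i [_ _ _ uA]; exact: uA.
by exists phi.
Qed.

Variable phi : R -> R.
Hypothesis u_phi : forall x, D x -> u i x @[i --> U] --> phi x.

Lemma limit_bounded_on : bounded_on D phi A.
Proof.
move=> x Dx; apply: (closed_cvg (fun y => y <= A) (@closed_le R A) _ _ (cvg_norm (u_phi Dx))).
by apply: filterS ugP => i [_ _ _ uA]; exact: uA.
Qed.

Lemma limit_equicontinuous eta s t : 0 < eta -> D s -> D t ->
  `|t - s| <= eta ^+ 2 / (4 * C) -> `|phi t - phi s| <= eta.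
Proof.
move=> eta0 Ds Dt st.
apply: (closed_cvg (fun y => y <= eta) (@closed_le R eta) _ _
  (cvg_norm (cvgB (u_phi Dt) (u_phi Ds)))).
by apply: filterS ugP => i [ui gC _ _]; exact: (H1on_equicontinuous sD ui C0).
Qed.

Lemma limit_uniform (N e : R) : 0 < e ->
  \forall i \near U, forall x, D x -> x <= N -> `|u i x - phi x| <= e.
Proof.
move=> e0; pose eta := e / 3; have eta0 : 0 < eta by rewrite divr_gt0.
pose d := eta ^+ 2 / (4 * C); have d0 : 0 < d by rewrite divr_gt0 ?exprn_gt0// mulr_gt0.
pose K := (Num.truncn (N / d)).+1.
have grid : \forall i \near U, forall k : 'I_K,
    D (k%:R * d) -> `|u i (k%:R * d) - phi (k%:R * d)| <= eta.
  apply: filter_forall => k; have [Dk|nDk] := pselect (D (k%:R * d)).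
    by move/cvgrPdistC_le: (u_phi Dk) => /(_ eta eta0); apply: filterS => i.
  by apply: nearW => i /nDk.
apply: filterS2 ugP grid => i [ui gC _ _] gridi x Dx xN.
have x0 := initial_segment_ge0 sD Dx.
have xd0 : 0 <= x / d by rewrite divr_ge0// ltW.
have kK : (Num.truncn (x / d) < K)%N by rewrite ltnS le_truncn// ler_pM2r// invr_gt0.
have /andP[kx xk] := truncn_itv xd0.
move: (gridi (Ordinal kK)) => /=; set k := Num.truncn _ in kx xk * => uk.
rewrite ler_pdivlMr// in kx; rewrite ltr_pdivrMr// in xk.
have Dk : D (k%:R * d).
  apply: (initial_segment_subset sD (lexx 0) Dx).
  by rewrite /= in_itv/= kx mulr_ge0// ltW.
have close : `|x - k%:R * d| <= eta ^+ 2 / (4 * C).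
  by rewrite ger0_norm ?subr_ge0// -/d; move: xk; rewrite -natr1 mulrDl mul1r; lra.
have := H1on_equicontinuous sD ui C0 eta0 gC Dk Dx close.
have := limit_equicontinuous eta0 Dk Dx close.
move: (uk Dk); rewrite !ler_norml /eta => /andP[? ?] /andP[? ?] /andP[? ?].
by apply/andP; split; lra.
Qed.

Lemma limit_continuous : {within D, continuous phi}.
Proof.
apply/subspace_continuousP => x Dx; apply/cvgrPdist_le => e e0.
have d0 : 0 < e ^+ 2 / (4 * C) by rewrite divr_gt0 ?exprn_gt0// mulr_gt0.
rewrite near_withinE; near=> y => Dy; apply: (limit_equicontinuous e0 Dy Dx).
by near: y; apply: (@cvgr_dist_le _ _ _ _ _ id).
Unshelve. all: by end_near. Qed.

Let mphi : measurable_fun D phi.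
Proof. by apply: subspace_continuous_measurable_fun => //; exact: limit_continuous. Qed.

Lemma limit_Rintegrable_exprn n k : Rintegrable (truncation D k) (fun x => phi x ^+ n).
Proof.
apply: (@le_Rintegrable _ _ _ (fun=> A ^+ n)) => //.
- by apply: measurable_funX; apply: measurable_funS mphi => //; exact: truncation_subset.
- by move=> x [Dx _]; rewrite normrX lerXn2r ?nnegrE//; exact: (limit_bounded_on Dx).
- by apply: RintegrableS (Rintegrable_cst 0 k%:R (A ^+ n)) => //; exact: subIsetr.
Qed.

Lemma cvg_Rintegral_exprn n k :
  \int[leb]_(x in truncation D k) u i x ^+ n.+2 @[i --> U] -->
  \int[leb]_(x in truncation D k) phi x ^+ n.+2.
Proof.
have [K K0 lip] := exprn_lipschitz n.+2 A0.
apply/cvgrPdistC_le => e e0; pose d := e / (K + 1) / (k%:R + 1).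
have d0 : 0 < d by rewrite !divr_gt0// ltr_wpDl.
have Kdk : K * d * k%:R <= e.
  have -> : K * d * k%:R = e * ((K / (K + 1)) * (k%:R / (k%:R + 1))).
    by rewrite /d; field; rewrite !gt_eqF// ltr_wpDl.
  rewrite ler_piMr ?(ltW e0)// mulr_ile1 ?divr_ge0 ?addr_ge0//.
    by rewrite ler_pdivrMr ?ltr_wpDl// mul1r lerDl.
  by rewrite ler_pdivrMr ?ltr_wpDl// mul1r lerDl.
apply: filterS2 ugP (limit_uniform k%:R d0) => i [ui _ _ uA] close.
have uint : Rintegrable (truncation D k) (fun x => u i x ^+ n.+2).
  apply: RintegrableS (H1on_Rintegrable_exprn sD ui n uA) => //; exact: truncation_subset.
have mTk := mT k; have pint := limit_Rintegrable_exprn n.+2 k.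
have diff := RintegrableB mTk uint pint.
rewrite -RintegralB//; apply: le_trans (le_normr_Rintegral _ diff) _ => //.
apply: le_trans Kdk; rewrite -[X in _ * X]subr0 -Rintegral_itv_cst//.
apply: (@le_trans _ _ (\int[leb]_(x in truncation D k) (K * d))).
  apply: le_Rintegral => //; first exact: (integrable_norm diff).
    by apply: RintegrableS (Rintegrable_cst 0 k%:R _) => //; exact: subIsetr.
  move=> x [Dx]; rewrite /= in_itv/= => /andP[_ xk].
  apply: le_trans (lip _ _ (uA x Dx) (limit_bounded_on Dx)) _.
  by rewrite ler_wpM2l// close.
apply: ge0_subset_Rintegral => //; [exact: subIsetr| |exact: Rintegrable_cst].
by move=> x _; rewrite mulr_ge0// ltW.
Qed.

Lemma limit_sqr_Rintegrable : Rintegrable D (fun x => phi x ^+ 2).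
Proof.
have trunc_le k : (\int[leb]_(x in truncation D k) (phi x ^+ 2)%:E <= m%:E)%E.
  rewrite (EFin_Rintegral (mT k) (limit_Rintegrable_exprn 2 k)) lee_fin.
  apply: (closed_cvg (fun y => y <= m) (@closed_le R m) _ _ (@cvg_Rintegral_exprn 0 k)).
  apply: filterS ugP => i [[_ u2 _] _ um _]; apply: le_trans um.
  by apply: subset_Rintegral_sqr => //; exact: truncation_subset.
have DU : \bigcup_k truncation D k = D.
  rewrite eqEsubset; split=> [x [k _ []]//|x Dx].
  exists (Num.truncn x).+1 => //; split=> //.
  by rewrite /= in_itv/= (initial_segment_ge0 sD Dx) ltW// truncnS_gt.
apply: ge0_Rintegrable => //; first exact: measurable_funX.
  by move=> x _; exact: sqr_ge0.
apply: (@le_lt_trans _ _ m%:E); last exact: ltry.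
have cvgT : (\int[leb]_(x in truncation D k) (phi x ^+ 2)%:E)%E @[k --> \oo] -->
    (\int[leb]_(x in D) (phi x ^+ 2)%:E)%E.
  rewrite -[X in _ --> integral _ X _]DU; apply: ge0_nondecreasing_set_cvg_integral => //.
  - move=> n k nk; apply/subsetPset => x [Dx]; rewrite /= in_itv/= => /andP[x0 xn].
    by split=> //; rewrite /= in_itv/= x0 (le_trans xn)// ler_nat.
  - move=> k; apply/measurable_EFinP.
    exact: Rintegrable_measurable (limit_Rintegrable_exprn 2 k).
  - by move=> k x _; rewrite lee_fin sqr_ge0.
by rewrite -(cvg_lim _ cvgT)//; apply: lime_le; [exact: cvgP cvgT|exact: nearW].
Qed.

Lemma exists_weak_limit : exists gam, H1on D phi gam /\ forall k e, 0 < e ->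
  \forall i \near U, \int[leb]_(x in truncation D k) gam x ^+ 2 <=
    \int[leb]_(x in truncation D k) g i x ^+ 2 + e.
Proof.
have gle k i : H1_ball D C m A (u i) (g i) -> \int[leb]_(x in truncation D k) g i x ^+ 2 <= C.
  move=> [[[_ g2] _ _] gC _ _]; apply: le_trans gC.
  by apply: subset_Rintegral_sqr => //; exact: truncation_subset.
have /choice[c cP] : forall k, exists l : R,
    \int[leb]_(x in truncation D k) g i x ^+ 2 @[i --> U] --> l.
  move=> k; apply: (@ultra_bounded_cvg _ _ _ _ _ C); apply: filterS ugP => i /(gle k).
  by rewrite ger0_norm// Rintegral_sqr_ge0.
have [|gam [gamH gamc]] := @exists_weak_derivative R D phi c C sD limit_sqr_Rintegrable.
  move=> n; have eps0 : 0 < (2 ^+ n)^-1 :> R by rewrite invr_gt0 exprn_gt0.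
  have norms : \forall i \near U, forall k : 'I_n.+1,
      `|\int[leb]_(x in truncation D k) g i x ^+ 2 - c k| <= (2 ^+ n)^-1.
    apply: filter_forall => k.
    by move/cvgrPdistC_le: (cP k) => /(_ _ eps0); apply: filterS => i.
  have [i [[[g2 _ uE] gC _ _] [normi close]]] :=
    filter_ex (filterI ugP (filterI norms (limit_uniform n%:R eps0))).
  exists (g i); split=> //.
    move=> k kn; have := normi (Ordinal (kn : (k < n.+1)%N)) => /=.
    by rewrite ler_norml => /andP[_]; lra.
  have D0 : D 0 by case: sD.
  move=> x Dx xn; move: (close x Dx xn) (close 0 D0 (ler0n R n)); rewrite (uE x Dx).
  by rewrite !ler_norml => /andP[? ?] /andP[? ?]; apply/andP; split; lra.
exists gam; split=> // k e e0; move/cvgrPdistC_le: (cP k) => /(_ e e0).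
by apply: filterS => i; rewrite ler_norml => /andP[ge_c _]; have := gamc k; lra.
Qed.

End EdgeLimit.

Section LowerSemicontinuity.
Variables (R : realType) (I : Type) (U : set_system I).
Context {UU : UltraFilter U}.
Implicit Types (D E : set R) (u g : I -> R -> R) (phi gam v h : R -> R) (C A m e : R).

Definition lower_limit D u g phi gam := [/\ H1on D phi gam,
  forall x, D x -> u i x @[i --> U] --> phi x,
  forall e, 0 < e -> \forall i \near U,
    \int[leb]_(x in D) phi x ^+ 2 <= \int[leb]_(x in D) u i x ^+ 2 + e &
  forall e, 0 < e -> \forall i \near U,
    \int[leb]_(x in D) energy_density phi gam x <=
    \int[leb]_(x in D) energy_density (u i) (g i) x + e].

Lemma Rintegral_energy_density E v h : measurable E ->
  Rintegrable E (fun x => h x ^+ 2) -> Rintegrable E (fun x => v x ^+ 6) ->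
  \int[leb]_(x in E) energy_density v h x =
  2^-1 * \int[leb]_(x in E) h x ^+ 2 - 6^-1 * \int[leb]_(x in E) v x ^+ 6.
Proof. by move=> mE h2 v6; rewrite RintegralB//; [rewrite !RintegralZl|exact: RintegrableZl..]. Qed.

Lemma exists_lower_limit_of_tails D u g C m A : initial_segment D -> 0 < C -> 0 <= A ->
  (\forall i \near U, H1_ball D C m A (u i) (g i)) ->
  (forall phi gam, H1on D phi gam -> bounded_on D phi A ->
    (forall x, D x -> u i x @[i --> U] --> phi x) -> forall e, 0 < e -> exists k,
    [/\ \int[leb]_(x in D) phi x ^+ 2 <= \int[leb]_(x in truncation D k) phi x ^+ 2 + e,
        \int[leb]_(x in D) energy_density phi gam x <=
          \int[leb]_(x in truncation D k) energy_density phi gam x + e &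
        \forall i \near U, \int[leb]_(x in truncation D k) energy_density (u i) (g i) x <=
          \int[leb]_(x in D) energy_density (u i) (g i) x + e]) ->
  exists phi gam, lower_limit D u g phi gam.
Proof.
move=> sD C0 A0 ugP tails; have mD := initial_segment_measurable sD.
have [phi u_phi] := exists_pointwise_limit ugP.
have phiA : bounded_on D phi A by exact: (limit_bounded_on (UU := UU) ugP u_phi).
have [gam [phiH gam_le]] := exists_weak_limit sD C0 A0 ugP u_phi.
exists phi, gam; split=> // e e0.
  have e20 : 0 < e / 2 by rewrite divr_gt0.
  have [k [mass_tail _ _]] := tails _ _ phiH phiA u_phi _ e20.
  have /cvgrPdistC_le/(_ _ e20) :=
    cvg_Rintegral_exprn (UU := UU) (n := 0) (k := k) sD C0 A0 ugP u_phi.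
  apply: filterS2 ugP => i [[_ u2 _] _ _ _] /=; rewrite ler_norml => /andP[mass_close _].
  have := subset_Rintegral_sqr mD (measurable_truncation sD k) (@truncation_subset _ D k) u2.
  lra.
have e40 : 0 < e / 4 by rewrite divr_gt0.
have [k [_ phi_tail u_tail]] := tails _ _ phiH phiA u_phi _ e40.
have /cvgrPdistC_le/(_ _ e40) p6_close :=
  cvg_Rintegral_exprn (UU := UU) (n := 4) (k := k) sD C0 A0 ugP u_phi.
have mT := measurable_truncation sD k; have subT := @truncation_subset _ D k.
have trunc_energy v h : H1on D v h -> bounded_on D v A ->
    \int[leb]_(x in truncation D k) energy_density v h x =
    2^-1 * \int[leb]_(x in truncation D k) h x ^+ 2 -
    6^-1 * \int[leb]_(x in truncation D k) v x ^+ 6.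
  move=> vh vA; apply: Rintegral_energy_density => //.
    by have [[_ h2] _ _] := vh; exact: RintegrableS h2.
  exact: RintegrableS (H1on_Rintegrable_exprn sD vh 4 vA).
move: phi_tail; rewrite (trunc_energy _ _ phiH phiA) => phi_tail.
apply: filterS2 (filterI ugP u_tail) (filterI p6_close (gam_le k _ e40)).
move=> i [[uiH _ _ uA]]; rewrite (trunc_energy _ _ uiH uA) => energy_tail [].
by rewrite ler_norml => /andP[? ?]; lra.
Qed.

Lemma exists_lower_limit_itvcc l u g C m A : 0 < l -> 0 < C -> 0 <= A ->
  (\forall i \near U, H1_ball `[0, l] C m A (u i) (g i)) ->
  exists phi gam, lower_limit `[0, l] u g phi gam.
Proof.
move=> l0 C0 A0 ugP.
apply: (exists_lower_limit_of_tails (initial_segment_itvcc (ltW l0)) C0 A0 ugP).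
move=> phi gam _ _ _ e e0; exists (Num.truncn l).+1.
have -> : truncation `[0, l] (Num.truncn l).+1 = `[0, l]%classic.
  apply/setIidPl => x; rewrite /= !in_itv/= => /andP[-> xl]/=.
  exact: le_trans xl (ltW (truncnS_gt _)).
by split; rewrite ?lerDl ?(ltW e0)//; apply: nearW => i; rewrite lerDl ltW.
Qed.

(* The energy that may be lost at infinity is nonnegative in the limit, by [tail_energy_ge]. *)
Lemma exists_lower_limit_itvcy u g C A : 0 < C -> 0 <= A ->
  (\forall i \near U, H1_ball `[0, +oo[ C (mu_line R) A (u i) (g i)) ->
  exists phi gam, lower_limit `[0, +oo[ u g phi gam.
Proof.
move=> C0 A0 ugP; have sD := initial_segment_itvcy R.
apply: (exists_lower_limit_of_tails sD C0 A0 ugP) => phi gam phiH phiA u_phi e e0.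
have [[_ gam2] phi2 _] := phiH.
have A1 : 0 < A + 1 by rewrite ltr_wpDl.
pose eta := Num.sqrt e / (2 * (A + 1)).
have eta0 : 0 < eta by rewrite divr_gt0 ?sqrtr_gt0// mulr_gt0.
have [n [mass_tail gam_tail phin]] := H1on_small_tail phiH e0 eta0; exists n.
have -> : truncation `[(0 : R), +oo[ n = `[0, n%:R]%classic.
  by apply/setIidPr => x; rewrite /= !in_itv/= andbT => /andP[].
have n0 : 0 <= n%:R :> R by [].
have Dn : `[0, +oo[%classic (n%:R : R) by rewrite /= in_itv/= n0.
have sub : `[n%:R, +oo[ `<=` `[(0 : R), +oo[ by apply: subset_itvr; rewrite bnd_simp.
have bndA1 v : bounded_on `[0, +oo[ v A -> bounded_on `[0, +oo[ v (A + 1).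
  by move=> vA x Dx; apply: le_trans (vA x Dx) _; rewrite lerDl.
have ei v h : H1on `[0, +oo[ v h -> bounded_on `[0, +oo[ v A ->
    Rintegrable `[0, +oo[ (energy_density v h).
  by move=> vh vA; apply: (Rintegrable_energy_density sD vh A1) => //; exact: bndA1.
split.
- by rewrite (Rintegral_itv_split n0 _ phi2)// lerD2l.
- rewrite (Rintegral_itv_split n0 _ (ei _ _ phiH phiA))// lerD2l; apply: le_trans gam_tail.
  apply: le_Rintegral => //; [exact: RintegrableS (ei _ _ phiH phiA)|exact: RintegrableS gam2|].
  move=> x _; rewrite /energy_density; have := exprn_even_ge0 (n := 6) (phi x) isT.
  by have := sqr_ge0 (gam x); lra.
have /cvgrPdistC_le/(_ _ eta0) := u_phi _ Dn; apply: filterS2 ugP => i [ui _ um uA] close.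
rewrite (Rintegral_itv_split n0 _ (ei _ _ ui uA))// -addrA lerDl.
have mass : \int[leb]_(x in `[n%:R, +oo[) u i x ^+ 2 <= mu_line R.
  by apply: le_trans um; apply: subset_Rintegral_sqr => //; case: ui.
have := tail_energy_ge ui n0 mass (bounded_onS sub (bndA1 _ uA)).
suff : (A + 1) ^+ 2 * u i n%:R ^+ 2 <= e by lra.
have un : `|u i n%:R| <= 2 * eta.
  by rewrite -[u i n%:R](subrK (phi n%:R)); apply: le_trans (ler_normD _ _) _; lra.
apply: le_trans (ler_wpM2l (sqr_ge0 _) (ler_sqr_norm un)) _.
have -> : (A + 1) ^+ 2 * (2 * eta) ^+ 2 = Num.sqrt e ^+ 2 by rewrite /eta; field; rewrite gt_eqF.
by rewrite sqr_sqrtr// ltW.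
Qed.

End LowerSemicontinuity.

(** * Existence of minimizers *)

Lemma exists_minimizing_ultrafilter (R : realType) (T : Type) (P : set T) (F : T -> R) :
  has_inf (F @` P) -> exists U : set_system T,
    [/\ UltraFilter U, \forall x \near U, P x & F x @[x --> U] --> inf (F @` P)].
Proof.
move=> infP; pose c := inf (F @` P).
pose B e := P `&` [set x | F x <= c + e].
have BP : ProperFilter (filter_from [set e | 0 < e] B).
  apply: filter_from_proper => [|e e0]; last first.
    by have [_ [x Px <-] Fx] := inf_adherent e0 infP; exists x; split=> //; exact: ltW.
  apply: filter_from_filter => [|d e d0 e0]; first by exists 1; exact: ltr01.
  exists (Num.min d e); first by rewrite /= lt_min d0.
  move=> x [Px Fx]; split; split=> //; apply: le_trans Fx _; rewrite lerD2l.
    by rewrite ge_min lexx.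
  by rewrite ge_min lexx orbT.
have [U [UU BU]] := ultraFilterLemma BP; exists U; split=> //.
  by apply: BU; exists 1 => [|x []]; first exact: ltr01.
apply/cvgrPdistC_le => e e0; apply: BU; exists e => // x [Px Fx].
have cF : c <= F x by apply: ge_inf; [case: infP|exists x].
by rewrite /= ger0_norm ?subr_ge0// lerBlDl.
Qed.

Lemma near_ler_sum (R : realFieldType) (I : Type) (J : finType) (U : set_system I)
    (UF : Filter U) (a : J -> R) (F : I -> J -> R) :
  (forall j e, 0 < e -> \forall i \near U, a j <= F i j + e) ->
  forall e, 0 < e -> \forall i \near U, \sum_j a j <= \sum_j F i j + e.
Proof.
move=> aF e e0; pose d := e / (#|J|%:R + 1).
have d0 : 0 < d by rewrite divr_gt0// ltr_wpDl.
have : \forall i \near U, forall j, a j <= F i j + d by apply: filter_forall => j; exact: aF.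
apply: filterS => i aFi; apply: (@le_trans _ _ (\sum_j (F i j + d))); first exact: ler_sum.
rewrite big_split/= lerD2l sumr_const -[#|_|]/#|J| -mulr_natl /d mulrA ler_pdivrMr ?ltr_wpDl//.
by rewrite mulrC ler_pM2l// lerDl.
Qed.

Section GraphLimit.
Variables (R : realType) (G : metric_graph R) (U : set_system (gfun G)).
Context {UU : UltraFilter U}.
Variables (m C A : R).
Hypotheses (ml : m <= mu_line R) (C0 : 0 < C) (A0 : 0 <= A).
Hypothesis Ubnd : \forall f \near U, [/\ H1 f, Rmass f = m, Rdnorm f <= C & gbounded f A].
Implicit Types (f : gfun G) (j : edge G).

Definition graph_lower_limit f0 := forall j,
  lower_limit U (edge_dom j) (fun f => edge_fun f j) (fun f => edge_deriv f j)
    (edge_fun f0 j) (edge_deriv f0 j).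

Lemma exists_edge_lower_limit j : exists p : (R -> R) * (R -> R),
  lower_limit U (edge_dom j) (fun f => edge_fun f j) (fun f => edge_deriv f j) p.1 p.2.
Proof.
have ball : \forall f \near U,
    H1_ball (edge_dom j) C (mu_line R) A (edge_fun f j) (edge_deriv f j).
  apply: filterS Ubnd => f [Hf fm fC fA]; split; [exact: H1_edge| | |exact: fA].
    exact: le_trans (edge_dnorm_le f j) fC.
  by apply: le_trans (edge_mass_le f j) _; rewrite fm.
case: j ball => [e|h] ball.
  have [phi [gam lim]] := exists_lower_limit_itvcc (UU := UU) (blen_gt0 e) C0 A0 ball.
  by exists (phi, gam).
have [phi [gam lim]] := exists_lower_limit_itvcy (UU := UU) C0 A0 ball.
by exists (phi, gam).
Qed.

Lemma exists_graph_lower_limit : exists f0, graph_lower_limit f0.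
Proof.
have [p pP] := choice exists_edge_lower_limit.
exists (GFun (fun e => (p (inl e)).1) (fun e => (p (inl e)).2)
  (fun h => (p (inr h)).1) (fun h => (p (inr h)).2)).
by case=> [e|h]; [exact: (pP (inl e))|exact: (pP (inr h))].
Qed.

Variable f0 : gfun G.
Hypothesis lim0 : graph_lower_limit f0.

Lemma limit_vertex_values : exists phi, vertex_values f0 phi.
Proof.
have /choice[vf vfP] : forall f, exists phi, H1 f -> vertex_values f phi.
  move=> f; have [/H1P[[phi fphi] _]|nH] := pselect (H1 f); first by exists phi.
  by exists (fun=> 0).
exists (fun v => lim (vf f v @[f --> U])).
have limE v j x : edge_dom j x -> (forall f, H1 f -> edge_fun f j x = vf f v) ->
    edge_fun f0 j x = lim (vf f v @[f --> U]).
  move=> jx fv; apply/esym/cvg_lim => //; have [_ cvg_x _ _] := lim0 j.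
  apply: cvg_trans (cvg_x x jx); apply: near_eq_cvg.
  by apply: filterS Ubnd => f [/fv].
split=> [e|h]; last first.
  by apply: (@limE _ (inr h)) => [|f /vfP[_]]; [rewrite /= in_itv/= lexx|exact].
have l0 := ltW (blen_gt0 e).
split; apply: (@limE _ (inl e)) => [|f /vfP[/(_ e)[]]]; by [rewrite /= in_itv/= lexx ?l0|].
Qed.

Lemma limit_H1 : H1 f0.
Proof. by apply/H1P; split=> [|j]; [exact: limit_vertex_values|have [] := lim0 j]. Qed.

Lemma limit_Rmass_le : Rmass f0 <= m.
Proof.
apply/ler_addgt0Pr => e e0.
have mass_le j := let: And4 _ _ le_j _ := lim0 j in le_j.
have [f [[_ fm _ _]]] := filter_ex (filterI Ubnd (near_ler_sum _ mass_le e0)).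
by rewrite -/(Rmass f) fm.
Qed.

Lemma limit_Renergy_le c : Renergy f @[f --> U] --> c -> Renergy f0 <= c.
Proof.
move=> fc; apply/ler_addgt0Pr => e e0; have e20 : 0 < e / 2 by rewrite divr_gt0.
have energy_le j := let: And4 _ _ _ le_j := lim0 j in le_j.
have /cvgrPdistC_le/(_ _ e20) close := fc.
have [f []] := filter_ex (filterI close (near_ler_sum _ energy_le e20)).
by rewrite ler_norml -/(Renergy f) -/(Renergy f0) => /andP[_ ?] ?; lra.
Qed.

End GraphLimit.

Section Existence.
Variables (R : realType) (G : metric_graph R).
Hypothesis oneHL : #|HL G| = 1%N.
Hypothesis noterm : forall v : V G, ~ terminal_point v.
Implicit Types (f : gfun G) (m : R).

Lemma exists_relaxed_minimizer m : mu_halfline R < m -> m <= mu_line R ->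
  exists f0, [/\ H1 f0, Rmass f0 <= m, Renergy f0 < 0 &
    forall f, H1 f -> Rmass f = m -> Renergy f0 <= Renergy f].
Proof.
move=> hm ml; have m0 : 0 < m := lt_trans (mu_halfline_gt0 R) hm.
pose P := [set f : gfun G | H1 f /\ Rmass f = m]; pose c := inf (@Renergy R G @` P).
have [f1 [Hf1 f1m f1_neg]] := exists_negative_energy oneHL noterm hm.
have [b bP] := Renergy_bounded_below oneHL noterm m0 ml.
have infP : has_inf (@Renergy R G @` P).
  by split; [exists (Renergy f1), f1|exists b => _ [f [Hf fm] <-]; exact: bP].
have c_le f : H1 f -> Rmass f = m -> c <= Renergy f.
  by move=> Hf fm; apply: ge_inf; [case: infP|exists f].
have c_neg : c < 0 := le_lt_trans (c_le _ Hf1 f1m) f1_neg.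
have [U [UU UP Uc]] := exists_minimizing_ultrafilter infP.
have c20 : 0 < - c / 2 by rewrite divr_gt0// oppr_gt0.
have [A A0 fA] := negative_energy_bounded oneHL noterm m0 ml c20.
have A4m0 : 0 <= A ^+ 4 * m by rewrite mulr_ge0 ?exprn_ge0// ltW.
have C0 : 0 < A ^+ 4 * m + 1 by rewrite ltr_wpDl.
have Ubnd : \forall f \near U,
    [/\ H1 f, Rmass f = m, Rdnorm f <= A ^+ 4 * m + 1 & gbounded f A].
  move/cvgrPdistC_le: Uc => /(_ _ c20); apply: filterS2 UP => f [Hf fm].
  rewrite -/c ler_norml => /andP[_ fc].
  have bnd : gbounded f A by apply: fA => //; lra.
  by split=> //; have := Rp6_le Hf bnd; have := RenergyE Hf; rewrite fm; lra.
have [f0 lim0] := exists_graph_lower_limit (UU := UU) ml C0 A0 Ubnd.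
have f0c : Renergy f0 <= c by exact: (limit_Renergy_le (UU := UU) lim0 Uc).
exists f0; split; last by move=> f Hf fm; exact: le_trans f0c (c_le f Hf fm).
- exact: (limit_H1 (UU := UU) Ubnd).
- exact: (limit_Rmass_le (UU := UU) Ubnd).
- exact: le_lt_trans f0c c_neg.
Qed.

(* A factor [c >= 1] scales the kinetic term by [c ^+ 2] and the L^6 term by [c ^+ 6]. *)
Lemma exists_rescaling f0 m : H1 f0 -> Renergy f0 < 0 -> Rmass f0 <= m ->
  exists f, [/\ H1 f, Rmass f = m & Renergy f <= Renergy f0].
Proof.
move=> H0 neg f0m.
have mass0 : 0 < Rmass f0.
  rewrite lt_neqAle Rmass_ge0 andbT eq_sym; apply: contraTneq neg => f00.
  have [A fA] := gfun_bounded H0; rewrite -leNgt.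
  by have := Renergy_ge H0 fA; rewrite f00 mulr0 oppr0.
pose w := m / Rmass f0.
have w1 : 1 <= w by rewrite ler_pdivlMr// mul1r.
have w0 : 0 <= w by lra.
exists (gscale (Num.sqrt w) f0); split; first exact: H1_gscale.
  by rewrite Rmass_gscale// sqr_sqrtr// divfK// gt_eqF.
rewrite Renergy_gscale// (exprM _ 2 3) sqr_sqrtr//.
have w3 : w * Rp6 f0 <= w ^+ 3 * Rp6 f0 by rewrite ler_wpM2r ?Rp6_ge0// ler_eXnr.
have : w * Renergy f0 <= 1 * Renergy f0 by rewrite ler_wnM2r// ltW.
by rewrite mul1r {1}RenergyE//; lra.
Qed.

Lemma exists_minimizer m : mu_halfline R < m -> m <= mu_line R ->
  exists f, [/\ H1 f, Rmass f = m &
    forall f', H1 f' -> Rmass f' = m -> Renergy f <= Renergy f'].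
Proof.
move=> hm ml; have [f0 [H0 f0m neg min0]] := exists_relaxed_minimizer hm ml.
have [f [Hf fm fle]] := exists_rescaling H0 neg f0m; exists f; split=> // f' Hf' f'm.
exact: le_trans fle (min0 f' Hf' f'm).
Qed.

End Existence.

(** * The ground state energy level *)

Section GroundStates.
Variables (R : realType) (G : metric_graph R).
Implicit Types (f : gfun G) (m : R).

Lemma H1_muP m f : H1_mu m f <-> H1 f /\ Rmass f = m.
Proof.
split=> [[Hf]|[Hf fm]]; first by rewrite massE// => -[].
by split=> //; rewrite massE// fm.
Qed.

Lemma Elev_le f : H1 f -> (Elev G (Rmass f) <= (Renergy f)%:E)%E.
Proof. by move=> Hf; apply: ereal_inf_lbound; exists f; [exact/H1_muP|rewrite energyE]. Qed.

Lemma Elev_minimizer f : H1 f ->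
  (forall f', H1 f' -> Rmass f' = Rmass f -> Renergy f <= Renergy f') ->
  Elev G (Rmass f) = (Renergy f)%:E.
Proof.
move=> Hf fmin; apply/eqP; rewrite eq_le Elev_le//=.
apply: le_ereal_inf_tmp => _ [f' /H1_muP[Hf' f'm] <-].
by rewrite energyE// lee_fin fmin.
Qed.

Hypothesis oneHL : #|HL G| = 1%N.
Hypothesis noterm : forall v : V G, ~ terminal_point v.

Lemma exists_ground_state m : mu_halfline R < m -> m <= mu_line R ->
  exists f, [/\ H1 f, Rmass f = m & Elev G m = (Renergy f)%:E].
Proof.
move=> hm ml; have [f [Hf fm fmin]] := exists_minimizer oneHL noterm hm ml.
exists f; split=> //; rewrite -fm; apply: Elev_minimizer => // f' Hf'.
by rewrite fm; exact: fmin.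
Qed.

Lemma Elev_lt0 m : mu_halfline R < m -> (Elev G m < 0)%E.
Proof.
move=> hm; have [f [Hf <- fneg]] := exists_negative_energy oneHL noterm hm.
by apply: le_lt_trans (Elev_le Hf) _; rewrite lte_fin.
Qed.

Lemma Elev_le0 m : 0 < m -> (Elev G m <= 0)%E.
Proof.
move=> m0; apply/lee_addgt0Pr => e e0; rewrite add0e.
have [f [Hf <- fe]] := exists_small_energy oneHL noterm m0 e0.
by apply: le_trans (Elev_le Hf) _; rewrite lee_fin.
Qed.

Lemma Elev_Ny m : mu_line R < m -> Elev G m = -oo%E.
Proof.
move=> lm; apply: eq_ninfty => M.
have [f [Hf <- fM]] := exists_energy_lt oneHL M lm.
by apply: le_trans (Elev_le Hf) _; rewrite lee_fin ltW.
Qed.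

Hypothesis conn : connected_graph G.

Lemma ground_state_mass_itv f m : 0 < m -> H1_mu m f -> energy f = Elev G m ->
  mu_halfline R < m <= mu_line R.
Proof.
move=> m0 /H1_muP[Hf fm]; rewrite energyE// => fE.
have [hm|_ /=] := leP m (mu_halfline R).
  have : 0 < Renergy f by apply: Renergy_gt0; rewrite ?fm ?gt_eqF.
  by rewrite -lte_fin fE ltNge Elev_le0.
by rewrite leNgt; apply/negP => lm; move: fE; rewrite Elev_Ny.
Qed.

End GroundStates.

Section CriticalMass.
Variables (R : realType) (G : metric_graph R).
Hypotheses (conn : connected_graph G) (oneHL : #|HL G| = 1%N).
Hypothesis noterm : forall v : V G, ~ terminal_point v.
Implicit Types (f : gfun G) (e : R).

Definition gn_ratio f := Rp6 f / (Rmass f ^+ 2 * Rdnorm f).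

Lemma mu_halfline_sqr : mu_halfline R ^+ 2 = 3 * pi ^+ 2 / 16.
Proof. by rewrite /mu_halfline !exprMn sqr_sqrtr// exprVn; field. Qed.

Lemma gn_ratio_le f : H1 f -> Rmass f != 0 -> gn_ratio f <= 16 / pi ^+ 2.
Proof.
move=> Hf f0; have := gagliardo_nirenberg conn oneHL noterm Hf f0; rewrite mu_halfline_sqr => gn.
have pi2 : 0 < pi ^+ 2 :> R by rewrite exprn_gt0// pi_gt0.
have p6pi : 0 <= Rp6 f * (3 * pi ^+ 2 / 16).
  by rewrite mulr_ge0 ?Rp6_ge0// divr_ge0// mulr_ge0// ltW.
have den0 : 0 < Rmass f ^+ 2 * Rdnorm f by lra.
by rewrite /gn_ratio ler_pdivrMr// mulrAC ler_pdivlMr//; lra.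
Qed.

Lemma gn_ratio_competitor k : 0 < k ->
  gn_ratio (competitor G 1 k 0) =
  16 * (1 + 4 * k * core_length G / pi) / (pi * (1 + 2 * k * core_length G / pi)) ^+ 2.
Proof.
move=> k0; have L0 := core_length_gt0 oneHL noterm; have p0 := pi_gt0 R.
rewrite /gn_ratio Rmass_competitor0// Rp6_competitor0// Rdnorm_competitor0// !expr1n !mul1r.
move: (pi) (core_length G) p0 L0 => p L p0 L0.
have kL0 : 0 < k * L by rewrite mulr_gt0.
by field; rewrite !gt_eqF//; lra.
Qed.

Lemma gn_ratio_ge e : 0 < e ->
  exists f, [/\ H1 f, Rmass f != 0 & 16 / pi ^+ 2 - e <= gn_ratio f].
Proof.
move=> e0; have p0 := pi_gt0 R; have L0 := core_length_gt0 oneHL noterm.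
pose y := e * pi ^+ 2 / 32; have y0 : 0 < y by rewrite divr_gt0// mulr_gt0// exprn_gt0.
pose k := y * pi / (2 * core_length G).
have k0 : 0 < k by rewrite divr_gt0// mulr_gt0.
exists (competitor G 1 k 0); split; first exact: H1_competitor.
  by rewrite Rmass_competitor0// expr1n mul1r gt_eqF// addr_gt0// divr_gt0// mulr_gt0.
have y1 : 0 < 1 + y by lra.
have kL : 2 * k * core_length G / pi = y.
  by rewrite /k; move: (y) (pi) p0 => z p p0; field; rewrite !gt_eqF.
have -> : gn_ratio (competitor G 1 k 0) = 16 * (1 + 2 * y) / (pi * (1 + y)) ^+ 2.
  by rewrite gn_ratio_competitor// -kL; congr (_ * (1 + _) / _); rewrite !mulrA -natrM.
rewrite ler_pdivlMr ?exprn_gt0 ?mulr_gt0//.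
have -> : (16 / pi ^+ 2 - e) * (pi * (1 + y)) ^+ 2 = (16 - 32 * y) * (1 + y) ^+ 2.
  by rewrite /y; move: (pi) p0 => p p0; field; rewrite gt_eqF.
have := mulr_ge0 (ltW y0) (sqr_ge0 y); have := sqr_ge0 y; lra.
Qed.

Lemma KG_halfline : KG G = (16 / pi ^+ 2)%:E.
Proof.
have ratioE f : H1 f ->
    fine (p6 f) / (fine (mass f) ^+ 2 * fine (dnorm f)) = gn_ratio f.
  by move=> Hf; rewrite massE// p6E// dnormE.
apply/eqP; rewrite eq_le; apply/andP; split.
  apply: ge_ereal_sup => _ [f [Hf /eqP fm0] <-]; rewrite ratioE// lee_fin gn_ratio_le//.
  by move: fm0; rewrite massE.
apply/lee_addgt0Pr => e e0; have [f [Hf fm0 fe]] := gn_ratio_ge e0.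
rewrite -leeBlDr//; apply: (@le_trans _ _ (gn_ratio f)%:E); first by rewrite -EFinB lee_fin.
apply: ereal_sup_ubound; exists f; last by rewrite ratioE.
by split=> //; apply/eqP; rewrite massE.
Qed.

Lemma muG_halfline : muG G = mu_halfline R.
Proof.
have p0 := pi_gt0 R; rewrite /muG KG_halfline/=.
have -> : 3 / (16 / pi ^+ 2) = mu_halfline R ^+ 2.
  by rewrite mu_halfline_sqr; move: (pi) p0 => p p0; field; rewrite gt_eqF.
by rewrite sqrtr_sqr ger0_norm// ltW// mu_halfline_gt0.
Qed.

End CriticalMass.

Theorem theorem7p3 (R : realType) (G : metric_graph R) :
  connected_graph G ->
  #|HL G| = 1%N ->
  (forall v : V G, ~ terminal_point v) ->
  [/\ muG G = mu_halfline R,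
      (forall m : R, mu_halfline R < m <= mu_line R ->
         (-oo < Elev G m)%E /\ (Elev G m < 0)%E) &
      (forall m : R, 0 < m ->
         ((exists f : gfun G, H1_mu m f /\ energy f = Elev G m) <->
          mu_halfline R < m <= mu_line R))].
Proof.
move=> conn oneHL noterm; split; first exact: muG_halfline.
- move=> m /andP[hm ml]; split; last exact: Elev_lt0.
  by have [f [_ _ ->]] := exists_ground_state oneHL noterm hm ml; exact: ltNyr.
- move=> m m0; split=> [[f [fm fE]]|/andP[hm ml]].
    exact: (ground_state_mass_itv oneHL noterm conn m0 fm fE).
  have [f [Hf fm ->]] := exists_ground_state oneHL noterm hm ml.
  by exists f; split; [exact/H1_muP|rewrite energyE].
Qed.
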